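(* Let $p'\in[1,\infty)$, $p,q\in[1,\infty]$ and $s>1/p$. Define $s':=s+\min(1/p'-1/p,\,0)$. Let $A\in\mathcal B(\mathbb R^d)$; if $p'<p$, assume moreover that $A$ is bounded. For admissible $n$ let the level $j=j(n)$ be the integer with $|M|^{j}\le |I_n|^{1/(2s'+1)}<|M|^{j+1}$. (1) Let $f\in F_{s,p,q}(K,A)$ for some $K>0$, and let $Z$ be a random field with marginal density $f$ satisfying the standing assumptions on $Z$ and, in addition, the condition $D(a)$ with $a=1$ if $p'\in[1,2]$, respectively with $a=2$ if $p'\in(2,\infty)$. Then there is a constant $C_1>0$, not depending on $n$, such that for all admissible $n$ $$\mathbb E\Big[\int_{\mathbb R^d}|f-\tilde P_jf|^{p'}\,\mathrm d\lambda^d\Big]^{1/p'}\le C_1\,|I_n|^{-s'/(2s'+1)} .$$ (2) Moreover, if $A$ is bounded, $K>0$ is fixed, and $h_0>0$ is fixed, then there is a constant $C_2>0$ such that for all admissible $n$ $$\sup_{f\in F_{s,p,q}(K,A)}\mathbb E\Big[\int_{\mathbb R^d}|f-\tilde P_jf|^{p'}\,\mathrm d\lambda^d\Big]^{1/p'}\le C_2\,|I_n|^{-s'/(2s'+1)}$$ for all dependence structures of the random field $Z$ (with marginal density $f$, satisfying the standing assumptions with the same constants $c_0,c_1,C'$) such that $|f_{Z(s),Z(t)}(z_1,z_2)-f(z_1)f(z_2)|\le h_0$ for all $s\ne t$ in $\mathbb Z^N$ and all $z_1,z_2\in\mathbb R^d$. The constants $C_1,C_2$ depend on the wavelets $\Psi_k$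 ($k=0,\dots,|M|-1$), the matrix $M$, the bound on the mixing rates, the domain $A$, the index $p'$ and the fixed parameters $s,p,q,K,N,d,C'$; $C_1$ depends additionally on the functions $h$ and $\tilde h$ from $D(a)$, and $C_2$ additionally on $h_0$.
   Context: Wavelets. $\lambda^d$ is Lebesgue measure on $\mathbb R^d$, $d\in\mathbb N_+$. $M\in\mathbb R^{d\times d}$ is diagonalizable, $M\mathbb Z^d\subseteq\mathbb Z^d$, all eigenvalues have absolute value $>1$, and $|M|:=|\det M|$. A scaling function $\Phi:\mathbb R^d\to\mathbb R$ generates a multiresolution analysis: there are increasing subspaces $(U_j)_{j\in\mathbb Z}$ of $L^2(\lambda^d)$ with dense union and intersection $\{0\}$, $f\in U_j$ iff $f(M^{-j}\cdot)\in U_0$, and $\{\Phi(\cdot-\gamma):\gamma\in\mathbb Z^d\}$ is an orthonormal basis of $U_0$. Put $\Psi_0:=\Phi$ and $\Psi_k=\sum_{\gamma\in\mathbb Z^d}a_k(\gamma)\Phi(M\cdot-\gamma)$, $k=1,\dots,|M|-1$, where $(a_k(\gamma))$, $0\le k\le |M|-1$ (with $\Phi=\sum_\gamma a_0(\gamma)\Phi(M\cdot-\gamma)$), satisfy $\sum_{\gamma'}a_j(\gamma')a_k(M\gamma+\gamma')=|M|\,\delta(j,k)\delta(\gamma,0)$ and $\sum_\gamma a_0(\gamma)=|M|$; then $\{|M|^{j/2}\Psi_k(M^j\cdot-\gamma):j\in\mathbb Z,1\le k\le|M|-1,\gamma\in\mathbb Z^d\}$ is an orthonormal basis of $L^2(\lambda^d)$.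 All $\Psi_k$ are bounded with support in $[0,L]^d$ for some $L\in\mathbb N_+$, and $\int\Psi_k\,\mathrm d\lambda^d=0$ for $k\ge1$. Write $\Psi_{k,j,\gamma}:=|M|^{j/2}\Psi_k(M^j\cdot-\gamma)$, $\Phi_{j,\gamma}:=\Psi_{0,j,\gamma}$. Besov classes. For $f=\sum_{\gamma}\theta_{0,\gamma}\Phi_{0,\gamma}+\sum_{k=1}^{|M|-1}\sum_{j\ge0}\sum_{\gamma}\upsilon_{k,j,\gamma}\Psi_{k,j,\gamma}$ put $$\|f\|_{s,p,q}:=\|\theta_{0,\cdot}\|_{\ell^p}+\Big(\sum_{k=1}^{|M|-1}\sum_{j\ge0}|M|^{j(s+1/2-1/p)q}\|\upsilon_{k,j,\cdot}\|_{\ell^p}^q\Big)^{1/q}$$ (usual modification if $p=\infty$ or $q=\infty$). $B^s_{p,q}(\mathbb R^d)$ is the set of $f:\mathbb R^d\to\mathbb R$ with such a representation and finite norm (this norm is equivalent to the usual $L^p$-based norm used to define the space). For $K>0$, $A\in\mathcal B(\mathbb R^d)$: $F_{s,p,q}(K,A):=\{f:\mathbb R^d\to[0,\infty):f\in B^s_{p,q}(\mathbb R^d),\int f\,\mathrm d\lambda^d=1,\|f\|_{s,p,q}\le K,\operatorname{supp}f\subseteq A\}$. Standing assumptions on $Z$. $N\in\mathbb N_+$; $Z=\{Z(s):s\in\mathbb Z^N\}$ is an $\mathbb R^d$-valued random field; the $Z(s)$ are identically distributed with bounded density $f$ w.r.t. $\lambda^d$. With $\mathcal F(I)=\sigma(Z(s):s\in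 I)$, $d_\infty(I,J)=\inf\{\|s-t\|_\infty:s\in I,t\in J\}$ and $\alpha(k):=\sup_{I,J\subseteq\mathbb Z^N,\,d_\infty(I,J)\ge k}\sup_{A\in\mathcal F(I),B\in\mathcal F(J)}|\mathbb P(A\cap B)-\mathbb P(A)\mathbb P(B)|$, one has $\alpha(k)\le c_0e^{-c_1k}$ for all $k\in\mathbb N_+$, with constants $c_0,c_1>0$. Index sets are $I_n:=\{s\in\mathbb Z^N:1\le s_i\le n_i\ \forall i\}$; $n\in\mathbb N_+^N$ is admissible if $\min_in_i\ge C'\max_in_i$ for a fixed constant $C'>0$. Condition $D(a)$, $a\in\mathbb N_+$. There are bounded, non-increasing radial functions $h,\tilde h:\mathbb R^d\to[0,\infty)$ (i.e. $h(x)\le h(y)$ whenever $\|x\|_2\ge\|y\|_2$) with $f\le h$ and $|f_{Z(s),Z(t)}(z_1,z_2)-f(z_1)f(z_2)|\le\tilde h(z_1)\tilde h(z_2)$ for all $s\neq t$, where $f_{Z(s),Z(t)}$ is the joint density of $(Z(s),Z(t))$, and $\|h^{1/(2a)}\|_{L^1(\lambda^d)}<\infty$, $\|\tilde h^{1/a}\|_{L^2(\lambda^d)}<\infty$. Linear estimator. $\tilde P_jf:=\sum_{\gamma\in\mathbb Z^d}\hat\theta_{j,\gamma}\Phi_{j,\gamma}$ with $\hat\theta_{j,\gamma}:=|I_n|^{-1}\sum_{s\in I_n}\Phi_{j,\gamma}(Z(s))$. *)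

(* Defs.v *)
From HB Require Import structures.
From mathcomp Require Import all_boot all_order all_algebra finmap.
From mathcomp Require Import complex.
From mathcomp Require Import all_classical all_reals all_analysis.

Set Implicit Arguments.
Unset Strict Implicit.
Unset Printing Implicit Defensive.

Import Order.TTheory GRing.Theory Num.Theory.
Import numFieldNormedType.Exports.

Local Open Scope classical_set_scope.
Local Open Scope ring_scope.

(* The sigma-algebra generated by the entries is the product of the Borel
   sigma-algebras of R, i.e. the Borel sigma-algebra of R^n for 'cV[R]_n. *)

Definition mx_display : measure_display.
Proof. exact: default_measure_display. Qed.

Section measurable_matrix.
Context {R : realType} (m n : nat).

Definition mx_measurable : set (set 'M[R]_(m, n)) :=
  <<s \bigcup_(ij in [set: 'I_m * 'I_n])
        preimage_set_system setT (fun A : 'M[R]_(m, n) => A ij.1 ij.2)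
          measurable >>.

Let mx_measurable0 : mx_measurable set0.
Proof. exact: sigma_algebra0. Qed.

Let mx_measurableC A : mx_measurable A -> mx_measurable (~` A).
Proof. exact: sigma_algebraC. Qed.

Let mx_measurable_bigcup (F : (set 'M[R]_(m, n))^nat) :
  (forall i, mx_measurable (F i)) -> mx_measurable (\bigcup_i F i).
Proof. exact: sigma_algebra_bigcup. Qed.

HB.instance Definition _ := @isMeasurable.Build mx_display 'M[R]_(m, n)
  mx_measurable mx_measurable0 mx_measurableC mx_measurable_bigcup.

Lemma measurable_coord (i : 'I_m) (j : 'I_n) :
  measurable_fun setT (fun A : 'M[R]_(m, n) => A i j).
Proof.
move=> _ Y mY; rewrite setTI; apply: sub_sigma_algebra => /=.
by exists (i, j) => //=; exists Y => //; rewrite setTI.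
Qed.

Lemma measurable_fun_mxP d (T : measurableType d) (f : T -> 'M[R]_(m, n)) :
  (forall i j, measurable_fun setT (fun t => f t i j)) ->
  measurable_fun setT f.
Proof.
move=> mf; apply: (@measurability _ _ _ _ setT f) => //.
move=> _ [_ [[i j] _ [B mB <-]] <-] /=.
by rewrite !setTI; have := mf i j measurableT B mB; rewrite setTI.
Qed.

End measurable_matrix.

Section lebesgue_cV.
Context {R : realType}.

Definition cV_cons n (p : R * 'cV[R]_n) : 'cV[R]_n.+1 :=
  \col_i (if unlift ord0 i is Some j then p.2 j 0 else p.1).

Definition cV_uncons n (v : 'cV[R]_n.+1) : R * 'cV[R]_n :=
  (v ord0 0, \col_i v (lift ord0 i) 0).

Lemma cV_consK n : cancel (@cV_cons n) (@cV_uncons n).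
Proof.
case=> x v; rewrite /cV_uncons /cV_cons mxE unlift_none /=; congr pair.
by apply/colP => i; rewrite !mxE liftK.
Qed.

Lemma measurable_cV_cons n :
  measurable_fun setT (@cV_cons n : measurableTypeR R * _ -> _).
Proof.
apply: measurable_fun_mxP => i j.
rewrite (_ : (fun t => _) = fun p : R * 'cV[R]_n =>
  if unlift ord0 i is Some k then p.2 k 0 else p.1); last first.
  by apply/funext => p; rewrite mxE.
case: (unlift ord0 i) => [k|]; last exact: measurable_fst.
by apply: (measurableT_comp (measurable_coord k 0)); exact: measurable_snd.
Qed.

Lemma measurable_cV_uncons n :
  measurable_fun setT (@cV_uncons n : _ -> measurableTypeR R * _).
Proof.
apply: measurable_fun_pair => /=; first exact: measurable_coord.
apply: measurable_fun_mxP => i j.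
under eq_fun do rewrite mxE.
exact: measurable_coord.
Qed.

Definition leb_succ n (mu : {sigma_finite_measure set 'cV[R]_n -> \bar R}) :
    set 'cV[R]_n.+1 -> \bar R :=
  pushforward (@lebesgue_measure R \x mu)%E (@cV_cons n).

Section leb_succ.
Context n (mu : {sigma_finite_measure set 'cV[R]_n -> \bar R}).

Let leb_succ0 : leb_succ mu set0 = 0%E.
Proof. by rewrite /leb_succ /pushforward preimage_set0 measure0. Qed.

Let leb_succ_ge0 A : (0 <= leb_succ mu A)%E.
Proof. exact: (measure_ge0 (@lebesgue_measure R \x mu)%E). Qed.

Let leb_succ_sigma_additive : semi_sigma_additive (leb_succ mu).
Proof.
move=> F mF tF mUF; rewrite /leb_succ /pushforward preimage_bigcup.
apply: measure_semi_sigma_additive.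
- move=> k; rewrite -[X in measurable X]setTI.
  exact: measurable_cV_cons.
- apply/trivIsetP => /= i j _ _ ij; rewrite -preimage_setI.
  by move/trivIsetP : tF => /(_ _ _ _ _ ij) ->//; rewrite preimage_set0.
- rewrite -preimage_bigcup -[X in measurable X]setTI.
  exact: measurable_cV_cons.
Qed.

HB.instance Definition _ := isMeasure.Build _ _ _ (leb_succ mu)
  leb_succ0 leb_succ_ge0 leb_succ_sigma_additive.

Let leb_succ_sigma_finite : sigma_finite setT (leb_succ mu).
Proof.
have /sigma_finiteP[F [FT ndF Foo]] := sigma_finiteT (@lebesgue_measure R).
have /sigma_finiteP[G [GT ndG Goo]] := sigma_finiteT mu.
exists (fun k => @cV_uncons n @^-1` (F k `*` G k)).
  rewrite -preimage_bigcup (_ : \bigcup_k _ = setT) ?preimage_setT//.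
  rewrite -setXTT FT GT predeqE => -[x y]; split.
    by move=> [k _ []/= ? ?]; split; exists k.
  move=> [/= [k _ Fkx] [l _ Gly]]; exists (maxn k l) => //; split.
  - by move: x Fkx; exact/subsetPset/ndF/leq_maxl.
  - by move: y Gly; exact/subsetPset/ndG/leq_maxr.
move=> k; have [mF Fk] := Foo k; have [mG Gk] := Goo k; split.
  rewrite -[X in measurable X]setTI; apply: measurable_cV_uncons => //.
  exact: measurableX.
rewrite /leb_succ /pushforward /= -comp_preimage.
rewrite (_ : _ \o _ = id); last by apply/funext => x; exact: cV_consK.
by rewrite preimage_id product_measure1E// lte_mul_pinfty// ge0_fin_numE.
Qed.

HB.instance Definition _ := Measure_isSigmaFinite.Build _ _ _ (leb_succ mu)
  leb_succ_sigma_finite.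

End leb_succ.

Fixpoint leb n : {sigma_finite_measure set 'cV[R]_n -> \bar R} :=
  if n is n'.+1 then leb_succ (leb n') else \d_(0 : 'cV[R]_0).


Lemma leb_rectangle n (A : 'I_n -> set (measurableTypeR R)) :
  (forall i, measurable (A i)) ->
  leb n [set x | forall i, A i (x i 0)] = (\prod_(i < n) lebesgue_measure (A i))%E.
Proof.
elim: n A => [|n IH] A mA.
  by rewrite big_ord0 /= diracE mem_set//= => i; have := ltn_ord i.
rewrite big_ord_recl /= /leb_succ /pushforward.
rewrite (_ : _ @^-1` _ =
    A ord0 `*` [set v : 'cV[R]_n | forall i, A (lift ord0 i) (v i 0)]); last first.
  apply/seteqP; split => -[x v] /=.
    move=> H; split => /=; first by have := H ord0; rewrite mxE unlift_none.
    by move=> i; have := H (lift ord0 i); rewrite mxE liftK.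
  by move=> [/= Hx Hv] i; rewrite mxE; case: unliftP => [j|] ->.
rewrite product_measure1E//; first by congr (_ * _)%E; apply: IH => i.
rewrite (_ : mkset _ = \bigcap_(i in [set: 'I_n])
    ((fun v : 'cV[R]_n => v i 0) @^-1` A (lift ord0 i))); last first.
  by apply/seteqP; split => v /= H i; [move=> _|]; apply: H.
apply: fin_bigcap_measurable => // i _.
by rewrite -[X in measurable X]setTI; exact: (@measurable_coord R n 1 i 0 measurableT _ (mA _)).
Qed.

End lebesgue_cV.

Definition zvec {R : realType} {d} (g : 'cV[int]_d) : 'cV[R]_d :=
  map_mx intr g.

Definition absdet {R : realType} {d} (M : 'M[R]_d) : R := `|\det M|.

(* For a matrix preserving the integer lattice [absdet M] is an integer. *)
Definition ndet {R : realType} {d} (M : 'M[R]_d) : nat :=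
  Num.truncn (absdet M).

(* Diagonalizability and eigenvalues are over the complex numbers. *)
Record dilation_matrix {R : realType} {d} (M : 'M[R]_d) : Prop := {
  dilation_diagonalizable : diagonalizable (map_mx (real_complex R) M) ;
  dilation_lattice : forall g : 'cV[int]_d, exists g' : 'cV[int]_d,
    M *m zvec g = zvec g' ;
  dilation_expanding : forall z : R[i],
    eigenvalue (map_mx (real_complex R) M) z -> 1 < `|z| }.

Definition dilate {R : realType} {d} (M : 'M[R]_d.+1) (psi : 'cV[R]_d.+1 -> R)
    (j : int) (g : 'cV[int]_d.+1) (x : 'cV[R]_d.+1) : R :=
  absdet M `^ (j%:~R / 2) * psi (M ^ j *m x - zvec g).

Definition has_sum {R : realType} {I : choiceType} (u : I -> R) (l : R) : Prop :=
  forall e : R, 0 < e -> exists F0 : {fset I}, forall F : {fset I},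
    (F0 `<=` F)%fset -> `|\sum_(i <- F) u i - l| < e.

Definition L2dist {R : realType} {d} (f g : 'cV[R]_d -> R) : \bar R :=
  'N[leb d]_2%:E[(fun x => (f x - g x)%:E)]%E.

(* The subspaces [U j] of L^2 are given as sets of functions stable under
   almost everywhere equality. *)
Record multiresolution {R : realType} {d} (M : 'M[R]_d.+1)
    (Phi : 'cV[R]_d.+1 -> R) (U : int -> set ('cV[R]_d.+1 -> R)) : Prop := {
  mra_L2 : forall j f, U j f -> f \in Lfun (leb d.+1) 2%:E ;
  mra_ae : forall j f g, U j f -> g \in Lfun (leb d.+1) 2%:E ->
    {ae leb d.+1, forall x, f x = g x} -> U j g ;
  mra_zero : forall j, U j (fun=> 0) ;
  mra_linear : forall j (c : R) f g, U j f -> U j g ->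
    U j (fun x => c * f x + g x) ;
  mra_increasing : forall j : int, U j `<=` U (j + 1) ;
  mra_dense : forall f, f \in Lfun (leb d.+1) 2%:E ->
    forall e : R, 0 < e ->
    exists j, exists2 g, U j g & (L2dist f g < e%:E)%E ;
  mra_separated : forall f, (forall j, U j f) ->
    {ae leb d.+1, forall x, f x = 0} ;
  mra_scaling : forall (j : int) f,
    U j f <-> U 0 (fun x => f (M ^ (- j) *m x)) ;
  mra_translate : forall g, U 0 (fun x => Phi (x - zvec g)) ;
  mra_orthonormal : forall g g' : 'cV[int]_d.+1,
    (\int[leb d.+1]_x (Phi (x - zvec g) * Phi (x - zvec g'))%:E =
     ((g == g')%:R)%:E)%E ;
  mra_total : forall f, U 0 f -> forall e : R, 0 < e ->
    exists (F : {fset 'cV[int]_d.+1}) (c : 'cV[int]_d.+1 -> R),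
      (L2dist f (fun x => (\sum_(g <- F) c g * Phi (x - zvec g))%R)
         < e%:E)%E }.

(* [Psi 0] is the scaling function and [Psi k], 1 <= k < |M|, are the mother
   wavelets; the values of [Psi] at k >= |M| are irrelevant. Since the [Psi k]
   have compact support, the sums over all translates in [wav_refinement],
   as those in [besov_partial_sum] and [linear_estimator] below, have at each
   point only finitely many nonzero terms. *)
Record wavelet_system {R : realType} {d} (M : 'M[R]_d.+1)
    (Psi : nat -> 'cV[R]_d.+1 -> R) : Prop := {
  wav_mra : exists U, multiresolution M (Psi 0%N) U ;
  wav_measurable : forall k, (k < ndet M)%N -> measurable_fun setT (Psi k) ;
  wav_bounded : forall k, (k < ndet M)%N ->
    exists B : R, forall x, `|Psi k x| <= B ;
  wav_support : exists2 L : nat, (0 < L)%N & forall k, (k < ndet M)%N ->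
    forall x, Psi k x != 0 -> forall i, 0 <= x i 0 <= L%:R ;
  wav_mean : forall k, (0 < k < ndet M)%N ->
    (\int[leb d.+1]_x (Psi k x)%:E = 0)%E ;
  wav_refinement : exists a : nat -> 'cV[int]_d.+1 -> R,
    [/\ forall k, (k < ndet M)%N -> {ae leb d.+1, forall x,
          Psi k x = \sum_(g \in setT) a k g * Psi 0%N (M *m x - zvec g)},
        forall j k, (j < ndet M)%N -> (k < ndet M)%N ->
          forall g Mg : 'cV[int]_d.+1, zvec Mg = M *m zvec g ->
          has_sum (fun g' => a j g' * a k (Mg + g'))
                  (absdet M * ((j == k) && (g == 0))%:R)
      & has_sum (a 0%N) (absdet M)] }.

(* Meant for 1 <= p <= oo. *)
Definition lnorm {R : realType} {I : choiceType} (p : \bar R) (D : set I)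
    (u : I -> \bar R) : \bar R :=
  match p with
  | r%:E => ((\esum_(i in D) `|u i| `^ r) `^ r^-1)%E
  | _ => ereal_sup [set `|u i|%E | i in D]
  end.

Definition recip {R : realType} (p : \bar R) : R :=
  if p is r%:E then r^-1 else 0.

Section besov.
Context {R : realType} {d : nat} (M : 'M[R]_d.+1)
  (Psi : nat -> 'cV[R]_d.+1 -> R).
Local Notation Rd := ('cV[R]_d.+1).
Local Notation Zd := ('cV[int]_d.+1).

Definition besov_norm (s : R) (p q : \bar R) (theta : Zd -> R)
    (ups : nat -> nat -> Zd -> R) : \bar R :=
  (lnorm p setT (EFin \o theta) +
   lnorm q [set kj : nat * nat | (0 < kj.1 < ndet M)%N]
     (fun kj => (absdet M `^ (kj.2%:R * (s + 2^-1 - recip p)))%:E *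
                lnorm p setT (EFin \o ups kj.1 kj.2)))%E.

Definition besov_partial_sum (theta : Zd -> R) (ups : nat -> nat -> Zd -> R)
    (x : Rd) (J : nat) : R :=
  \sum_(g \in setT) theta g * dilate M (Psi 0%N) 0 g x +
  \sum_(1 <= k < ndet M) \sum_(0 <= j < J)
    \sum_(g \in setT) ups k j g * dilate M (Psi k) j%:Z g x.

(* When s > 1/p and the Besov norm is finite, this series converges uniformly
   and the coefficients are determined by [f]. *)
Definition wavelet_expansion (f : Rd -> R) (theta : Zd -> R)
    (ups : nat -> nat -> Zd -> R) : Prop :=
  {ae leb d.+1, forall x, besov_partial_sum theta ups x @ \oo --> f x}.

Definition besov (s : R) (p q : \bar R) : set (Rd -> R) :=
  [set f | measurable_fun setT f /\
    exists theta ups, wavelet_expansion f theta ups /\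
      (besov_norm s p q theta ups < +oo)%E].

Definition besov_density (s : R) (p q : \bar R) (K : R) (A : set Rd) :
    set (Rd -> R) :=
  [set f | [/\ forall x, 0 <= f x,
    besov s p q f,
    (\int[leb d.+1]_x (f x)%:E = 1)%E,
    exists theta ups, wavelet_expansion f theta ups /\
      (besov_norm s p q theta ups <= K%:E)%E
  & forall x, f x != 0 -> A x]].

End besov.

Definition has_density {R : realType} {dT dU} {T : measurableType dT}
    {U : measurableType dU} (P : probability T R) (X : T -> U)
    (nu : {measure set U -> \bar R}) (f : U -> R) : Prop :=
  [/\ measurable_fun setT f, forall u, 0 <= f u &
      forall B, measurable B -> (P (X @^-1` B) = \int[nu]_(u in B) (f u)%:E)%E].

Section random_field.
Context {R : realType} {d N : nat} {dT} {T : measurableType dT}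
  (P : probability T R) (Z : 'cV[int]_N -> {RV P >-> 'cV[R]_d.+1}).
Local Notation Rd := ('cV[R]_d.+1).
Local Notation ZN := ('cV[int]_N).

Definition field_sigma (I : set ZN) : set (set T) :=
  <<s \bigcup_(s in I) preimage_set_system setT (Z s) measurable >>.

(* The norm of a matrix is the sup norm of its entries. *)
Definition dist_infty (I J : set ZN) : \bar R :=
  ereal_inf [set e | exists s t, [/\ I s, J t & e = (`|s - t|%:~R)%:E]].

Definition alpha_mixing (k : nat) : \bar R :=
  ereal_sup [set e | exists I J A B,
    [/\ (k%:R%:E <= dist_infty I J)%E, field_sigma I A, field_sigma J B &
        e = `|P (A `&` B) - P A * P B|%E]].

Record standing_assumptions (c0 c1 : R) (f : Rd -> R) : Prop := {
  field_density : forall s, has_density P (Z s) (leb d.+1) f ;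
  field_bounded : exists B : R, {ae leb d.+1, forall x, f x <= B} ;
  field_mixing : forall k, (0 < k)%N ->
    (alpha_mixing k <= (c0 * expR (- c1 * k%:R))%:E)%E }.

Definition joint_density (s t : ZN) (f2 : Rd * Rd -> R) : Prop :=
  has_density P (fun w => (Z s w, Z t w)) (leb d.+1 \x leb d.+1)%E f2.

Definition norm2 (x : Rd) : R := Num.sqrt (\sum_i x i 0 ^+ 2).

Definition radial_envelope (h : Rd -> R) : Prop :=
  [/\ forall x, 0 <= h x, exists B : R, forall x, h x <= B &
      forall x y, norm2 y <= norm2 x -> h x <= h y].

Record condition_D (a : nat) (f h ht : Rd -> R) : Prop := {
  D_envelope : radial_envelope h ;
  D_joint_envelope : radial_envelope ht ;
  D_density : {ae leb d.+1, forall x, f x <= h x} ;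
  D_joint : forall s t, s != t -> exists2 f2, joint_density s t f2 &
    forall z1 z2, `|f2 (z1, z2) - f z1 * f z2| <= ht z1 * ht z2 ;
  D_integrable : ('N[leb d.+1]_1%:E
    [(fun x => (h x `^ (2 * a%:R)^-1)%:E)] < +oo)%E ;
  D_joint_integrable : ('N[leb d.+1]_2%:E
    [(fun x => (ht x `^ a%:R^-1)%:E)] < +oo)%E }.

Definition joint_bounded (h0 : R) (f : Rd -> R) : Prop :=
  forall s t, s != t -> exists2 f2, joint_density s t f2 &
    forall z1 z2, `|f2 (z1, z2) - f z1 * f z2| <= h0.

End random_field.

Definition index_box {N} (n : 'I_N -> nat) : set 'cV[int]_N :=
  [set s | forall i, 1 <= s i 0 <= (n i)%:Z].

Definition card_box {N} (n : 'I_N -> nat) : nat := #|` fset_set (index_box n)|.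

(* n in N_+^N with min_i n_i >= C max_i n_i *)
Definition admissible {R : realType} {N} (C : R) (n : 'I_N -> nat) : Prop :=
  (forall i, (0 < n i)%N) /\ (forall i j, C * (n j)%:R <= (n i)%:R).

Section estimator.
Context {R : realType} {d N : nat} (M : 'M[R]_d.+1)
  (Phi : 'cV[R]_d.+1 -> R).
Local Notation Rd := ('cV[R]_d.+1).
Local Notation ZN := ('cV[int]_N).

(* The sample is z : Z^N -> R^d, a realisation of the field. *)
Definition theta_hat (n : 'I_N -> nat) (j : int) (z : ZN -> Rd)
    (g : 'cV[int]_d.+1) : R :=
  (card_box n)%:R^-1 * \sum_(s \in index_box n) dilate M Phi j g (z s).

Definition linear_estimator (n : 'I_N -> nat) (j : int) (z : ZN -> Rd)
    (x : Rd) : R :=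
  \sum_(g \in setT) theta_hat n j z g * dilate M Phi j g x.

Definition estimator_risk {dT} {T : measurableType dT} (P : probability T R)
    (Z : ZN -> {RV P >-> Rd}) (f : Rd -> R) (p' : R) (n : 'I_N -> nat)
    (j : int) : \bar R :=
  ((\int[P]_w \int[leb d.+1]_x
      (`|f x - linear_estimator n j (fun s => Z s w) x| `^ p')%:E)
   `^ p'^-1)%E.

End estimator.

Definition s_prime {R : realType} (s p' : R) (p : \bar R) : R :=
  s + Num.min (p'^-1 - recip p) 0.

Definition level {R : realType} {d N} (M : 'M[R]_d) (s' : R)
    (n : 'I_N -> nat) (j : int) : Prop :=
  absdet M ^ j <= (card_box n)%:R `^ (2 * s' + 1)^-1 < absdet M ^ (j + 1).

(* Main.v *)
Require Import Defs.
From HB Require Import structures.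
From mathcomp Require Import all_boot all_order all_algebra finmap.
From mathcomp Require Import complex.
From mathcomp Require Import all_classical all_reals all_analysis.
From mathcomp Require Import measurable_realfun zify ring lra.

(** The risk is split into a bias, the distance of [f] to its projection onto
    level [j], and a stochastic error, the distance of the estimator to that
    projection; with [b = |det M|] and [n = |I_n|] they are shown to be of order
    [b ^ (-j s')] and [(b ^ j / n) ^ (1/2)], and the level [j] is chosen such that
    both equal [n ^ (-s' / (2 s' + 1))] up to constants ([risk_le]).

    Bias. Compact support makes the refinement equations finite
    ([finite_refinement_exists]), so wavelets of level at least [j] are orthogonal
    to level [j] ([wavelet_orth]) and the projection of [f] is a partial sum of its
    expansion ([projection_partial_sum]). As [s > 1/p], the expansion converges
    uniformly, and the Besov norm makes the tail decay geometrically in every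
    [L^r] with [r >= p] ([integral_tail_powR]). If [p' < p], the error lives on a
    fixed bounded set, and the rate of the exponent [p] transfers to [p']
    ([integral_bias]).

    Stochastic error. A point sees a bounded number of translates of the scaling
    function, so the error is controlled by the sum over [g] of the [p']-th
    absolute moments of the centred empirical coefficients. There are infinitely
    many [g] and [f] need not have compact support, so each of these moments
    must be summable in [g]: it is bounded by [n ^ (-p'/2)] times [v_g], the
    root of the integral of [h Phi_(j,g) ^ 2], for a radial majorant [h] of [f]
    with integrable root ([coef_moment_le]); and the [v_g] sum up to [O (b ^ j)]
    by comparison with the integral of [sqrt h] ([esum_sqrt_env_le]).

    The moment bound must therefore be linear in the standard deviation [v_g],
    although the summands are as large as [b ^ (j/2)]. For the first absolute moment
    this holds for every exponentially mixing field ([sum_norm_le]): sites are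
    grouped by residues modulo powers of two, the sums over well separated residue
    classes are truncated and combined, and exponential mixing makes all losses
    summable over the scales. For high even moments ([field_moment_le]) the power is
    expanded over tuples of sites, each tuple is cut at a large gap, and the
    covariance across the gap is bounded by interpolating between mixing and
    variances; for pairs of distinct sites the bound on the joint densities
    replaces the variances, and for larger groups the sup norm, at most of order
    [sqrt n] at the chosen level, is absorbed by the powers of [sqrt n] that
    are available. A real moment is bounded by the sum of a first and an even one.

    Both parts of the theorem are instances of [risk_le]. In the first one the
    majorant is the given function [h], whose root is integrable as [h] is bounded,
    and the joint densities are within the square of a bound of [ht] of the product
    density. In the second one the majorant is a multiple of the indicator of a ball
    containing [A], by the uniform bound [partial_sum_le] for the densities of a
    Besov ball. *)

Set Implicit Arguments.
Unset Strict Implicit.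
Unset Printing Implicit Defensive.

Import Order.TTheory GRing.Theory Num.Theory.
Import numFieldNormedType.Exports.

Local Open Scope classical_set_scope.
Local Open Scope ring_scope.

(** * Integrals of nonnegative functions *)

Lemma measurable_mem dT (T : measurableType dT) (A : set T) :
  measurable A -> measurable_fun [set: T] (fun x => x \in A).
Proof.
move=> mA; apply: (measurable_fun_bool true).
rewrite setTI (_ : _ @^-1` _ = A)//.
by apply/seteqP; split => x /= => [/set_mem|/mem_set].
Qed.

Section integral_complements.
Context {dT} {T : measurableType dT} {R : realType}.
Variable mu : {measure set T -> \bar R}.
Local Open Scope ereal_scope.

Lemma le_integral_ge0 (f1 f2 : T -> \bar R) : (forall x, 0 <= f1 x) ->
  (forall x, f1 x <= f2 x) -> \int[mu]_x f1 x <= \int[mu]_x f2 x.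
Proof.
move=> f10 f12; have f20 x : 0 <= f2 x by exact: le_trans (f12 x).
rewrite !ge0_integralTE//; apply: ge_ereal_sup => _ [h hf1 <-].
by apply: ereal_sup_ubound; exists h => // x; exact: le_trans (f12 x).
Qed.

(** The exceptional null set is absorbed by a majorant that is +oo there,
    which leaves the integral of [f2] unchanged. *)
Lemma ae_le_integral_ge0 (f1 f2 : T -> \bar R) : (forall x, 0 <= f1 x) ->
  (forall x, 0 <= f2 x) -> measurable_fun [set: T] f2 ->
  {ae mu, forall x, f1 x <= f2 x} -> \int[mu]_x f1 x <= \int[mu]_x f2 x.
Proof.
move=> f10 f20 mf2 [A [mA A0 sub]].
pose g x := if x \in A then +oo else f2 x.
have mg : measurable_fun [set: T] g.
  apply: measurable_fun_ifT => //.
  exact: measurable_mem.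
apply: (@le_trans _ _ (\int[mu]_x g x)).
  apply: le_integral_ge0 => // x; rewrite /g; case: ifPn => xA; first exact: leey.
  by apply: contrapT => h; move/negP: xA; apply; rewrite inE; apply: sub.
suff -> : \int[mu]_x g x = \int[mu]_x f2 x by [].
apply: ge0_ae_eq_integral => //.
  by move=> x _; rewrite /g; case: ifP.
exists A; split => // x; rewrite /= => h; apply: contrapT => xA; apply: h => _.
by rewrite /g; case: ifPn => //; rewrite inE.
Qed.

(** Monotone convergence for unordered sums: a countable index set is enumerated
    by its pickling function, with zeros at the unused numbers. *)
Lemma measurable_esum (I : countType) (F : I -> T -> \bar R) :
  (forall i, measurable_fun [set: T] (F i)) -> (forall i x, 0 <= F i x) ->
  measurable_fun [set: T] (fun x => \esum_(i in [set: I]) F i x) /\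
  \int[mu]_x (\esum_(i in [set: I]) F i x) =
    \esum_(i in [set: I]) (\int[mu]_x F i x).
Proof.
move=> mF F0.
pose G n x := if choice.unpickle n is Some i then if choice.pickle i == n then F i x else 0 else 0.
have esumE (a : I -> \bar R) : (forall i, 0 <= a i) ->
    \esum_(i in [set: I]) a i =
    \sum_(n <oo) (if choice.unpickle n is Some i then if choice.pickle i == n then a i else 0 else 0).
  move=> a0; rewrite nneseries_esumT; last first.
    by move=> n; case: choice.unpickle => // i; case: ifP.
  rewrite [in RHS](_ : setT = [set n | exists i : I, n = choice.pickle i] `|` ~` [set n | exists i : I, n = choice.pickle i]); last by rewrite setUv.
  rewrite (_ : esum (_ `|` _) _ = \esum_(n in [set n | exists i : I, n = choice.pickle i]) (if choice.unpickle n is Some i then if choice.pickle i == n then a i else 0 else 0)).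
    rewrite (@reindex_esum R I nat [set: I] _ choice.pickle).
      by apply: eq_esum => i _; rewrite choice.pickleK eqxx.
    split => [i _|i j _ _|n [i ->]]; first by exists i.
      exact: (pcan_inj choice.pickleK).
    by exists i.
  rewrite setUv [RHS]esum_mkcond; apply: eq_esum => n _.
  case: ifPn => //; rewrite notin_setE /= => h.
  by case E : (choice.unpickle n) => [i|//]; case: eqP => // pi; exfalso; apply: h; exists i.
have G0 n x : 0 <= G n x by rewrite /G; case: choice.unpickle => // i; case: ifP.
have mG n : measurable_fun [set: T] (G n).
  by rewrite /G; case: choice.unpickle => [i|]; [case: eqP => _|]; [exact: mF|exact: measurable_cst..].
have E : (fun x => \esum_(i in [set: I]) F i x) = (fun x => \sum_(n <oo) G n x).
  by apply/funext => x; rewrite esumE.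
split; first by rewrite E; exact: ge0_emeasurable_sum.
rewrite (eq_integral (fun x => \sum_(n <oo) G n x)); last by move=> x _; rewrite esumE.
rewrite integral_nneseries// esumE; last by move=> i; exact: integral_ge0.
apply: eq_eseriesr => n _; rewrite /G.
by case: choice.unpickle => [i|]; [case: eqP => _|]; rewrite ?integral0.
Qed.

End integral_complements.

Section affine1.
Context {R : realType}.
Notation mu := (@lebesgue_measure R).
Local Open Scope ereal_scope.

Lemma ge0_integral_shift1 (b : R) (u : R -> \bar R) :
  measurable_fun [set: R] u -> (forall x, 0 <= u x) ->
  \int[mu]_x u (x + b)%R = \int[mu]_x u x.
Proof.
move=> mu_ u0.
have mf : measurable_fun setT ((fun x => x + b)%R : measurableTypeR R -> measurableTypeR R).
  by apply: measurable_funD; [exact: measurable_id|exact: measurable_cst].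
have := @ge0_integral_pushforward _ _ _ _ _ _ mf mu setT u measurableT mu_ (fun x _ => u0 x).
rewrite preimage_setT /= => <-.
apply: eq_measure_integral => //= A mA _.
apply/esym/lebesgue_measure_unique => //= _ [[x y]] _ <-.
rewrite /pushforward.
rewrite (_ : _ @^-1` _ = `](x - b)%R, (y - b)%R]%classic); last first.
  by apply/seteqP; split => z /=; rewrite !in_itv /= ltrBlDr lerBrDr.
by rewrite !lebesgue_measure_itv /= !lte_fin ltrD2r -!EFinB; case: ifP => // _; congr EFin; ring.
Qed.

Lemma ge0_integral_scale1 (a : R) (u : R -> \bar R) : (a != 0)%R ->
  measurable_fun [set: R] u -> (forall x, 0 <= u x) ->
  `|a|%:E * \int[mu]_x u (a * x)%R = \int[mu]_x u x.
Proof.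
move=> a0 mu_ u0.
have mf : measurable_fun setT ((fun x => a * x)%R : measurableTypeR R -> measurableTypeR R).
  by apply: measurable_funM; [exact: measurable_cst|exact: measurable_id].
pose c : {nonneg R} := NngNum (normr_ge0 a).
transitivity (\int[mscale c mu]_x u (a * x)%R).
  rewrite ge0_integral_mscale//=.
  exact: (measurableT_comp mu_ mf).
have := @ge0_integral_pushforward _ _ _ _ _ _ mf (mscale c mu) setT u measurableT mu_ (fun x _ => u0 x).
rewrite preimage_setT /= => <-.
apply: eq_measure_integral => //= A mA _.
apply/esym/lebesgue_measure_unique => //= _ [[x y]] _ <-.
rewrite /pushforward /mscale /=.
rewrite lebesgue_measure_itv /= lte_fin -EFinB.
have [agt0|] := ltP 0%R a.
  rewrite (_ : _ @^-1` _ = `](x / a)%R, (y / a)%R]%classic); last first.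
    by apply/seteqP; split => z /=; rewrite !in_itv /= ltr_pdivrMr// ler_pdivlMr// mulrC.
  rewrite lebesgue_measure_itv /= lte_fin ltr_pM2r ?invr_gt0// -EFinB.
  case: ifP => _; last by rewrite mule0.
  by rewrite gtr0_norm// -EFinM; congr EFin; field.
rewrite le_eqVlt (negbTE a0) /= => alt0.
rewrite (_ : _ @^-1` _ = `[(y / a)%R, (x / a)%R[%classic); last first.
  by apply/seteqP; split => z /=; rewrite !in_itv /= ltr_ndivlMr// ler_ndivrMr// andbC mulrC.
rewrite lebesgue_measure_itv /= lte_fin ltr_nM2r ?invr_lt0// -EFinB.
case: ifP => _; last by rewrite mule0.
by rewrite ltr0_norm// -EFinM; congr EFin; field.
Qed.

End affine1.

(** * Linear change of variables for Lebesgue measure *)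

Section lebesgue_linear.
Context {R : realType}.
Local Open Scope ereal_scope.

Lemma measurable_mulmx m n k (A : 'M[R]_(m, n)) :
  measurable_fun setT (fun x : 'M[R]_(n, k) => A *m x).
Proof.
apply: measurable_fun_mxP => i j.
under eq_fun do rewrite mxE.
apply: measurable_sum => l.
by apply: measurable_funM; [exact: measurable_cst|exact: measurable_coord].
Qed.

Lemma measurable_addmx m n (c : 'M[R]_(m, n)) :
  measurable_fun setT (fun x : 'M[R]_(m, n) => (x + c)%R).
Proof.
apply: measurable_fun_mxP => i j.
under eq_fun do rewrite mxE.
by apply: measurable_funD; [exact: measurable_coord|exact: measurable_cst].
Qed.

Lemma measurable_comp_mulmx n (A : 'M[R]_n) (u : 'cV[R]_n -> \bar R) :
  measurable_fun [set: 'cV[R]_n] u ->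
  measurable_fun [set: 'cV[R]_n] (fun x => u (A *m x)).
Proof.
by move=> mu; exact: (measurableT_comp mu (measurable_mulmx A)).
Qed.

Lemma leb_tonelli n (u : 'cV[R]_n.+1 -> \bar R) :
  measurable_fun [set: 'cV[R]_n.+1] u -> (forall x, 0 <= u x) ->
  \int[leb n.+1]_x u x =
    \int[lebesgue_measure]_x \int[leb n]_v u (cV_cons (x, v)) /\
  \int[leb n.+1]_x u x =
    \int[leb n]_v \int[lebesgue_measure]_x u (cV_cons (x, v)).
Proof.
move=> mu u0.
have E : \int[leb n.+1]_x u x =
    \int[lebesgue_measure \x leb n]_z u (cV_cons z).
  have := @ge0_integral_pushforward _ _ _ _ _ _ (@measurable_cV_cons R n)
    (lebesgue_measure \x leb n) setT u measurableT mu (fun x _ => u0 x).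
  by rewrite preimage_setT /= => <-.
have mu' : measurable_fun [set: measurableTypeR R * 'cV[R]_n] (u \o @cV_cons R n).
  exact: (measurableT_comp mu (@measurable_cV_cons R n)).
split.
- by rewrite E (@fubini_tonelli1 _ _ (measurableTypeR R) _ R (@lebesgue_measure R) (leb n) _ mu' (fun x => u0 _)).
- by rewrite E (@fubini_tonelli2 _ _ (measurableTypeR R) _ R (@lebesgue_measure R) (leb n) _ mu' (fun x => u0 _)).
Qed.

Lemma measurable_cV_cons_l n (v : 'cV[R]_n) (u : 'cV[R]_n.+1 -> \bar R) :
  measurable_fun [set: 'cV[R]_n.+1] u ->
  measurable_fun [set: R] (fun x => u (cV_cons (x, v))).
Proof.
move=> mu.
have := measurableT_comp mu (@measurable_cV_cons R n).
by move/(@measurable_fun_pair1 _ _ _ _ _ _ _) => /(_ v).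
Qed.

Lemma measurable_cV_cons_r n (x : R) (u : 'cV[R]_n.+1 -> \bar R) :
  measurable_fun [set: 'cV[R]_n.+1] u ->
  measurable_fun [set: 'cV[R]_n] (fun v => u (cV_cons (x, v))).
Proof.
move=> mu.
have := measurableT_comp mu (@measurable_cV_cons R n).
by move/(@measurable_fun_pair2 _ _ _ _ _ _ _) => /(_ x).
Qed.

Lemma cV_consE n (x : R) (v : 'cV[R]_n) : cV_cons (x, v) = col_mx x%:M v.
Proof.
apply/colP => i; rewrite [LHS]mxE; case: (unliftP ord0 i) => [j|] -> /=.
  have -> : lift ord0 j = rshift 1 j by exact: ord_inj.
  exact: (esym (col_mxEd _ _ _ _)).
have -> : ord0 = lshift n (ord0 : 'I_1) by exact: ord_inj.
by apply: (etrans _ (esym (col_mxEu _ _ _ _))); rewrite mxE.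
Qed.

Lemma leb_shift n (c : 'cV[R]_n) (u : 'cV[R]_n -> \bar R) :
  measurable_fun [set: 'cV[R]_n] u -> (forall x, 0 <= u x) ->
  \int[leb n]_x u (x + c)%R = \int[leb n]_x u x.
Proof.
elim: n c u => [c u _ _|n IH c u mu u0].
  by apply: eq_integral => x _; congr u; apply/colP => -[].
rewrite (proj1 (leb_tonelli _ _))//; last exact: measurableT_comp mu (measurable_addmx c).
rewrite (proj1 (leb_tonelli _ _))//.
have [c1 [c2 ->]] : exists c1 c2, c = cV_cons (c1, c2).
  exists (c ord0 ord0), (\col_i c (lift ord0 i) ord0).
  by apply/colP => i; rewrite !mxE; case: unliftP => [j|] ->; rewrite ?mxE.
have addE (x : R) v : (cV_cons (x, v) + cV_cons (c1, c2))%R = cV_cons ((x + c1)%R, (v + c2)%R).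
  by apply/colP => i; rewrite !mxE; case: unlift => [j|] /=; rewrite ?mxE.
transitivity (\int[lebesgue_measure]_x \int[leb n]_v u (cV_cons ((x + c1)%R, v))).
  apply: eq_integral => x _; under eq_integral do rewrite addE.
  by rewrite (IH c2 (fun v => u (cV_cons ((x + c1)%R, v))))//; exact: measurable_cV_cons_r.
rewrite (ge0_integral_shift1 c1 (u := fun x => \int[leb n]_v u (cV_cons (x, v))))//.
  apply: (measurable_fun_fubini_tonelli_F (u \o @cV_cons R n)) => //.
    exact: (measurableT_comp mu (@measurable_cV_cons R n)).
  by move=> x; exact: u0.
by move=> x; exact: integral_ge0.
Qed.

(** Stated as an identity with the factor on the left, the change of variables
    formula is visibly stable under products of matrices. *)
Definition lincov n (A : 'M[R]_n) := forall u : 'cV[R]_n -> \bar R,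
  measurable_fun [set: 'cV[R]_n] u -> (forall x, 0 <= u x) ->
  `|\det A|%:E * \int[leb n]_x u (A *m x) = \int[leb n]_x u x.

Lemma lincovM n (A B : 'M[R]_n) : lincov A -> lincov B -> lincov (A *m B).
Proof.
move=> hA hB u mu u0; rewrite det_mulmx normrM EFinM -muleA.
under eq_integral do rewrite -mulmxA.
rewrite (hB (fun x => u (A *m x)))//; first exact: hA.
exact: measurable_comp_mulmx.
Qed.

(** For fixed last coordinates a shear only translates the first one. *)
Lemma lincov_upper n (r : 'rV[R]_n) :
  lincov (block_mx 1%:M r 0%R 1%:M).
Proof.
move=> u mu u0; rewrite det_ublock !det1 mulr1 normr1 mul1e.
rewrite (proj2 (leb_tonelli _ _))//; last exact: measurable_comp_mulmx.
rewrite [RHS](proj2 (leb_tonelli _ _))//.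
apply: eq_integral => v _.
transitivity (\int[lebesgue_measure]_x u (cV_cons ((x + (r *m v) ord0 ord0)%R, v))).
  apply: eq_integral => x _; congr u; rewrite !cV_consE mul_block_col !mul1mx mul0mx add0r.
  by rewrite raddfD /= -mx11_scalar.
rewrite (ge0_integral_shift1 _ (u := fun x => u (cV_cons (x, v))))//.
exact: measurable_cV_cons_l.
Qed.

Lemma lincov_lower n (c : 'cV[R]_n) :
  lincov (block_mx 1%:M 0%R c 1%:M).
Proof.
move=> u mu u0; rewrite det_lblock !det1 mulr1 normr1 mul1e.
rewrite (proj1 (leb_tonelli _ _))//; last exact: measurable_comp_mulmx.
rewrite [RHS](proj1 (leb_tonelli _ _))//.
apply: eq_integral => x _.
transitivity (\int[leb n]_v u (cV_cons (x, (v + c *m x%:M)%R))).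
  apply: eq_integral => v _; congr u; rewrite !cV_consE mul_block_col !mul1mx mul0mx addr0.
  by rewrite addrC.
rewrite (leb_shift _ (u := fun v => u (cV_cons (x, v))))//.
exact: measurable_cV_cons_r.
Qed.

Lemma lincov_diag n (a : R) (B : 'M[R]_n) : (a != 0)%R -> lincov B ->
  lincov (block_mx (a%:M : 'M[R]_1) 0%R 0%R B).
Proof.
move=> a0 hB u mu u0; rewrite det_ublock det_scalar1 normrM EFinM.
rewrite (proj1 (leb_tonelli _ _))//; last exact: measurable_comp_mulmx.
rewrite [RHS](proj1 (leb_tonelli _ _))//.
have mF : measurable_fun [set: R] (fun x => \int[leb n]_v u (cV_cons (x, v))).
  apply: (measurable_fun_fubini_tonelli_F (u \o @cV_cons R n)).
    exact: (measurableT_comp mu (@measurable_cV_cons R n)).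
  by move=> x; exact: u0.
have F0 (x : R) : 0 <= \int[leb n]_v u (cV_cons (x, v)) by exact: integral_ge0.
rewrite -(ge0_integral_scale1 a0 mF F0) -muleA; congr (_ * _).
set D := block_mx _ _ _ _; change 'M[R]_n.+1 in (type of D).
have E (x : R) : `|\det B|%:E * \int[leb n]_v u (D *m cV_cons (x, v)) =
    \int[leb n]_v u (cV_cons ((a * x)%R, v)).
  rewrite -(hB (fun v => u (cV_cons ((a * x)%R, v))))//; last exact: measurable_cV_cons_r.
  congr (_ * _); apply: eq_integral => v _; congr u.
  rewrite !cV_consE.
  have H := mul_block_col (a%:M : 'M[R]_1) 0%R 0%R B (x%:M : 'M[R]_1) v.
  apply: (etrans H); by rewrite !mul0mx add0r addr0 -scalar_mxM.
have mD : measurable_fun [set: R * 'cV[R]_n] (fun z : measurableTypeR R * 'cV[R]_n => u (D *m cV_cons z)).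
  exact: (measurableT_comp (measurable_comp_mulmx D mu) (@measurable_cV_cons R n)).
rewrite -ge0_integralZl//; first by apply: eq_integral => x _; rewrite E.
- by apply: (measurable_fun_fubini_tonelli_F (fun z : R * 'cV[R]_n => u (D *m cV_cons z))).
- by move=> x _; exact: integral_ge0.
Qed.

(** Block Gaussian elimination: with a nonzero pivot a matrix is a product of a
    lower shear, a block diagonal matrix of smaller size and an upper shear; a
    vanishing pivot is made nonzero by one further shear. *)
Lemma lincov_unitmx n (A : 'M[R]_n) : A \in unitmx -> lincov A.
Proof.
elim: n A => [A _ u mu u0|n IH].
  rewrite det_mx00 normr1 mul1e; apply: eq_integral => x _.
  by congr u; apply/colP => -[].
have base (A : 'M[R]_(1 + n)) : A \in unitmx -> A ord0 ord0 != 0%R -> lincov A.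
  move=> uA a0; set a := A ord0 ord0.
  have aE : ulsubmx A = a%:M by rewrite [LHS]mx11_scalar !mxE; congr (A _ _)%:M; exact: ord_inj.
  (* The block remaining after eliminating the first column. *)
  pose S := (drsubmx A - dlsubmx A *m (a^-1%:M *m ursubmx A))%R.
  have AE : A = block_mx 1%:M 0%R (dlsubmx A *m a^-1%:M) 1%:M *m
      (block_mx a%:M 0%R 0%R S *m block_mx 1%:M (a^-1%:M *m ursubmx A) 0%R 1%:M).
    rewrite !mulmx_block !mulmx1 !mul1mx !mulmx0 !mul0mx !addr0 !add0r.
    rewrite -mulmxA -scalar_mxM mulVf// mulmx1 -!mulmxA (mulmxA a%:M) -scalar_mxM mulfV// mul1mx.
    by rewrite /S addrCA subrr addr0 -aE submxK.
  have uS : S \in unitmx.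
    move: uA; rewrite AE !unitmxE !det_mulmx det_lblock !det1 !det_ublock !det1 !mulr1 ?mul1r.
    by rewrite unitrM => /andP[].
  rewrite AE; apply: lincovM; first exact: lincov_lower.
  by apply: lincovM; [apply: lincov_diag => //; exact: IH|exact: lincov_upper].
change (forall A : 'M[R]_(1 + n), A \in unitmx -> lincov A) => A uA.
have [/base|] := boolP (A ord0 ord0 != 0%R); first exact.
rewrite negbK => /eqP a0.
have [i ci] : exists i : 'I_n, A (rshift 1 i) ord0 != 0%R.
  apply: contrapT => h.
  have : A *m (delta_mx ord0 ord0 : 'cV_(1 + n)) = 0%R.
    apply/colP => k; rewrite -colE !mxE; case: (splitP k) => [j kj|j kj].
      by rewrite (_ : k = ord0) ?a0//; apply: ord_inj; rewrite kj (ord1 j).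
    rewrite (_ : k = rshift 1 j); last exact: ord_inj.
    by apply/eqP; apply: contrapT => /negP hj; apply: h; exists j.
  move/(congr1 (mulmx (invmx A))); rewrite mulKmx// mulmx0 => /colP/(_ ord0).
  by rewrite !mxE !eqxx => /eqP; rewrite oner_eq0.
(* Adding row [i] to the first one creates a nonzero pivot. *)
pose E (b : R) : 'M[R]_(1 + n) := block_mx 1%:M (b *: delta_mx ord0 i)%R 0%R 1%:M.
have uE b : E b \in unitmx.
  by rewrite unitmxE det_ublock !det1 mulr1 unitr1.
have EE : A = E (-1)%R *m (E 1%R *m A).
  rewrite mulmxA mulmx_block !mulmx1 !mul1mx !mulmx0 !mul0mx !addr0 !add0r -scalerDl subrr scale0r.
  by rewrite -scalar_mx_block mul1mx.
rewrite EE; apply: lincovM; first exact: lincov_upper.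
apply: base; first by rewrite unitmx_mul uE.
rewrite -[A in E 1%R *m A]submxK mulmx_block /block_mx.
rewrite (_ : ord0 = lshift n (ord0 : 'I_1)); last exact: ord_inj.
rewrite col_mxEu row_mxEl mul1mx scale1r !mxE.
rewrite (bigD1 i)//= big1 => [|k ki]; last by rewrite !mxE (negbTE ki) andbF mul0r.
rewrite !mxE !eqxx mul1r addr0.
have -> : lshift n (ord0 : 'I_1) = ord0 by exact: ord_inj.
by rewrite a0 add0r.
Qed.

Lemma ge0_integral_affine n (A : 'M[R]_n) (c : 'cV[R]_n) (u : 'cV[R]_n -> \bar R) :
  A \in unitmx -> measurable_fun [set: 'cV[R]_n] u -> (forall x, 0 <= u x) ->
  \int[leb n]_x u (A *m x + c)%R = `|\det A|^-1%:E * \int[leb n]_x u x.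
Proof.
move=> uA mu u0.
have d0 : (0 < `|\det A|)%R by rewrite normr_gt0 -unitfE -unitmxE.
have := lincov_unitmx uA (u := fun x => u (x + c)%R).
rewrite leb_shift// => <-//; last exact: measurableT_comp mu (measurable_addmx c).
by rewrite muleA -EFinM mulVf ?mul1e// gt_eqF.
Qed.

End lebesgue_linear.

(** * Dilation matrices *)

Section dilation.
Context {R : realType} {d : nat}.
Variables (M : 'M[R]_d.+1).
Hypothesis dM : dilation_matrix M.
Local Notation toC := (real_complex R).

Lemma normr_toC (x : R) : `|toC x| = toC `|x|.
Proof. by rewrite normc_def /= expr0n /= addr0 sqrtr_sqr. Qed.

Lemma dilation_diag : exists (P : 'M[R[i]]_d.+1) (D : 'rV[R[i]]_d.+1),
  [/\ P \in unitmx, P *m map_mx toC M = diag_mx D *m P &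
      forall i, 1 < `|D 0 i|].
Proof.
have [P uP /diagonalizable_forPex[D PD]] := dilation_diagonalizable dM.
have {}PD := simmxP uP PD.
exists P, D; split => // i; apply: (dilation_expanding dM).
apply/eigenvalueP; exists (row i P).
  by rewrite -row_mul PD row_mul row_diag_mx -scalemxAl -rowE.
apply/negP => /eqP Pi0.
have : row i P *m invmx P = 0 by rewrite Pi0 mul0mx.
rewrite -row_mul mulmxV// => /rowP/(_ i); rewrite !mxE eqxx => /eqP.
by rewrite oner_eq0.
Qed.

Lemma absdet_gt1 : 1 < absdet M.
Proof.
have [P [D [uP PD D1]]] := dilation_diag.
have dP : \det P != 0 by rewrite -unitfE -unitmxE.
have : toC (absdet M) = \prod_i `|D 0 i|.
  rewrite /absdet -normr_toC -normr_prod; congr `|_|.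
  have := congr1 determinant PD; rewrite !det_mulmx det_map_mx det_diag mulrC.
  by move/(mulIf dP).
move=> E; have : 1 < toC (absdet M).
  rewrite E big_ord_recl.
  have D0 : 1 <= \prod_(i < d) `|D 0 (lift ord0 i)|.
    elim/big_ind : _ => // [x y x1 y1|i _]; last exact/ltW/D1.
    by rewrite -[1]mulr1 ler_pM.
  apply: (lt_le_trans (D1 ord0)).
  by rewrite ler_peMr.
by rewrite (_ : 1 = toC 1) ?ltcR.
Qed.

Lemma dilation_unit j : M ^+ j \in unitmx.
Proof.
have dM0 : \det M != 0.
  apply/negP => /eqP d0; have := absdet_gt1; rewrite /absdet d0 normr0.
  by rewrite ltr10.
have : M \is a GRing.unit by rewrite -[_ \is a _]/(M \in unitmx) unitmxE unitfE.
by move=> uM; exact: (unitrX j uM).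
Qed.

Lemma absdetX j : absdet (M ^+ j) = absdet M ^+ j.
Proof.
elim: j => [|j IH]; first by rewrite /absdet expr0 det1 normr1.
by rewrite exprS /absdet -[M * _]/(M *m _) det_mulmx normrM -!/(absdet _) IH exprS.
Qed.

(** In an eigenbasis [M ^+ j] multiplies each coordinate by a number of modulus at
    least one, so going back through it is bounded uniformly in [j]. This is what
    keeps the supports of all dilates of a compactly supported function within a
    fixed distance of their base points. *)
Lemma dilation_expand : exists2 Lam : R, 1 <= Lam &
  forall j (x : 'cV[R]_d.+1) (b : R), (forall i, `|(M ^+ j *m x) i 0| <= b) ->
    forall i, `|x i 0| <= Lam * b.
Proof.
have [P [D [uP PD D1]]] := dilation_diag.
pose Q := invmx P.
(* Bound for the row sums of [|P^-1| |P|], which are real complex numbers. *)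
pose LC : R[i] := 1 + \sum_a \sum_i `|Q a i| * \sum_l `|P i l|.
have LC_real : LC \is Num.real.
  rewrite /LC rpredD// ?real1//; apply: rpred_sum => a _; apply: rpred_sum => i _.
  by rewrite realM// ?normr_real//; apply: rpred_sum => l _; rewrite normr_real.
have sum_ge0 a i : 0 <= `|Q a i| * \sum_l `|P i l|.
  by rewrite mulr_ge0// sumr_ge0.
have LC1 : 1 <= LC by rewrite lerDl; do 2 (apply: sumr_ge0 => ? _).
have LCle a : \sum_i `|Q a i| * \sum_l `|P i l| <= LC.
  rewrite /LC [X in 1 + X](bigD1 a)//= addrCA lerDl addr_ge0//.
  by apply: sumr_ge0 => ? _; apply: sumr_ge0 => ? _.
have [Lam LamE] : exists k, LC = toC k by apply/complex_realP.
exists Lam; first by rewrite -lecR -LamE.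
move=> j x b hb a; rewrite -lecR rmorphM /= -LamE -normr_toC.
have b0 : 0 <= toC b by rewrite ler0c; exact: le_trans (hb ord0).
pose xc := map_mx toC x; pose y := M ^+ j *m x.
have PDj : P *m map_mx toC (M ^+ j) = diag_mx (\row_i D 0 i ^+ j) *m P.
  elim: j {hb y} => [|j IH].
    rewrite expr0 map_mx1 mulmx1 (_ : diag_mx _ = 1%:M) ?mul1mx//.
    by apply/matrixP => u v; rewrite !mxE expr0.
  rewrite exprSr map_mxM mulmxA IH -mulmxA PD mulmxA; congr (_ *m _).
  rewrite mul_diag_mx; apply/matrixP => u v; rewrite !mxE exprSr.
  by case: (u =P v) => [->|]; rewrite ?mulr1n ?mulr0n ?mulr0.
have Py i : (P *m map_mx toC y) i 0 = D 0 i ^+ j * (P *m xc) i 0.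
  by rewrite /y map_mxM mulmxA PDj -mulmxA mul_diag_mx !mxE.
have Px i : `|(P *m xc) i 0| <= toC b * \sum_l `|P i l|.
  apply: (@le_trans _ _ `|(P *m map_mx toC y) i 0|).
    rewrite Py normrM normrX ler_peMl// exprn_ege1//; exact/ltW.
  rewrite mxE (le_trans (ler_norm_sum _ _ _))// mulr_sumr ler_sum// => l _.
  by rewrite normrM mulrC ler_wpM2r// mxE normr_toC lecR.
have -> : toC (x a 0) = (Q *m (P *m xc)) a 0 by rewrite mulKmx// mxE.
rewrite mxE (le_trans (ler_norm_sum _ _ _))//.
apply: (@le_trans _ _ (\sum_i `|Q a i| * (toC b * \sum_l `|P i l|))).
  by apply: ler_sum => i _; rewrite normrM ler_wpM2l.
rewrite [leLHS](_ : _ = (\sum_i `|Q a i| * \sum_l `|P i l|) * toC b).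
  by apply: ler_wpM2r => //; exact: LCle.
by rewrite mulr_suml; apply: eq_bigr => i _; rewrite mulrCA mulrC.
Qed.

End dilation.

(** * Lattice points seen by a compactly supported function *)

Section fsum_complements.
Context {R : realType} {I : choiceType}.

Lemma fsumT_fset (F : I -> R) (G : {fset I}) :
  (forall i, F i != 0 -> i \in G) -> \sum_(i \in setT) F i = \sum_(i <- G) F i.
Proof.
move=> FG; rewrite (fsbig_seq _ F (fset_uniq G)); apply/esym/fsbig_widen => //.
move=> i /= [_ iG]; apply: contrapT => /eqP Fi; apply: iG; exact: FG.
Qed.

(** Comparison of the sum with its largest term; this crude form of convexity also
    covers exponents below one. *)
Lemma powR_sum_le (J : finType) (a : J -> R) (r : R) : 0 < r ->
  `|\sum_i a i| `^ r <= #|J|%:R `^ r * \sum_i `|a i| `^ r.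
Proof.
move=> r0; case: (pickP (fun _ : J => true)) => [i0 _|J0]; last first.
  by rewrite !big_pred0// mulr0 normr0 powR0// gt_eqF.
pose i := [arg max_(i > i0) `|a i|]%O.
have ai k : `|a k| <= `|a i|.
  by rewrite /i; case: arg_maxP => // l _ /(_ k isT).
apply: (@le_trans _ _ ((#|J|%:R * `|a i|) `^ r)).
  rewrite ge0_ler_powR ?nnegrE ?mulr_ge0 ?(ltW r0)//.
  rewrite (le_trans (ler_norm_sum _ _ _))//.
  rewrite (le_trans (ler_sum _ (fun k _ => ai k)))//.
  by rewrite sumr_const mulr_natl.
rewrite powRM// ler_wpM2l ?powR_ge0// (bigD1 i)//= lerDl sumr_ge0//.
Qed.

End fsum_complements.

Section lattice.
Context {R : realType} {n : nat}.
Local Notation Rn := ('cV[R]_n).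
Local Notation Zn := ('cV[int]_n).

Definition supp_cube (L : nat) (psi : Rn -> R) :=
  forall x, psi x != 0 -> forall i, 0 <= x i 0 <= L%:R.

Lemma zvecD (g h : Zn) : zvec (g + h) = zvec g + zvec h :> Rn.
Proof. by apply/matrixP => i j; rewrite !mxE intrD. Qed.

Lemma zvecB (g h : Zn) : zvec (g - h) = zvec g - zvec h :> Rn.
Proof. by apply/matrixP => i j; rewrite !mxE intrD rmorphN. Qed.

Lemma zvec_inj : injective (@zvec R n).
Proof.
move=> g h gh; apply/matrixP => i j.
by have /matrixP/(_ i j) := gh; rewrite !mxE => /intr_inj.
Qed.

(** The integer points [g] with [y - g] in the cube of side [L] have coordinates
    [floor y_i - k] with [k <= L]. Indexing them by a type that is the same for all
    [y] turns a locally finite lattice sum into a sum of fixed length, and makes it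
    measurable in [y]. *)
Definition lat (L : nat) (y : Rn) (e : {ffun 'I_n -> 'I_L.+1}) : Zn :=
  \col_i (Num.floor (y i 0) - (e i : nat)%:Z).

Lemma lat_inj L y : injective (@lat L y).
Proof.
move=> e f ef; apply/ffunP => i; apply: ord_inj.
have /colP/(_ i) := ef; rewrite !mxE => /addrI/oppr_inj.
by move=> [].
Qed.

Lemma lat_cover L psi y (g : Zn) : supp_cube L psi ->
  psi (y - zvec g) != 0 -> exists e, g = @lat L y e.
Proof.
move=> sp /sp h.
have H i : {k : 'I_L.+1 | g i 0 = Num.floor (y i 0) - (k : nat)%:Z}.
  apply: cid; move: (h i); rewrite !mxE => /andP[h1 h2].
  have f1 : g i 0 <= Num.floor (y i 0) by rewrite floor_ge_int -subr_ge0.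
  have f2 : Num.floor (y i 0) - g i 0 <= L%:Z.
    rewrite -(ler_int R) intrD rmorphN /=; apply: le_trans h2.
    by rewrite lerB// floor_le.
  have [m mE] : exists m : nat, Num.floor (y i 0) - g i 0 = m%:Z.
    by exists (absz (Num.floor (y i 0) - g i 0)%R); rewrite gez0_abs// subr_ge0.
  have mL : (m < L.+1)%N by rewrite ltnS -lez_nat -mE.
  by exists (Ordinal mL) => /=; rewrite -mE opprB addrC subrK.
exists [ffun i => proj1_sig (H i)]; apply/colP => i; rewrite !mxE ffunE.
by case: (H i) => k /= ->; congr (_ - _).
Qed.

Definition latset (L : nat) (y : Rn) : {fset Zn} := [fset g in codom (@lat L y)]%fset.

Lemma latsetP L psi y (g : Zn) : supp_cube L psi ->
  psi (y - zvec g) != 0 -> g \in latset L y.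
Proof. by move=> sp /(lat_cover sp)[e ->]; rewrite inE; exact: codom_f. Qed.

Lemma fsum_lat L psi y (c : Zn -> R) : supp_cube L psi ->
  \sum_(g \in setT) c g * psi (y - zvec g) =
  \sum_e c (@lat L y e) * psi (y - zvec (lat y e)).
Proof.
move=> sp; rewrite (fsumT_fset (G := latset L y)); last first.
  by move=> g; rewrite mulf_eq0 negb_or => /andP[_]; exact: latsetP.
rewrite (perm_big (codom (@lat L y))) /=; last first.
  apply: uniq_perm; rewrite ?fset_uniq//.
    by rewrite map_inj_uniq ?enum_uniq//; exact: lat_inj.
  by move=> g; rewrite inE.
by rewrite big_map big_enum.
Qed.

End lattice.

(** * Bounded functions of compact support and their dilates *)

(** A selection among countably many measurable functions, made on measurable
    pieces; it is applied with pieces on which the floors of all coordinates are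
    constant. *)
Lemma measurable_countable_glue dT (T : measurableType dT) dU
    (U : measurableType dU) (I : countType) (G : T -> I) (H : I -> T -> U) :
  (forall i, measurable (G @^-1` [set i])) ->
  (forall i, measurable_fun [set: T] (H i)) ->
  measurable_fun [set: T] (fun x => H (G x) x).
Proof.
move=> mG mH _ Y mY; rewrite setTI.
rewrite (_ : _ @^-1` Y = \bigcup_n
    (if choice.unpickle n is Some i then G @^-1` [set i] `&` H i @^-1` Y else set0)).
  apply: bigcupT_measurable => k; case: choice.unpickle => [i|//].
  by apply: measurableI => //; rewrite -[_ @^-1` Y]setTI; exact: mH.
apply/seteqP; split => x /=.
  by move=> Yx; exists (choice.pickle (G x)) => //=; rewrite choice.pickleK.
by move=> [k _]; case: choice.unpickle => [i|//] [/= -> ].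
Qed.

Section euclidean.
Context {R : realType} {n : nat}.
Local Notation Rn := ('cV[R]_n).
Local Notation Zn := ('cV[int]_n).

Lemma measurable_coord_set (i : 'I_n) (A : set R) : measurable A ->
  measurable [set x : Rn | A (x i 0)].
Proof.
by move=> mA; rewrite -[X in measurable X]setTI; exact: (@measurable_coord R n 1 i 0 measurableT _ mA).
Qed.

Lemma measurable_forall (A : 'I_n -> set R) : (forall i, measurable (A i)) ->
  measurable [set x : Rn | forall i, A i (x i 0)].
Proof.
move=> mA; rewrite (_ : mkset _ = \bigcap_(i in [set: 'I_n]) [set x : Rn | A i (x i 0)]).
  by apply: fin_bigcap_measurable => // i _; exact: measurable_coord_set.
by apply/seteqP; split => x /= h i => [_|]; exact: h.
Qed.

Lemma measurable_lat L (e : {ffun 'I_n -> 'I_L.+1}) (g : Zn) :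
  measurable ((fun y : Rn => lat y e) @^-1` [set g]).
Proof.
pose A i := `[(g i 0 + (e i : nat)%:Z)%:~R, (g i 0 + (e i : nat)%:Z + 1)%:~R[%classic : set R.
rewrite (_ : _ @^-1` _ = [set x : Rn | forall i, A i (x i 0)]).
  by apply: measurable_forall => i; exact: measurable_itv.
apply/seteqP; split => y /=.
  move=> /colP h i; have := h i; rewrite !mxE /A /= in_itv /= => <-.
  by rewrite subrK; exact: floor_itv.
move=> h; apply/colP => i; rewrite !mxE; have := h i; rewrite /A /= in_itv /= => hi.
by rewrite (floor_def hi) addrK.
Qed.

Lemma measurable_lat_sum L (psi : Rn -> R) (c : Zn -> R) :
  measurable_fun [set: Rn] psi -> supp_cube L psi ->
  measurable_fun [set: Rn] (fun y => \sum_(g \in setT) c g * psi (y - zvec g)).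
Proof.
move=> mpsi sp; under eq_fun do rewrite (fsum_lat _ _ sp).
apply: measurable_sum => e.
apply: (@measurable_countable_glue _ Rn _ R _ (fun y : Rn => lat y e)
  (fun g y => c g * psi (y - zvec g))) => g; first exact: measurable_lat.
apply: measurable_funM; first exact: measurable_cst.
exact: (measurableT_comp mpsi (measurable_addmx _)).
Qed.

Lemma measurable_cube (a b : R) :
  measurable [set x : Rn | forall i, a <= x i 0 <= b].
Proof.
rewrite (_ : mkset _ = [set x : Rn | forall i, `[a, b]%classic (x i 0)]).
  by apply: (@measurable_forall (fun=> `[a, b]%classic)) => i; exact: measurable_itv.
by apply/seteqP; split => x /= h i; have := h i; rewrite /= in_itv.
Qed.

Lemma leb_cube (a b : R) : a <= b ->
  leb n [set x : Rn | forall i, a <= x i 0 <= b] = ((b - a) ^+ n)%:E.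
Proof.
move=> ab; rewrite (_ : mkset _ = [set x : Rn | forall i, `[a, b]%classic (x i 0)]).
  rewrite (@leb_rectangle R n (fun=> `[a, b]%classic)) => [|i]; last exact: measurable_itv.
  rewrite (eq_bigr (fun=> (b - a)%:E)) => [|i _].
    by rewrite prodEFin prodr_const card_ord.
  rewrite lebesgue_measure_itv /= lte_fin; move: ab; rewrite le_eqVlt => /orP[/eqP ->|->].
    by rewrite ltxx subrr.
  by rewrite EFinB.
by apply/seteqP; split => x /= h i; have := h i; rewrite /= in_itv.
Qed.

(** Bounded, compactly supported, measurable: the class is stable under products
    with bounded functions and consists of integrable functions, which settles the
    integrability of every product of wavelets below. *)
Definition bcs (u : Rn -> R) := [/\ measurable_fun [set: Rn] u,
  exists B : R, forall x, `|u x| <= B &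
  exists b : R, forall x, u x != 0 -> forall i, `|x i 0| <= b].

Lemma bcs_mul (v u : Rn -> R) : measurable_fun [set: Rn] v ->
  (exists B : R, forall x, `|v x| <= B) -> bcs u -> bcs (fun x => v x * u x).
Proof.
move=> mv [B vB] [mu [C uC] [b ub]]; split; first exact: measurable_funM.
  by exists (B * C) => x; rewrite normrM ler_pM.
by exists b => x; rewrite mulf_eq0 negb_or => /andP[_ /ub].
Qed.

Lemma bcs_bounded (u : Rn -> R) : bcs u -> exists B : R, forall x, `|u x| <= B.
Proof. by case. Qed.

Lemma bcs_measurable (u : Rn -> R) : bcs u -> measurable_fun [set: Rn] u.
Proof. by case. Qed.

Lemma bcs_integrable (u : Rn -> R) : bcs u -> (leb n).-integrable setT (EFin \o u).
Proof.
move=> [mu [B uB] [b ub]]; pose b' := Num.max b 0.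
pose E := [set x : Rn | forall i, - b' <= x i 0 <= b'].
have bb : - b' <= b' by rewrite ge0_cp// le_max lexx orbT.
have mE : measurable E by exact: measurable_cube.
have iE : (leb n).-integrable E (EFin \o u).
  apply: measurable_bounded_integrable => //.
  - by rewrite [X in (X < _)%E](leb_cube bb) ltry.
  - exact: measurable_funTS.
  - by exists B; split => [|y By x _]; [exact: num_real|exact: le_trans (uB x) (ltW By)].
move/(integrable_mkcond _ mE) : iE; congr (_.-integrable _ _).
apply/funext => x; rewrite patchE; case: ifPn => // xE.
congr EFin; apply/esym/eqP; apply: contraNT xE => ux.
by rewrite inE => i; rewrite -ler_norml (le_trans (ub x ux i))// le_max lexx.
Qed.

Lemma integrable_affine (A : 'M[R]_n) (c : 'cV[R]_n) (u : Rn -> R) :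
  A \in unitmx -> (leb n).-integrable setT (EFin \o u) ->
  (leb n).-integrable setT (EFin \o (fun x => u (A *m x + c))).
Proof.
move=> uA iu; have mu := measurable_int _ iu; move/integrableP : iu => [_ ui].
have mA : measurable_fun [set: Rn] (fun x : Rn => A *m x + c).
  exact: (measurableT_comp (measurable_addmx c) (measurable_mulmx A)).
apply/integrableP; split; first exact: (measurableT_comp mu mA).
rewrite (@ge0_integral_affine _ _ A c (fun x => `|(u x)%:E|)%E uA)//.
  by rewrite lte_mul_pinfty// lee_fin invr_ge0.
exact: (measurableT_comp _ mu).
Qed.

Lemma Rintegral_affine (A : 'M[R]_n) (c : 'cV[R]_n) (u : Rn -> R) :
  A \in unitmx -> (leb n).-integrable setT (EFin \o u) ->
  (\int[leb n]_x u (A *m x + c)) = `|\det A|^-1 * \int[leb n]_x u x.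
Proof.
move=> uA iu; have mu := measurable_int _ iu.
have mA : measurable_fun [set: Rn] (fun x : Rn => A *m x + c).
  exact: (measurableT_comp (measurable_addmx c) (measurable_mulmx A)).
rewrite /Rintegral.
have h (v : Rn -> \bar R) : measurable_fun setT v -> (forall x, 0 <= v x)%E ->
  (\int[leb n]_x v (A *m x + c)%R = `|\det A|^-1%:E * \int[leb n]_x v x)%E.
  by move=> mv v0; exact: ge0_integral_affine.
have hp : (\int[leb n]_x (EFin \o u)^\+ (A *m x + c)%R =
  `|\det A|^-1%:E * \int[leb n]_x (EFin \o u)^\+ x)%E.
  by apply: h; [exact: measurable_funepos|move=> x; exact: funepos_ge0].
have hm : (\int[leb n]_x (EFin \o u)^\- (A *m x + c)%R =
  `|\det A|^-1%:E * \int[leb n]_x (EFin \o u)^\- x)%E.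
  by apply: h; [exact: measurable_funeneg|move=> x; exact: funeneg_ge0].
have ip : (\int[leb n]_x (EFin \o u)^\+ x)%E \is a fin_num := integrable_pos_fin_num measurableT iu.
have im : (\int[leb n]_x (EFin \o u)^\- x)%E \is a fin_num := integrable_neg_fin_num measurableT iu.
rewrite [in LHS]integralE [in RHS]integralE.
transitivity (fine (\int[leb n]_x (EFin \o u)^\+ (A *m x + c)%R -
   \int[leb n]_x (EFin \o u)^\- (A *m x + c)%R)%E).
  by congr (fine (_ - _)%E); apply: eq_integral => x _; rewrite ?funeposE ?funenegE.
rewrite hp hm -muleBr ?fin_num_adde_defr// fineM// fin_numB.
by apply/andP; split.
Qed.

Lemma ae_affine (A : 'M[R]_n) (c : 'cV[R]_n) (P : Rn -> Prop) : A \in unitmx ->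
  {ae leb n, forall x, P x} -> {ae leb n, forall x, P (A *m x + c)}.
Proof.
move=> uA [N [mN N0 PN]].
have mA : measurable_fun [set: Rn] (fun x : Rn => A *m x + c).
  exact: (measurableT_comp (measurable_addmx c) (measurable_mulmx A)).
have mN' : measurable ((fun x : Rn => A *m x + c) @^-1` N).
  by rewrite -[X in measurable X]setTI; exact: mA.
exists ((fun x : Rn => A *m x + c) @^-1` N); split => //; last first.
  by move=> x /= h; apply: PN.
rewrite -[X in leb n X]setIT -integral_indic//.
transitivity (\int[leb n]_x (\1_N (A *m x + c))%:E)%E; first exact: eq_integral.
rewrite (@ge0_integral_affine _ _ A c (fun x => (\1_N x)%:E) uA)//.
  by rewrite integral_indic// setIT; move: N0 => /= ->; rewrite mule0.
by apply/measurable_EFinP; exact: measurable_indic.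
Qed.

End euclidean.

Section dilates.
Context {R : realType} {d : nat}.
Variable M : 'M[R]_d.+1.
Hypothesis dM : dilation_matrix M.
Local Notation Rd := ('cV[R]_d.+1).
Local Notation Zd := ('cV[int]_d.+1).

Lemma dilateE psi (j : nat) (g : Zd) (x : Rd) :
  dilate M psi j%:Z g x = absdet M `^ (j%:R / 2) * psi (M ^+ j *m x - zvec g).
Proof. by []. Qed.

Lemma measurable_dilate psi (j : nat) (g : Zd) : measurable_fun [set: Rd] psi ->
  measurable_fun [set: Rd] (dilate M psi j%:Z g).
Proof.
move=> mpsi; apply: measurable_funM; first exact: measurable_cst.
apply: (measurableT_comp mpsi).
exact: (measurableT_comp (measurable_addmx _) (measurable_mulmx _)).
Qed.

Lemma supp_dilate L psi (j : nat) (g : Zd) (x : Rd) : supp_cube L psi ->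
  dilate M psi j%:Z g x != 0 -> forall i, 0 <= (M ^+ j *m x - zvec g) i 0 <= L%:R.
Proof. by move=> sp; rewrite dilateE mulf_eq0 negb_or => /andP[_ /sp]. Qed.

Lemma dilate_bounded psi (B : R) (j : nat) (g : Zd) (x : Rd) :
  (forall x, `|psi x| <= B) ->
  `|dilate M psi j%:Z g x| <= absdet M `^ (j%:R / 2) * B.
Proof.
by move=> hB; rewrite dilateE normrM (ger0_norm (powR_ge0 _ _)) ler_wpM2l ?powR_ge0.
Qed.

Lemma bcs_dilate L psi (j : nat) (g : Zd) : supp_cube L psi ->
  measurable_fun [set: Rd] psi -> (exists B : R, forall x, `|psi x| <= B) ->
  bcs (dilate M psi j%:Z g).
Proof.
move=> sp mpsi [B hB]; split; first exact: measurable_dilate.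
  by eexists => x; exact: dilate_bounded hB.
have [Lam Lam1 hLam] := dilation_expand dM.
exists (Lam * (L%:R + \sum_i `|(zvec g : Rd) i 0|)) => x xn0; apply: (hLam j) => i.
have /andP[h1 h2] := supp_dilate sp xn0 i.
rewrite -[M ^+ j *m x](subrK (zvec g)) mxE (le_trans (ler_normD _ _))// lerD//.
  by rewrite ger0_norm.
by rewrite (bigD1 i)//= lerDl sumr_ge0.
Qed.

Lemma ip_dilate phi psi (j : nat) (g h : Zd) :
  (leb d.+1).-integrable setT (fun x : Rd => (phi (x - zvec g) * psi (x - zvec h))%:E) ->
  \int[leb d.+1]_x (dilate M phi j%:Z g x * dilate M psi j%:Z h x) =
  \int[leb d.+1]_x (phi (x - zvec g) * psi (x - zvec h)).
Proof.
move=> iu; have M0 : 0 < absdet M by exact: lt_trans (absdet_gt1 dM).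
have := Rintegral_affine 0 (dilation_unit dM j) iu.
rewrite -/(absdet _) absdetX => E.
have iu' : (leb d.+1).-integrable setT (fun x : Rd => (phi (M ^+ j *m x + 0 - zvec g) * psi (M ^+ j *m x + 0 - zvec h))%:E).
  exact: (integrable_affine 0 (dilation_unit dM j) iu).
transitivity (\int[leb d.+1]_x (absdet M ^+ j * (phi (M ^+ j *m x + 0 - zvec g) * psi (M ^+ j *m x + 0 - zvec h)))).
  apply: eq_Rintegral => x _; rewrite !dilateE addr0 mulrACA -powRD; last first.
    by apply/implyP => _; rewrite gt_eqF.
  by rewrite -splitr powR_mulrn ?ltW.
by rewrite RintegralZl// E mulrA mulfV ?mul1r// gt_eqF// exprn_gt0.
Qed.

End dilates.

(** * Pairing a lattice sum with a test function *)

Lemma Rintegral_sum dT (T : measurableType dT) (R : realType)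
    (mu : {measure set T -> \bar R}) (I : eqType) (s : seq I) (F : I -> T -> R) :
  (forall i, i \in s -> mu.-integrable setT (EFin \o F i)) ->
  mu.-integrable setT (EFin \o (fun x => \sum_(i <- s) F i x)) /\
  \int[mu]_x (\sum_(i <- s) F i x) = \sum_(i <- s) \int[mu]_x F i x.
Proof.
elim: s => [|i s IH] iF.
  split.
    apply: (eq_integrable _ (cst 0%E)) => //; first by move=> x _ /=; rewrite big_nil.
    exact: integrable0.
  rewrite big_nil /Rintegral integral0_eq// => x _; by rewrite big_nil.
have [i1 i2] := IH (fun k ks => iF k (@mem_behead _ (i :: s) k ks)).
have i0 := iF i (mem_head _ _).
split.
  apply: (eq_integrable _ (fun x => (F i x)%:E + (\sum_(i <- s) F i x)%R%:E)%E) => //.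
    by move=> x _ /=; rewrite big_cons EFinD.
  exact: integrableD.
rewrite big_cons -i2 -RintegralD//; apply: eq_Rintegral => x _.
by rewrite big_cons.
Qed.

Lemma ae_eq_Rintegral dT (T : measurableType dT) (R : realType)
    (mu : {measure set T -> \bar R}) (u v : T -> R) :
  measurable_fun [set: T] u -> measurable_fun [set: T] v ->
  {ae mu, forall x, u x = v x} -> \int[mu]_x u x = \int[mu]_x v x.
Proof.
move=> mu' mv uv; rewrite /Rintegral; congr fine.
apply: ae_eq_integral => //; try exact/measurable_EFinP.
by apply: filterS uv => x -> _.
Qed.

Section zbox.
Context {R : realType} {n : nat}.
Local Notation Rn := ('cV[R]_n).
Local Notation Zn := ('cV[int]_n).

Definition zbox (m : nat) : {fset Zn} := latset (2 * m) (const_mx m%:R : Rn).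

Lemma zboxP (m : nat) (g : Zn) : (forall i, `|(g i 0)%:~R| <= m%:R :> R) ->
  g \in zbox m.
Proof.
move=> gm; pose C := [set x : Rn | forall i, 0 <= x i 0 <= (2 * m)%:R].
apply: (@latsetP _ _ _ (fun x => (x \in C)%:R)) => [x|].
  by rewrite pnatr_eq0 eqb0 negbK inE.
rewrite pnatr_eq0 eqb0 negbK inE => i; rewrite !mxE.
have := gm i; rewrite ler_norml => /andP[h1 h2].
by rewrite subr_ge0 h2 /= lerBlDr -lerBlDl natrM mulr_natl mulr2n opprD addrA subrr sub0r.
Qed.

End zbox.

Section lattice_pairing.
Context {R : realType} {d : nat}.
Variable M : 'M[R]_d.+1.
Hypothesis dM : dilation_matrix M.
Local Notation Rd := ('cV[R]_d.+1).
Local Notation Zd := ('cV[int]_d.+1).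

Lemma absdet_gt0 : 0 < absdet M.
Proof. exact: lt_trans (absdet_gt1 dM). Qed.

(** Against a compactly supported [u] all but finitely many translates vanish, so
    the integral passes through the lattice sum whatever the growth of [c]. *)
Lemma integral_lat_sum L psi (l : nat) (c : Zd -> R) (u : Rd -> R) (g0 : Zd) :
  supp_cube L psi -> measurable_fun [set: Rd] psi ->
  (exists B : R, forall x, `|psi x| <= B) -> bcs u ->
  exists G : {fset Zd}, [/\ g0 \in G,
    (forall (g : Zd) x, g \notin G -> dilate M psi l%:Z g x * u x = 0) &
    \int[leb d.+1]_x ((\sum_(g \in setT) c g * dilate M psi l%:Z g x) * u x) =
    \sum_(g <- G) c g * \int[leb d.+1]_x (dilate M psi l%:Z g x * u x)].
Proof.
move=> sp mpsi bpsi bu; have [mu bdu [b ub]] := bu.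
pose A := M ^+ l.
pose b1 := \sum_i \sum_k `|A i k| * `|b| + L%:R + \sum_i `|(zvec g0 : Rd) i 0|.
pose m := (Num.truncn b1).+1.
have b1m : b1 <= m%:R.
  by apply/ltW; rewrite /m truncnS_gt.
have s0 i : 0 <= \sum_k `|A i k| * `|b| by apply: sumr_ge0 => k _; rewrite mulr_ge0.
have ss0 : 0 <= \sum_i \sum_k `|A i k| * `|b| by apply: sumr_ge0.
have sz0 : 0 <= \sum_i `|(zvec g0 : Rd) i 0| by apply: sumr_ge0.
pose G := @zbox R d.+1 m.
have hG g x : g \notin G -> dilate M psi l%:Z g x * u x = 0.
  move=> gG; apply/eqP; apply: contraNT gG; rewrite mulf_eq0 negb_or => /andP[px ux].
  apply: zboxP => i; apply: le_trans b1m.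
  have /andP[h1 h2] := supp_dilate sp px i.
  have -> : (g i 0)%:~R = (A *m x) i 0 - (A *m x - zvec g) i 0.
    have E : (A *m x) i 0 = (A *m x - zvec g) i 0 + (zvec g : Rd) i 0.
      by rewrite -[in LHS](subrK (zvec g) (A *m x)) mxE.
    by rewrite E addrAC subrr add0r mxE.
  rewrite (le_trans (ler_normB _ _))// /b1 -addrA lerD//.
    rewrite mxE (le_trans (ler_norm_sum _ _ _))// [leRHS](bigD1 i)//= -[leLHS]addr0 lerD//.
      apply: ler_sum => k _; rewrite normrM ler_wpM2l//.
      by rewrite (le_trans (ub _ ux k))// ler_norm.
    by apply: sumr_ge0.
  by rewrite ger0_norm// (le_trans h2)// lerDl.
exists G; split => //.
  apply: zboxP => i; apply: le_trans b1m; rewrite /b1 -[leLHS]add0r lerD//.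
    by rewrite addr_ge0.
  by rewrite [leRHS](bigD1 i)//= mxE lerDl sumr_ge0.
transitivity (\int[leb d.+1]_x (\sum_(g <- G) c g * (dilate M psi l%:Z g x * u x))).
  apply: eq_Rintegral => x _; rewrite mulrC mulr_fsumr.
  have E g : u x * (c g * dilate M psi l%:Z g x) = c g * (dilate M psi l%:Z g x * u x).
    by ring.
  rewrite (fsumT_fset (G := G)); first by apply: eq_bigr => g _; exact: E.
  by move=> g; apply: contraNT => gG; rewrite E hG// mulr0.
have ib g : (leb d.+1).-integrable setT (EFin \o (fun x => dilate M psi l%:Z g x * u x)).
  apply: bcs_integrable; apply: bcs_mul => //; first exact: measurable_dilate.
  exact: bcs_bounded (bcs_dilate dM l g sp mpsi bpsi).
rewrite (proj2 (Rintegral_sum _)).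
  by apply: eq_bigr => g _; rewrite RintegralZl.
by move=> g _; exact: (integrableZl measurableT (c g) (ib g)).
Qed.

End lattice_pairing.

(** * Finite refinement equations *)

Lemma ae_forall_count dT (T : measurableType dT) (R : realType)
    (mu : {measure set T -> \bar R}) (I : countType) (P : I -> T -> Prop) :
  (forall i, {ae mu, forall x, P i x}) -> {ae mu, forall x, forall i, P i x}.
Proof.
move=> aeP.
have := @ae_foralln _ _ _ mu (fun n x => if choice.unpickle n is Some i then P i x else True).
case=> [n|N [mN N0 PN]].
  by case: choice.unpickle => [i|]; [exact: aeP|exact: aeW].
exists N; split => // x /= h; apply: PN => /= hx; apply: h => i.
by have := hx (choice.pickle i); rewrite choice.pickleK.
Qed.

Lemma has_sum_fset (R : realType) (I : choiceType) (u : I -> R) (l : R)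
    (F : {fset I}) : has_sum u l -> (forall i, i \notin F -> u i = 0) ->
  \sum_(i <- F) u i = l.
Proof.
move=> ul uF; apply: contrapT => /eqP; rewrite -subr_eq0 -normr_gt0 => e0.
have [F0 /(_ (F0 `|` F)%fset (fsubsetUl _ _))] := ul _ e0.
rewrite -(big_fset_incl _ (fsubsetUr F0 F)) ?ltxx//.
by move=> i _ /uF.
Qed.

Section dilate_sum.
Context {R : realType} {d : nat}.
Variable M : 'M[R]_d.+1.
Local Notation Rd := ('cV[R]_d.+1).
Local Notation Zd := ('cV[int]_d.+1).

Lemma fsum_dilate L psi (l : nat) (c : Zd -> R) (x : Rd) : supp_cube L psi ->
  \sum_(g \in setT) c g * dilate M psi l%:Z g x =
  \sum_e c (@lat _ _ L (M ^+ l *m x) e) * dilate M psi l%:Z (lat (M ^+ l *m x) e) x.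
Proof.
move=> sp; under eq_fsbigr do rewrite dilateE mulrA.
rewrite (fsum_lat _ _ sp); apply: eq_bigr => e _.
by rewrite dilateE mulrA.
Qed.

Lemma measurable_dilate_sum L psi (l : nat) (c : Zd -> R) :
  supp_cube L psi -> measurable_fun [set: Rd] psi ->
  measurable_fun [set: Rd] (fun x => \sum_(g \in setT) c g * dilate M psi l%:Z g x).
Proof.
move=> sp mpsi.
rewrite (_ : (fun x => _) = (fun y => \sum_(g \in setT)
  (c g * absdet M `^ (l%:R / 2)) * psi (y - zvec g)) \o (fun x : Rd => M ^+ l *m x)).
  exact: (measurableT_comp (measurable_lat_sum _ mpsi sp) (measurable_mulmx _)).
by apply/funext => x /=; under eq_fsbigr do rewrite dilateE mulrA.
Qed.

Lemma dilate_latset L psi (l : nat) (g : Zd) (x : Rd) : supp_cube L psi ->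
  dilate M psi l%:Z g x != 0 -> g \in latset L (M ^+ l *m x).
Proof.
by move=> sp; rewrite dilateE mulf_eq0 negb_or => /andP[_]; exact: latsetP.
Qed.

End dilate_sum.

(** The finite form of the refinement equations. Since
    [<Psi_k, Phi(M. - h)>] is a multiple of [a_k(h)], compact support forces the
    coefficients to vanish off a finite set [F]: the refinement equation then holds
    as a finite sum, and the quadratic relations of the coefficients become finite
    sums too. The map [mz] is multiplication by [M] on the lattice. *)
Record finite_refinement {R : realType} {d} (M : 'M[R]_d.+1)
    (Psi : nat -> 'cV[R]_d.+1 -> R) (L : nat) (B : R)
    (a : nat -> 'cV[int]_d.+1 -> R) (F : {fset 'cV[int]_d.+1})
    (mz : 'cV[int]_d.+1 -> 'cV[int]_d.+1) : Prop := {
  fr_supp : forall k, (k < ndet M)%N -> supp_cube L (Psi k) ;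
  fr_bound : forall k, (k < ndet M)%N -> forall x, `|Psi k x| <= B ;
  fr_meas : forall k, (k < ndet M)%N -> measurable_fun [set: 'cV[R]_d.+1] (Psi k) ;
  fr_orth : forall g h, \int[leb d.+1]_x
    (Psi 0%N (x - zvec g) * Psi 0%N (x - zvec h)) = (g == h)%:R ;
  fr_mz : forall g, zvec (mz g) = M *m zvec g ;
  fr_refine : forall k, (k < ndet M)%N -> {ae leb d.+1, forall x,
    Psi k x = \sum_(h <- F) a k h * Psi 0%N (M *m x - zvec h)} ;
  fr_rel : forall j k g, (j < ndet M)%N -> (k < ndet M)%N ->
    \sum_(h <- F) a j h * a k (mz g + h) = absdet M * ((j == k) && (g == 0))%:R ;
  fr_off : forall k h, (k < ndet M)%N -> h \notin F -> a k h = 0 }.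

Section refinement_exists.
Context {R : realType} {d : nat}.
Variables (M : 'M[R]_d.+1) (dM : dilation_matrix M).
Variables (Psi : nat -> 'cV[R]_d.+1 -> R) (W : wavelet_system M Psi).
Local Notation Rd := ('cV[R]_d.+1).
Local Notation Zd := ('cV[int]_d.+1).

Lemma ndet_gt0 : (0 < ndet M)%N.
Proof. by rewrite /ndet truncn_gt0; exact/ltW/absdet_gt1. Qed.

(** The coefficients are recovered by integrating the refinement equation against
    [Phi(M. - g)]; that integral is zero as soon as the two supports are disjoint. *)
Lemma finite_refinement_exists :
  exists L B a F mz, finite_refinement M Psi L B a F mz.
Proof.
have [L L0 sL] := wav_support W.
have [mz mzE] : exists mz : Zd -> Zd, forall g, zvec (mz g) = M *m zvec g :> Rd.
  have /choice[mz h] : forall g, exists g', M *m zvec g = zvec g' :> Rd.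
    exact: dilation_lattice dM.
  by exists mz => g; rewrite h.
have [B hB] : exists B : R, forall k, (k < ndet M)%N -> forall x, `|Psi k x| <= B.
  have /choice[b hb] : forall k, exists b : R, (k < ndet M)%N -> forall x, `|Psi k x| <= b.
    move=> k; case: (ltnP k (ndet M)) => [/(wav_bounded W)[b hb]|_]; first by exists b.
    by exists 0.
  exists (\sum_(k < ndet M) `|b k|) => k kn x.
  rewrite (bigD1 (Ordinal kn))//= (le_trans (hb _ kn x))// -[leLHS]addr0 lerD ?ler_norm//.
  by rewrite sumr_ge0.
have n0 := ndet_gt0.
have mPsi := wav_measurable W.
have bPsi k : (k < ndet M)%N -> exists B : R, forall x, `|Psi k x| <= B.
  by move=> kn; exists B => x; exact: hB.
have orth g h : \int[leb d.+1]_x (Psi 0%N (x - zvec g) * Psi 0%N (x - zvec h)) = (g == h)%:R.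
  by have [U mU] := wav_mra W; rewrite /Rintegral (mra_orthonormal mU).
have iPhi g h : (leb d.+1).-integrable setT (EFin \o (fun x : Rd => Psi 0%N (x - zvec g) * Psi 0%N (x - zvec h))).
  have t k : Psi 0%N \o (fun x : Rd => x - zvec k) = dilate M (Psi 0%N) 0%:Z k.
    by apply/funext => x; rewrite dilateE mul0r powRr0 mul1r expr0 mul1mx.
  apply: bcs_integrable.
  have bt k : bcs (Psi 0%N \o (fun x : Rd => x - zvec k)).
    by rewrite t; exact: bcs_dilate (sL _ n0) (mPsi _ n0) (bPsi _ n0).
  by apply: bcs_mul; [exact: bcs_measurable (bt g)|exact: bcs_bounded (bt g)|exact: bt].
have M0 := absdet_gt0 dM.
have ipPhi j g h : \int[leb d.+1]_x (dilate M (Psi 0%N) j%:Z g x * dilate M (Psi 0%N) j%:Z h x) = (g == h)%:R.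
  by rewrite ip_dilate// ?orth//; exact: iPhi.
have [a [ref rel _]] := wav_refinement W.
have dil1 g x : Psi 0%N (M *m x - zvec g) = absdet M `^ (- 2^-1) * dilate M (Psi 0%N) 1%:Z g x.
  rewrite dilateE expr1 mulrA -powRD ?mul1r ?addNr ?powRr0 ?mul1r//.
  by apply/implyP => _; rewrite gt_eqF.
have coefE k g : (k < ndet M)%N ->
    \int[leb d.+1]_x (Psi k x * dilate M (Psi 0%N) 1%:Z g x) = absdet M `^ (- 2^-1) * a k g.
  move=> kn; pose c h := absdet M `^ (- 2^-1) * a k h.
  have bd := bcs_dilate dM 1 g (sL _ n0) (mPsi _ n0) (bPsi _ n0).
  have [G [gG _ GE]] := integral_lat_sum dM 1 c g (sL _ n0) (mPsi _ n0) (bPsi _ n0) bd.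
  transitivity (\int[leb d.+1]_x ((\sum_(h \in setT) c h * dilate M (Psi 0%N) 1%:Z h x) * dilate M (Psi 0%N) 1%:Z g x)).
    apply: ae_eq_Rintegral.
    - apply: measurable_funM; first exact: mPsi.
      exact: bcs_measurable bd.
    - apply: measurable_funM; last exact: bcs_measurable bd.
      exact: measurable_dilate_sum (sL _ n0) (mPsi _ n0).
    - apply: filterS (ref k kn) => x ->; congr (_ * _).
      by apply: eq_fsbigr => h _; rewrite dil1 /c mulrCA mulrA.
  rewrite GE (big_fsetD1 g gG)/= ipPhi eqxx mulr1 big1_seq ?addr0// => h /=.
  by rewrite !inE => /andP[hg _]; rewrite ipPhi (negbTE hg) mulr0.
pose b1 := \sum_i \sum_k `|M i k| * L%:R + L%:R.
pose m := (Num.truncn b1).+1.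
have b1m : b1 <= m%:R by apply/ltW; rewrite /m truncnS_gt.
pose F := @zbox R d.+1 m.
have off k h : (k < ndet M)%N -> h \notin F -> a k h = 0.
  move=> kn; apply: contraNeq => akh.
  have [x xn0] : exists x, Psi k x * dilate M (Psi 0%N) 1%:Z h x != 0.
    apply: contrapT => /forallNP H.
    have := coefE k h kn; rewrite (@eq_Rintegral _ _ _ _ _ (cst 0)).
      rewrite /Rintegral integral0 => /esym/eqP; rewrite mulf_eq0 (negbTE akh) orbF.
      by rewrite gt_eqF// powR_gt0.
    by move=> x _; apply/eqP; apply: contrapT => /negP; exact: H.
  move: xn0; rewrite mulf_eq0 negb_or => /andP[px dx].
  apply: zboxP => i; apply: le_trans b1m.
  have /andP[h1 h2] := supp_dilate (sL _ n0) dx i.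
  have E : (M *m x) i 0 = (M *m x - zvec h) i 0 + (zvec h : Rd) i 0.
    by rewrite -[in LHS](subrK (zvec h) (M *m x)) mxE.
  rewrite expr1 in h1 h2.
  have -> : (h i 0)%:~R = (M *m x) i 0 - (M *m x - zvec h) i 0.
    by rewrite E addrAC subrr add0r mxE.
  rewrite (le_trans (ler_normB _ _))// /b1 lerD//; last by rewrite ger0_norm.
  rewrite mxE (le_trans (ler_norm_sum _ _ _))// [leRHS](bigD1 i)//= -[leLHS]addr0 lerD//.
    apply: ler_sum => l _; rewrite normrM ler_wpM2l//.
    by have /andP[x1 x2] := sL _ kn x px l; rewrite ger0_norm.
  by apply: sumr_ge0 => l _; apply: sumr_ge0.
exists L, B, a, F, mz; split => //.
- move=> k kn; apply: filterS (ref k kn) => x ->.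
  by apply: fsumT_fset => h; apply: contraNT => /(off k h kn) ->; rewrite mul0r.
- move=> j k g jn kn; apply: has_sum_fset; first exact: rel.
  by move=> h /(off j h jn) ->; rewrite mul0r.
Qed.

End refinement_exists.

(** * Orthogonality between levels *)

Lemma bcs_scale (R : realType) n (c : R) (u : 'cV[R]_n -> R) :
  bcs u -> bcs (fun x => c * u x).
Proof.
by move=> bu; apply: (@bcs_mul _ _ (cst c)) => //; exists `|c|.
Qed.

Section multiscale.
Context {R : realType} {d : nat}.
Local Notation Rd := ('cV[R]_d.+1).
Local Notation Zd := ('cV[int]_d.+1).
Variables (M : 'M[R]_d.+1) (dM : dilation_matrix M).
Variables (Psi : nat -> Rd -> R) (L : nat) (B : R) (a : nat -> Zd -> R).
Variables (F : {fset Zd}) (mz : Zd -> Zd).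
Hypothesis fr : finite_refinement M Psi L B a F mz.
Local Notation Phi := (Psi 0%N).

Let n0 := ndet_gt0 dM.
Let M0 := absdet_gt0 dM.

Let bPsi k : (k < ndet M)%N -> exists B : R, forall x, `|Psi k x| <= B.
Proof. by move=> kn; exists B => x; exact: (fr_bound fr kn). Qed.

Lemma bcs_wavelet k (j : nat) g : (k < ndet M)%N -> bcs (dilate M (Psi k) j%:Z g).
Proof.
move=> kn; exact: (bcs_dilate dM j g (fr_supp fr kn) (fr_meas fr kn) (bPsi kn)).
Qed.

Lemma bcs_wavelet_mul k i (j l : nat) g h : (k < ndet M)%N -> (i < ndet M)%N ->
  bcs (fun x => dilate M (Psi k) j%:Z g x * dilate M (Psi i) l%:Z h x).
Proof.
move=> kn inn; apply: bcs_mul; last exact: bcs_wavelet.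
  exact: bcs_measurable (bcs_wavelet j g kn).
exact: bcs_bounded (bcs_wavelet j g kn).
Qed.

Lemma orthonormal_level (j : nat) g h :
  \int[leb d.+1]_x (dilate M Phi j%:Z g x * dilate M Phi j%:Z h x) = (g == h)%:R.
Proof.
rewrite ip_dilate ?(fr_orth fr)//.
have t k : Phi \o (fun x : Rd => x - zvec k) = dilate M Phi 0%:Z k.
  by apply/funext => x; rewrite dilateE mul0r powRr0 mul1r expr0 mul1mx.
rewrite (_ : (fun x => _) = EFin \o (fun x => dilate M Phi 0%:Z g x * dilate M Phi 0%:Z h x)).
  by apply: bcs_integrable; exact: bcs_wavelet_mul.
by apply/funext => x /=; rewrite -!t.
Qed.

Let a' k h := absdet M `^ (- 2^-1) * a k h.

Lemma dilate_refine k (j : nat) : (k < ndet M)%N ->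
  {ae leb d.+1, forall x, forall g, dilate M (Psi k) j%:Z g x =
    \sum_(h <- F) a' k h * dilate M Phi j.+1%:Z (mz g + h) x}.
Proof.
move=> kn; apply: ae_forall_count => g.
have := ae_affine (- zvec g) (dilation_unit dM j) (fr_refine fr kn).
apply: filterS => x E; rewrite dilateE E mulr_sumr; apply: eq_bigr => h _.
rewrite dilateE /a' zvecD (fr_mz fr) exprS.
rewrite (_ : M *m (M ^+ j *m x - zvec g) - zvec h = M * M ^+ j *m x - (M *m zvec g + zvec h)); last first.
  by rewrite mulmxBr mulmxA opprD addrA.
rewrite mulrACA -powRD; last by apply/implyP => _; rewrite gt_eqF.
congr (_ `^ _ * _).
by rewrite -[j.+1%:R]natr1 mulrDl mul1r addrCA addNr addr0.
Qed.

Lemma mz_inj : injective mz.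
Proof.
move=> g h gh; apply: (@zvec_inj R).
have : M *m zvec g = M *m zvec h :> Rd by rewrite -!(fr_mz fr) gh.
by move/(congr1 (mulmx (invmx M))); rewrite !mulKmx//; have := dilation_unit dM 1; rewrite expr1.
Qed.

Lemma mzB g h : mz (g - h) = mz g - mz h.
Proof.
by apply: (@zvec_inj R); rewrite zvecB !(fr_mz fr) zvecB mulmxBr.
Qed.

(** Induction on the gap between the levels: the coarser [Phi] is refined until
    both functions live one level apart from [Phi], where the inner product is one
    of the quadratic relations between [a_k] and [a_0]. *)
Lemma wavelet_orth k (i j : nat) g g' : (0 < k < ndet M)%N ->
  \int[leb d.+1]_x (dilate M (Psi k) (j + i)%N%:Z g' x * dilate M Phi j%:Z g x) = 0.
Proof.
move=> /andP[k0 kn]; elim: i j g => [|i IH] j g.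
  rewrite addn0.
  transitivity (\int[leb d.+1]_x (\sum_(h <- F) \sum_(h' <- F)
      a' k h * a' 0%N h' * (dilate M Phi j.+1%:Z (mz g' + h) x * dilate M Phi j.+1%:Z (mz g + h') x))).
    apply: ae_eq_Rintegral.
    - exact: bcs_measurable (bcs_wavelet_mul _ _ _ _ kn n0).
    - apply: measurable_sum => h; apply: measurable_sum => h'.
      apply: measurable_funM; first exact: measurable_cst.
      exact: bcs_measurable (bcs_wavelet_mul _ _ _ _ n0 n0).
    - apply: filterS2 (dilate_refine j kn) (dilate_refine j n0) => x -> ->.
      rewrite mulr_suml; apply: eq_bigr => h _; rewrite mulr_sumr.
      by apply: eq_bigr => h' _; rewrite mulrACA.
  have ib h h' : (leb d.+1).-integrable setT (EFin \o (fun x => a' k h * a' 0%N h' *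
      (dilate M Phi j.+1%:Z (mz g' + h) x * dilate M Phi j.+1%:Z (mz g + h') x))).
    by apply: bcs_integrable; apply: bcs_scale; exact: bcs_wavelet_mul.
  rewrite (proj2 (Rintegral_sum _)); last first.
    by move=> h _; exact: (proj1 (Rintegral_sum _)).
  transitivity (\sum_(h <- F) absdet M `^ (- 2^-1) ^+ 2 * (a k h * a 0%N (mz (g' - g) + h))).
    apply: eq_bigr => h _; rewrite (proj2 (Rintegral_sum _))//.
    transitivity (\sum_(h' <- F) a' k h * a' 0%N h' * (h' == mz (g' - g) + h)%:R).
      apply: eq_bigr => h' _; rewrite RintegralZl//; last first.
        by apply: bcs_integrable; exact: bcs_wavelet_mul.
      rewrite orthonormal_level; congr (_ * (nat_of_bool _)%:R).
      rewrite mzB; apply/eqP/eqP => [E|->]; first by rewrite addrAC E addrAC subrr add0r.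
      by rewrite addrA addrCA subrr addr0.
    have [hF|hF] := boolP (mz (g' - g) + h \in F).
      rewrite (big_fsetD1 _ hF)/= eqxx mulr1 big1_seq ?addr0; last first.
        by move=> h' /=; rewrite !inE => /andP[/negbTE -> _]; rewrite mulr0.
      by rewrite /a' expr2; ring.
    rewrite (fr_off fr n0 hF) !mulr0 big1_seq// => h' /= h'F.
    by case: eqP => [E|_]; rewrite ?mulr0//; rewrite -E h'F in hF.
  by rewrite -mulr_sumr (fr_rel fr _ kn n0) (gtn_eqF k0) mulr0 mulr0.
rewrite -addSnnS.
transitivity (\int[leb d.+1]_x (\sum_(h <- F) a' 0%N h *
    (dilate M (Psi k) (j.+1 + i)%N%:Z g' x * dilate M Phi j.+1%:Z (mz g + h) x))).
  apply: ae_eq_Rintegral.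
  - exact: bcs_measurable (bcs_wavelet_mul _ _ _ _ kn n0).
  - apply: measurable_sum => h; apply: measurable_funM; first exact: measurable_cst.
    exact: bcs_measurable (bcs_wavelet_mul _ _ _ _ kn n0).
  - apply: filterS (dilate_refine j n0) => x ->.
    by rewrite mulr_sumr; apply: eq_bigr => h _; rewrite mulrCA.
rewrite (proj2 (Rintegral_sum _)); last first.
  move=> h _; apply: bcs_integrable; apply: bcs_scale.
  exact: bcs_wavelet_mul.
rewrite big1// => h _; rewrite RintegralZl//; last first.
  by apply: bcs_integrable; exact: bcs_wavelet_mul.
by rewrite IH mulr0.
Qed.

(** Pointwise form of the inclusion of a level in the next one. The coefficients
    of the sum over [M g + h] are collected by the lattice point [M g + h]; no
    summability of [v] enters, since locally both sides are finite sums. *)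
Lemma level_up k (l : nat) (v : Zd -> R) : (k < ndet M)%N ->
  exists c : Zd -> R, {ae leb d.+1, forall x,
    \sum_(g \in setT) v g * dilate M (Psi k) l%:Z g x =
    \sum_(g \in setT) c g * dilate M Phi l.+1%:Z g x}.
Proof.
move=> kn.
(* [v] transported along [mz] and extended by zero. *)
pose b u := if pselect (exists g, mz g = u) is left p then v (sval (cid p)) else 0.
have bmz g : b (mz g) = v g.
  rewrite /b; case: pselect => [p|]; last by case; exists g.
  by case: (cid p) => g' /= /mz_inj ->.
have bN u : (forall g, mz g <> u) -> b u = 0.
  by rewrite /b; case: pselect => // -[g gu] /(_ g).
exists (fun g' => \sum_(h <- F) a' k h * b (g' - h)).
apply: filterS (dilate_refine l kn) => x E.
pose D g := dilate M Phi l.+1%:Z g x.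
pose G' := latset L (M ^+ l.+1 *m x).
have DG g : D g != 0 -> g \in G' by move=> Dg; exact: dilate_latset (fr_supp fr n0) Dg.
have finG h : finite_set [set g | mz g + h \in G'].
  apply: (@finite_preimage _ _ [set` G'] (fun g : Zd => mz g + h)).
    by move=> g g' _ _ /addIr /mz_inj.
  exact: finite_fset.
have finG' : finite_set (\bigcup_(h in [set` F]) [set g | mz g + h \in G']).
  by apply: bigcup_finite => //; exact: finite_fset.
pose G := fset_set (\bigcup_(h in [set` F]) [set g | mz g + h \in G']).
have GP g h : h \in F -> D (mz g + h) != 0 -> g \in G.
  by move=> hF Dn0; rewrite in_fset_set// inE; exists h => //=; exact: DG.
transitivity (\sum_(h <- F) a' k h * \sum_(g <- G) v g * D (mz g + h)).
  rewrite (fsumT_fset (G := G)).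
    under eq_bigr do rewrite E mulr_sumr.
    rewrite exchange_big /=; apply: eq_bigr => h _; rewrite mulr_sumr.
    by apply: eq_bigr => g _; rewrite mulrCA.
  move=> g; rewrite E mulf_eq0 negb_or => /andP[_]; apply: contraNT => gG.
  rewrite big1_seq// => h /= hF; apply/eqP; apply: contraNT gG.
  by rewrite mulf_eq0 negb_or => /andP[_]; exact: GP.
rewrite (fsumT_fset (G := G')); last first.
  by move=> g; rewrite mulf_eq0 negb_or => /andP[_ /DG].
under [RHS]eq_bigr do rewrite mulr_suml.
rewrite [RHS]exchange_big /=; rewrite !big_seq; apply: eq_bigr => h hF.
under [RHS]eq_bigr do rewrite -mulrA; rewrite -mulr_sumr; congr (_ * _).
transitivity (\sum_(u \in setT) b (u - h) * D u); last first.
  by apply: fsumT_fset => u; rewrite mulf_eq0 negb_or => /andP[_ /DG].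
rewrite (reindex_fsbigT (fun u => u + h)); last first.
  by exists (fun u => u - h) => u; rewrite ?addrK ?subrK.
under eq_fsbigr do rewrite addrK.
rewrite -(fsbig_widen (range mz)) //; last first.
  move=> u /= [_ hu]; rewrite bN ?mul0r// => g gu; apply: hu; by exists g.
rewrite (fsbig_image _ mz); last by move=> g g' _ _; exact: mz_inj.
under eq_fsbigr do rewrite bmz.
apply/esym/fsumT_fset => g; rewrite mulf_eq0 negb_or => /andP[_].
exact: GP.
Qed.

End multiscale.

(** * Partial sums are orthogonal projections *)

Section projection.
Context {R : realType} {d : nat}.
Local Notation Rd := ('cV[R]_d.+1).
Local Notation Zd := ('cV[int]_d.+1).
Variables (M : 'M[R]_d.+1) (dM : dilation_matrix M).
Variables (Psi : nat -> Rd -> R) (L : nat) (B : R) (a : nat -> Zd -> R).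
Variables (F : {fset Zd}) (mz : Zd -> Zd).
Hypothesis fr : finite_refinement M Psi L B a F mz.
Local Notation Phi := (Psi 0%N).
Variables (th : Zd -> R) (v : nat -> nat -> Zd -> R).

Let n0 := ndet_gt0 dM.
Let M0 := absdet_gt0 dM.

Let bPsi k : (k < ndet M)%N -> exists B : R, forall x, `|Psi k x| <= B.
Proof. by move=> kn; exists B => x; exact: (fr_bound fr kn). Qed.

Local Notation W := (besov_partial_sum M Psi th v).

(** The increment between two consecutive partial sums of the expansion. *)
Definition detail (j : nat) (x : Rd) : R :=
  \sum_(1 <= k < ndet M) \sum_(g \in setT) v k j g * dilate M (Psi k) j%:Z g x.

Lemma partial_sumS J x : W x J.+1 = W x J + detail J x.
Proof.
rewrite /besov_partial_sum /detail -addrA; congr (_ + _).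
by rewrite -big_split /=; apply: eq_bigr => k _; rewrite big_nat_recr.
Qed.

Lemma partial_sum_details J i x :
  W x (J + i)%N = W x J + \sum_(0 <= l < i) detail (J + l)%N x.
Proof.
elim: i => [|i IH]; first by rewrite addn0 big_geq ?addr0.
by rewrite addnS partial_sumS IH big_nat_recr//= addrA.
Qed.

Lemma measurable_detail j : measurable_fun [set: Rd] (detail j).
Proof.
rewrite (_ : detail j = (fun x => \sum_(1 <= k < ndet M) (if (k < ndet M)%N then
  \sum_(g \in setT) v k j g * dilate M (Psi k) j%:Z g x else 0))); last first.
  by apply/funext => x; apply: eq_big_nat => k /andP[_ ->].
apply: measurable_sum => k; case: (boolP (k < ndet M)%N) => [kn|_]; last exact: measurable_cst.
exact: measurable_dilate_sum (fr_supp fr kn) (fr_meas fr kn).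
Qed.

Lemma measurable_partial_sum J : measurable_fun [set: Rd] (fun x => W x J).
Proof.
elim: J => [|J IH].
  rewrite (_ : (fun x => _) = (fun x => \sum_(g \in setT) th g * dilate M Phi 0%:Z g x)).
    exact: measurable_dilate_sum (fr_supp fr n0) (fr_meas fr n0).
  apply/funext => x; rewrite /besov_partial_sum [X in _ + X]big1 ?addr0// => k _.
  by rewrite big_geq.
under eq_fun do rewrite partial_sumS.
by apply: measurable_funD => //; exact: measurable_detail.
Qed.

Lemma lat_sumD (j : nat) (c c' : Zd -> R) x :
  \sum_(g \in setT) c g * dilate M Phi j%:Z g x +
  \sum_(g \in setT) c' g * dilate M Phi j%:Z g x =
  \sum_(g \in setT) (c g + c' g) * dilate M Phi j%:Z g x.
Proof.
rewrite !(fsum_dilate _ _ _ _ (fr_supp fr n0)) -big_split /=.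
by apply: eq_bigr => e _; rewrite mulrDl.
Qed.

Lemma detail_level (j : nat) : exists c : Zd -> R, {ae leb d.+1, forall x,
  detail j x = \sum_(g \in setT) c g * dilate M Phi j.+1%:Z g x}.
Proof.
rewrite /detail.
have : all (fun k => k < ndet M)%N (index_iota 1 (ndet M)).
  by apply/allP => k; rewrite mem_index_iota => /andP[].
elim: (index_iota _ _) => [_|k s IH /= /andP[kn /IH[c cE]]].
  exists (fun=> 0); apply: aeW => x; rewrite big_nil.
  by rewrite fsbig1// => g _; rewrite mul0r.
have [c' c'E] := level_up dM fr j (v k j) kn.
exists (fun g => c' g + c g); apply: filterS2 cE c'E => x cE c'E.
by rewrite big_cons cE c'E lat_sumD.
Qed.

Lemma partial_level (J : nat) : exists c : Zd -> R, {ae leb d.+1, forall x,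
  W x J = \sum_(g \in setT) c g * dilate M Phi J%:Z g x}.
Proof.
elim: J => [|J [c cE]].
  exists th; apply: aeW => x; rewrite /besov_partial_sum [X in _ + X]big1 ?addr0// => k _.
  by rewrite big_geq.
have [c1 c1E] := level_up dM fr J c n0.
have [c2 c2E] := detail_level J.
exists (fun g => c1 g + c2 g); apply: filterS3 cE c1E c2E => x cE c1E c2E.
by rewrite partial_sumS cE c1E c2E lat_sumD.
Qed.

Lemma detail_orth (i j : nat) g :
  (leb d.+1).-integrable setT (EFin \o (fun x => detail (j + i)%N x * dilate M Phi j%:Z g x)) /\
  \int[leb d.+1]_x (detail (j + i)%N x * dilate M Phi j%:Z g x) = 0.
Proof.
pose E k x := (\sum_(h \in setT) v k (j + i)%N h * dilate M (Psi k) (j + i)%N%:Z h x) *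
  dilate M Phi j%:Z g x.
have bPhi := bcs_wavelet dM fr j g n0.
have iE k : k \in index_iota 1 (ndet M) -> (leb d.+1).-integrable setT (EFin \o E k) /\
    \int[leb d.+1]_x E k x = 0.
  rewrite mem_index_iota => /andP[k0 kn].
  have [G [_ G0 GE]] := integral_lat_sum dM (j + i) (v k (j + i)%N) 0
    (fr_supp fr kn) (fr_meas fr kn) (bPsi kn) bPhi.
  split.
    rewrite (_ : E k = (fun x => \sum_(h <- G) v k (j + i)%N h *
      (dilate M (Psi k) (j + i)%N%:Z h x * dilate M Phi j%:Z g x))).
      apply: (proj1 (Rintegral_sum _)) => h _; apply: bcs_integrable.
      apply: bcs_scale; by apply: (bcs_wavelet_mul dM fr).
    apply/funext => x; rewrite /E mulrC mulr_fsumr.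
    have EE h : dilate M Phi j%:Z g x * (v k (j + i)%N h * dilate M (Psi k) (j + i)%N%:Z h x) =
      v k (j + i)%N h * (dilate M (Psi k) (j + i)%N%:Z h x * dilate M Phi j%:Z g x) by ring.
    rewrite (fsumT_fset (G := G)); first by apply: eq_bigr => h _; exact: EE.
    by move=> h; apply: contraNT => hG; rewrite EE G0// mulr0.
  rewrite GE big1_seq// => h _.
  by rewrite (wavelet_orth dM fr)// ?mulr0// k0.
have EE : (fun x => detail (j + i)%N x * dilate M Phi j%:Z g x) =
    (fun x => \sum_(1 <= k < ndet M) E k x).
  by apply/funext => x; rewrite /detail mulr_suml.
rewrite EE; have [h1 h2] := Rintegral_sum (fun k ks => proj1 (iE k ks)).
split => //; rewrite h2 big1_seq// => k /= ks.
exact: (proj2 (iE k ks)).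
Qed.

(** The partial sum of order [J] has coefficient [c g]; the later details are
    orthogonal to level [J], so all later partial sums have the same one; and so has
    the limit [f], by dominated convergence, because the partial sums are uniformly
    bounded and the test function has compact support. *)
Lemma projection_coef (f : Rd -> R) (C : R) (J : nat) g :
  measurable_fun [set: Rd] f -> wavelet_expansion M Psi f th v ->
  (forall j x, `|W x j| <= C) ->
  forall c : Zd -> R, {ae leb d.+1, forall x,
    W x J = \sum_(h \in setT) c h * dilate M Phi J%:Z h x} ->
  \int[leb d.+1]_x (f x * dilate M Phi J%:Z g x) = c g.
Proof.
move=> mf fE WC c cE.
pose D := dilate M Phi J%:Z g.
have bD : bcs D := bcs_wavelet dM fr J g n0.
have bW i : bcs (fun x => W x i * D x).
  by apply: bcs_mul => //; [exact: measurable_partial_sum|exists C].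
have WJ : \int[leb d.+1]_x (W x J * D x) = c g.
  have [G [gG G0 GE]] := integral_lat_sum dM J c g (fr_supp fr n0) (fr_meas fr n0) (bPsi n0) bD.
  transitivity (\int[leb d.+1]_x ((\sum_(h \in setT) c h * dilate M Phi J%:Z h x) * D x)).
    apply: ae_eq_Rintegral; first exact: bcs_measurable (bW J).
      apply: measurable_funM; last exact: bcs_measurable bD.
      exact: measurable_dilate_sum (fr_supp fr n0) (fr_meas fr n0).
    by apply: filterS cE => x ->.
  rewrite GE (big_fsetD1 g gG)/= (orthonormal_level dM fr) eqxx mulr1 big1_seq ?addr0// => h /=.
  by rewrite !inE => /andP[hg _]; rewrite (orthonormal_level dM fr) (negbTE hg) mulr0.
have WJi i : \int[leb d.+1]_x (W x (J + i)%N * D x) = c g.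
  elim: i => [|i IH]; first by rewrite addn0.
  have [h1 h2] := detail_orth i J g.
  rewrite addnS (@eq_Rintegral _ _ _ _ _ (fun x => W x (J + i)%N * D x + detail (J + i)%N x * D x)).
    by rewrite RintegralD ?IH ?h2 ?addr0//; exact: bcs_integrable.
  by move=> x _; rewrite partial_sumS mulrDl.
have mfD : measurable_fun [set: Rd] (fun x => f x * D x).
  by apply: measurable_funM => //; exact: bcs_measurable bD.
have ig : (leb d.+1).-integrable setT (EFin \o (fun x => `|C| * `|D x|)).
  apply: bcs_integrable; apply: bcs_scale; have [mD [b Db] [b' Db']] := bD.
  split; first exact: (measurableT_comp _ mD).
    by exists b => x; rewrite normr_id.
  by exists b' => x; rewrite normr_eq0; exact: Db'.
pose u_ i x := (W x (J + i)%N * D x)%:E.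
pose u x := (f x * D x)%:E.
have [_ _] : [/\ (leb d.+1).-integrable setT u,
  [sequence \int[leb d.+1]_x `|u_ i x - u x|]_i @ \oo --> 0 &
  [sequence \int[leb d.+1]_x u_ i x]_i @ \oo --> \int[leb d.+1]_x u x]%E.
  apply: (@dominated_convergence _ _ _ (leb d.+1) setT measurableT
    u_ u (fun x => (`|C| * `|D x|)%:E)) => //.
  - by move=> i; apply/measurable_EFinP; exact: bcs_measurable (bW _).
  - exact/measurable_EFinP.
  - apply: filterS fE => x fx _; apply: cvg_EFin; first exact: nearW.
    apply: cvgM; last exact: cvg_cst.
    move: fx; rewrite -(cvg_shiftn J) => fx; apply: cvg_trans fx.
    by apply: near_eq_cvg; apply: nearW => i /=; rewrite addnC.
  - apply: aeW => x i _; rewrite lee_fin normrM ler_wpM2r//.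
    by rewrite (le_trans (WC _ _))// ler_norm.
rewrite (_ : [sequence _]_i = cst (c g)%:E); last first.
  apply/funext => i /=; rewrite -(WJi i) /Rintegral fineK//.
  exact: integrable_fin_num (bcs_integrable (bW _)).
move=> cvgc; have E := cvg_unique _ (@cvg_cst _ (c g)%:E _ \oo _) cvgc.
by rewrite /Rintegral -E.
Qed.

(** Identifies the deterministic target of the linear estimator, the projection of
    [f] onto level [J], with a partial sum whose error is controlled by the Besov
    norm. *)
Lemma projection_partial_sum (f : Rd -> R) (C : R) (J : nat) :
  measurable_fun [set: Rd] f -> wavelet_expansion M Psi f th v ->
  (forall j x, `|W x j| <= C) ->
  {ae leb d.+1, forall x, W x J = \sum_(g \in setT)
    (\int[leb d.+1]_y (f y * dilate M Phi J%:Z g y)) * dilate M Phi J%:Z g x}.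
Proof.
move=> mf fE WC; have [c cE] := partial_level J.
apply: filterS (cE) => x ->; apply: eq_fsbigr => g _.
by rewrite (projection_coef g mf fE WC cE).
Qed.

End projection.

(** * Powers, geometric weights and sequence norms *)

Section real_powers.
Context {R : realType}.

Lemma powR_add (b x y : R) : 0 < b -> b `^ (x + y) = b `^ x * b `^ y.
Proof. by move=> b0; rewrite powRD//; apply/implyP => _; rewrite gt_eqF. Qed.

Lemma powR_le1 (b x : R) : 1 < b -> x <= 0 -> b `^ x <= 1.
Proof. by move=> b1 x0; rewrite -(powRr0 b) ler_powR// ltW. Qed.

Lemma powR_lt1 (b x : R) : 1 < b -> x < 0 -> b `^ x < 1.
Proof.
move=> b1 x0; rewrite lt_neqAle powR_le1 ?(ltW x0)// andbT powR_eq1.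
by rewrite gt_eqF//= ltNge (ltW (lt_trans _ b1))//= lt_eqF.
Qed.

Lemma powR_exprn (b x : R) (n : nat) : b `^ (n%:R * x) = (b `^ x) ^+ n.
Proof. by rewrite mulrC powRrM powR_mulrn// powR_ge0. Qed.

Lemma sum_geometric_le (q : R) (n : nat) : 0 <= q -> q < 1 ->
  \sum_(0 <= l < n) q ^+ l <= (1 - q)^-1.
Proof.
move=> q0 q1; have q1' : 0 < 1 - q by rewrite subr_gt0.
rewrite -[leRHS]mul1r ler_pdivlMr// big_mkord mulrC.
have -> : (1 - q) * \sum_(i < n) q ^+ i = 1 - q ^+ n.
  by rewrite -(opprB (q ^+ n)) subrX1 -mulNr opprB.
by rewrite gerBl exprn_ge0.
Qed.

Lemma nneseries_geometric_le (c q : R) : 0 <= c -> 0 <= q -> q < 1 ->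
  (\sum_(l <oo) (c * q ^+ l)%:E <= (c / (1 - q))%:E)%E.
Proof.
move=> c0 q0 q1; apply: lime_le.
  by apply: is_cvg_nneseries => n _ _; rewrite lee_fin mulr_ge0// exprn_ge0.
apply: nearW => n; rewrite sumEFin lee_fin -mulr_sumr ler_wpM2l//.
exact: sum_geometric_le.
Qed.

(** A substitute for Minkowski's inequality: each term is at most [w ^+ l] times
    the [r]-th root of the weighted sum, and the weights are summable. It reduces a
    power of a sum of details to integrals of powers of single details, at the price
    of half of their geometric decay. *)
Lemma weighted_sum_powR_le (n : nat) (a : nat -> R) (w r : R) :
  0 < w -> w < 1 -> 0 < r ->
  `|\sum_(0 <= l < n) a l| `^ r <=
  (1 - w)^-1 `^ r * \sum_(0 <= l < n) (w `^ (- r)) ^+ l * `|a l| `^ r.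
Proof.
move=> w0 w1 r0; have w1' : 0 < 1 - w by rewrite subr_gt0.
set S := \sum_(0 <= l < n) _ ^+ l * _.
have t0 l : 0 <= (w `^ (- r)) ^+ l * `|a l| `^ r.
  by rewrite mulr_ge0 ?exprn_ge0 ?powR_ge0.
have S0 : 0 <= S by apply: sumr_ge0.
have aS l : (l < n)%N -> `|a l| <= w ^+ l * S `^ r^-1.
  move=> ln; rewrite mulrC -ler_pdivrMr ?exprn_gt0//.
  have -> : `|a l| / w ^+ l = ((w `^ (- r)) ^+ l * `|a l| `^ r) `^ r^-1.
    rewrite powRM ?exprn_ge0 ?powR_ge0// -powRrM mulfV ?gt_eqF// powRr1//.
    rewrite -powR_exprn -powRrM -mulrA mulNr mulfV ?gt_eqF// mulrN1.
    by rewrite powRN powR_mulrn ?(ltW w0)// mulrC.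
  rewrite ge0_ler_powR ?nnegrE ?invr_ge0 ?(ltW r0)//.
  rewrite /S big_mkord (bigD1 (Ordinal ln))//= lerDl sumr_ge0// => i _.
have bound : `|\sum_(0 <= l < n) a l| <= (1 - w)^-1 * S `^ r^-1.
  rewrite (le_trans (ler_norm_sum _ _ _))//.
  apply: (@le_trans _ _ (\sum_(0 <= l < n) w ^+ l * S `^ r^-1)).
    by apply: ler_sum_nat => l /andP[_]; exact: aS.
  rewrite -mulr_suml ler_wpM2r ?powR_ge0//; exact: sum_geometric_le (ltW w0) w1.
apply: (@le_trans _ _ (((1 - w)^-1 * S `^ r^-1) `^ r)).
  rewrite ge0_ler_powR ?nnegrE ?(ltW r0)//.
  by rewrite mulr_ge0 ?powR_ge0// invr_ge0 ltW.
by rewrite powRM ?powR_ge0 ?invr_ge0 ?(ltW w1')// -powRrM mulVf ?gt_eqF// powRr1.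
Qed.

End real_powers.

Section lnorm_facts.
Context {R : realType} {I : choiceType}.
Local Open Scope ereal_scope.

Lemma lnorm_ge_term (p : \bar R) (D : set I) u i : 1 <= p -> D i ->
  `|u i| <= lnorm p D u.
Proof.
case: p => [r|_ Di|//] /=.
  rewrite lee_fin => r1 Di; have r0 : (0 < r)%R by exact: lt_le_trans r1.
  have -> : `|u i| = (`|u i| `^ r) `^ r^-1.
    by rewrite -poweRrM mulfV ?gt_eqF// poweRe1.
  apply: gt0_ler_poweR; rewrite ?invr_ge0 ?(ltW r0)//.
  - by rewrite in_itv /= leey poweR_ge0.
  - by rewrite in_itv /= leey andbT; apply: esum_ge0 => k _; exact: poweR_ge0.
  - apply: esum_ge; exists [set i]; first by split => //; move=> _ ->.
    by rewrite fsbig_set1.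
by apply: ereal_sup_ubound; exists i.
Qed.

Lemma lnorm_ge0 (p : \bar R) (D : set I) u i : 1 <= p -> D i -> 0 <= lnorm p D u.
Proof. by move=> p1 Di; apply: le_trans (lnorm_ge_term u p1 Di). Qed.

(** Inclusion of the sequence spaces: each term is at most the norm, and [t - r] of
    its powers are bounded by that. *)
Lemma esum_powR_le (r t : R) (K : R) (u : I -> R) : (1 <= r)%R -> (r <= t)%R ->
  lnorm r%:E setT (EFin \o u) <= K%:E ->
  \esum_(i in setT) (`|u i| `^ t)%:E <= (K `^ t)%:E.
Proof.
move=> r1 rt uK; have r0 : (0 < r)%R by exact: lt_le_trans r1.
have K0 : (0 <= K)%R.
  by rewrite -lee_fin; apply: le_trans uK; exact: poweR_ge0.
have uiK i : (`|u i| <= K)%R.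
  have := @lnorm_ge_term r%:E setT (EFin \o u) i; rewrite lee_fin => /(_ r1 Logic.I).
  by move/le_trans => /(_ _ uK); rewrite lee_fin.
have E1 : \esum_(i in setT) (`|u i| `^ r)%:E <= (K `^ r)%:E.
  have -> : \esum_(i in setT) (`|u i| `^ r)%:E = lnorm r%:E setT (EFin \o u) `^ r.
    rewrite /= -poweRrM mulVf ?gt_eqF// poweRe1//.
    by apply: esum_ge0 => k _; rewrite lee_fin powR_ge0.
  rewrite -poweR_EFin; apply: gt0_ler_poweR; rewrite ?(ltW r0)//.
  - by rewrite in_itv /= leey andbT; exact: poweR_ge0.
  - by rewrite in_itv /= leey andbT lee_fin.
have -> : (K `^ t)%:E = (K `^ (t - r))%:E * (K `^ r)%:E.
  rewrite -EFinM -powRD ?subrK//; apply/implyP => /eqP t0; exfalso.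
  by move: (lt_le_trans r0 rt); rewrite t0 ltxx.
apply: (@le_trans _ _ (\esum_(i in setT) ((K `^ (t - r))%:E * (`|u i| `^ r)%:E))).
  apply: le_esum => i _; rewrite -EFinM lee_fin.
  have -> : (`|u i| `^ t = `|u i| `^ (t - r) * `|u i| `^ r)%R.
    rewrite -powRD ?subrK//; apply/implyP => /eqP t0; exfalso.
    by move: (lt_le_trans r0 rt); rewrite t0 ltxx.
  by rewrite ler_wpM2r ?powR_ge0// ge0_ler_powR ?nnegrE ?subr_ge0.
apply: ge_ereal_sup => _ [X [finX _] <-].
rewrite -ge0_mule_fsumr; last by move=> i; rewrite lee_fin powR_ge0.
rewrite lee_wpmul2l ?lee_fin ?powR_ge0//; apply: le_trans E1.
by apply: esum_ge; exists X.
Qed.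

End lnorm_facts.

(** * Norms of a single level *)

Lemma esum_scale_le (R : realType) (I : choiceType) (k : R) (u : I -> \bar R) :
  (0 <= k)%R -> (forall i, 0 <= u i)%E ->
  (\esum_(i in [set: I]) (k%:E * u i) <= k%:E * \esum_(i in [set: I]) u i)%E.
Proof.
move=> k0 u0; apply: ge_ereal_sup => _ [X [finX _] <-].
rewrite -ge0_mule_fsumr// lee_wpmul2l ?lee_fin//.
by apply: esum_ge; exists X.
Qed.

Lemma ndet_gt1 (R : realType) d (M : 'M[R]_d.+1) : dilation_matrix M -> (1 < ndet M)%N.
Proof.
move=> dM; have M1 := absdet_gt1 dM.
have /choice[g gE] : forall j, exists g : 'cV[int]_d.+1, M *m zvec (delta_mx j 0) = zvec g :> 'cV[R]_d.+1.
  by move=> j; exact: dilation_lattice dM _.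
pose A : 'M[int]_d.+1 := \matrix_(i, j) g j i 0.
have MA : M = map_mx intr A.
  apply/matrixP => i j; have /colP/(_ i) := gE j; rewrite !mxE => <-.
  rewrite (bigD1 j)//= big1 => [|k kj]; last by rewrite !mxE (negbTE kj) mulr0.
  by rewrite !mxE !eqxx mulr1 addr0.
have E : absdet M = (absz (\det A))%:R.
  by rewrite /absdet [in LHS]MA det_map_mx /= -intr_norm natr_absz.
by rewrite /ndet E natrK; move: M1; rewrite E -[1]/(1%:R) ltr_nat.
Qed.

Section level_norms.
Context {R : realType} {d : nat}.
Local Notation Rd := ('cV[R]_d.+1).
Local Notation Zd := ('cV[int]_d.+1).
Variables (M : 'M[R]_d.+1) (dM : dilation_matrix M).
Variables (Psi : nat -> Rd -> R) (L : nat) (B : R) (a : nat -> Zd -> R).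
Variables (F : {fset Zd}) (mz : Zd -> Zd).
Hypothesis fr : finite_refinement M Psi L B a F mz.
Local Notation b := (absdet M).

Let b0 := absdet_gt0 dM.
Let b1 := absdet_gt1 dM.

(** An upper bound for the number of translates of a function supported in a cube
    of side [L] that are nonzero at a given point. *)
Definition overlap : R := #|{ffun 'I_d.+1 -> 'I_L.+1}|%:R.

Lemma wavelet_bound_ge0 : 0 <= B.
Proof. exact: le_trans (normr_ge0 _) (fr_bound fr (ndet_gt0 dM) 0). Qed.

(** Bound for the [r]-th power integral of a wavelet at level [l]: the height
    scales by [b ^ (l/2)], the volume of the support by [b ^ (-l)]. *)
Definition level_mass (r : R) (l : nat) : R :=
  b `^ (l%:R * (r / 2 - 1)) * (B `^ r * L%:R ^+ d.+1).

Lemma level_mass_ge0 r l : 0 <= level_mass r l.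
Proof. by rewrite !mulr_ge0 ?powR_ge0// exprn_ge0. Qed.

Lemma measurable_norm_powR (u : Rd -> R) r : measurable_fun [set: Rd] u ->
  measurable_fun [set: Rd] (fun x => (`|u x| `^ r)%:E).
Proof.
move=> mu; apply/measurable_EFinP.
apply: (measurableT_comp (measurable_powR _)).
exact: (measurableT_comp _ mu).
Qed.

Lemma integral_dilate_powR k (l : nat) g (r : R) : (k < ndet M)%N -> 0 < r ->
  (\int[leb d.+1]_x (`|dilate M (Psi k) l%:Z g x| `^ r)%:E <= (level_mass r l)%:E)%E.
Proof.
move=> kn r0.
pose u x := (`|Psi k x| `^ r)%:E.
have mu : measurable_fun [set: Rd] u := measurable_norm_powR r (fr_meas fr kn).
have u0 x : (0 <= u x)%E by rewrite lee_fin powR_ge0.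
have E x : ((`|dilate M (Psi k) l%:Z g x| `^ r)%:E =
    (b `^ (l%:R * (r / 2)))%:E * u (M ^+ l *m x + (- zvec g))%R)%E.
  rewrite dilateE normrM powRM// (ger0_norm (powR_ge0 _ _)) -powRrM -EFinM.
  by rewrite -!mulrA [2^-1 * r]mulrC.
under eq_integral do rewrite E.
rewrite ge0_integralZl ?lee_fin ?powR_ge0//; last first.
  apply: (measurableT_comp mu).
  exact: (measurableT_comp (measurable_addmx _) (measurable_mulmx _)).
rewrite (ge0_integral_affine _ (dilation_unit dM l))//.
have -> : `|\det (M ^+ l)|^-1 = b `^ (- l%:R).
  by rewrite -/(absdet _) absdetX powRN powR_mulrn// ltW.
rewrite muleA -EFinM -powR_add// /level_mass EFinM.
rewrite (_ : l%:R * (r / 2) + - l%:R = l%:R * (r / 2 - 1)); last by ring.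
rewrite lee_wpmul2l ?lee_fin ?powR_ge0//.
pose E0 := [set x : Rd | forall i, 0 <= x i 0 <= L%:R].
have mE0 : measurable E0 by exact: measurable_cube.
apply: (@le_trans _ _ (\int[leb d.+1]_x ((B `^ r)%:E * (\1_E0 x)%:E))%E).
  apply: le_integral_ge0 => // x; rewrite -EFinM lee_fin indicE.
  have [->|px] := eqVneq (Psi k x) 0.
    by rewrite normr0 powR0 ?gt_eqF// mulr_ge0 ?powR_ge0.
  rewrite mem_set ?mulr1; last exact: (fr_supp fr kn).
  by rewrite ge0_ler_powR ?nnegrE ?(ltW r0) ?wavelet_bound_ge0//; exact: (fr_bound fr kn).
rewrite ge0_integralZl ?lee_fin ?powR_ge0//; last first.
  by apply/measurable_EFinP; exact: measurable_indic.
rewrite integral_indic// setIT -/E0 EFinM.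
by rewrite [X in (_ * X)%E](leb_cube (ler0n _ L)) subr0.
Qed.

(** At each point at most [overlap] translates contribute, so the power of the sum
    is bounded by the sum of the powers. *)
Lemma integral_lat_sum_powR k (l : nat) (c : Zd -> R) (r : R) :
  (k < ndet M)%N -> 0 < r ->
  (\int[leb d.+1]_x (`|\sum_(g \in setT) c g * dilate M (Psi k) l%:Z g x|%R `^ r)%:E <=
   (overlap `^ r * level_mass r l)%:E * \esum_(g in setT) (`|c g| `^ r)%:E)%E.
Proof.
move=> kn r0.
pose G g x := (`|c g * dilate M (Psi k) l%:Z g x| `^ r)%:E.
have mG g : measurable_fun [set: Rd] (G g).
  apply: measurable_norm_powR; apply: measurable_funM => //.
  exact: measurable_dilate (fr_meas fr kn).
have G0 g x : (0 <= G g x)%E by rewrite lee_fin powR_ge0.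
have [mS IS] := measurable_esum (leb d.+1) mG G0.
apply: (@le_trans _ _ (\int[leb d.+1]_x ((overlap `^ r)%:E * \esum_(g in setT) G g x))%E).
  apply: le_integral_ge0 => x; first by rewrite lee_fin powR_ge0.
  rewrite (fsum_dilate _ _ _ _ (fr_supp fr kn)).
  set T := \sum_e _.
  apply: (@le_trans _ _ ((overlap `^ r)%:E * (\sum_e `|c (lat (M ^+ l *m x) e) *
      dilate M (Psi k) l%:Z (@lat _ _ L (M ^+ l *m x) e) x| `^ r)%:E)%E).
    by rewrite -EFinM lee_fin; exact: powR_sum_le.
  rewrite lee_wpmul2l ?lee_fin ?powR_ge0//.
  apply: esum_ge; exists [set` codom (@lat _ _ L (M ^+ l *m x))].
    by split => //; exact: finite_seq.
  rewrite -fsbig_seq; last first.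
    by rewrite map_inj_uniq ?enum_uniq//; exact: lat_inj.
  by rewrite big_map big_enum /= sumEFin.
rewrite ge0_integralZl ?lee_fin ?powR_ge0//; last by move=> x _; exact: esum_ge0.
rewrite IS EFinM -muleA lee_wpmul2l ?lee_fin ?powR_ge0//.
apply: (@le_trans _ _ (\esum_(g in setT) ((level_mass r l)%:E * (`|c g| `^ r)%:E))%E); last first.
  apply: esum_scale_le; first exact: level_mass_ge0.
  by move=> g; rewrite lee_fin powR_ge0.
apply: le_esum => g _.
rewrite /G; under eq_integral do rewrite normrM powRM// EFinM.
rewrite ge0_integralZl ?lee_fin ?powR_ge0//; last first.
  by apply: measurable_norm_powR; exact: measurable_dilate (fr_meas fr kn).
by rewrite muleC lee_wpmul2r ?lee_fin ?powR_ge0//; exact: integral_dilate_powR.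
Qed.

Lemma lat_sum_bound k (l : nat) (c : Zd -> R) (C : R) x : (k < ndet M)%N ->
  (forall g, `|c g| <= C) ->
  `|\sum_(g \in setT) c g * dilate M (Psi k) l%:Z g x| <=
  overlap * (C * (b `^ (l%:R / 2) * B)).
Proof.
move=> kn cC; rewrite (fsum_dilate _ _ _ _ (fr_supp fr kn)).
rewrite (le_trans (ler_norm_sum _ _ _))//.
apply: (@le_trans _ _ (\sum_(e : {ffun 'I_d.+1 -> 'I_L.+1}) C * (b `^ (l%:R / 2) * B))).
  apply: ler_sum => e _; rewrite normrM ler_pM//.
  by apply: dilate_bounded; exact: (fr_bound fr kn).
rewrite sumr_const /overlap -[leLHS]mulr_natl; exact: lexx.
Qed.

End level_norms.

(** * Uniform bounds on the wavelet expansion *)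

Section besov_bounds.
Context {R : realType} {d : nat}.
Local Notation Rd := ('cV[R]_d.+1).
Local Notation Zd := ('cV[int]_d.+1).
Variables (M : 'M[R]_d.+1) (dM : dilation_matrix M).
Variables (Psi : nat -> Rd -> R) (L : nat) (B : R) (a : nat -> Zd -> R).
Variables (F : {fset Zd}) (mz : Zd -> Zd).
Hypothesis fr : finite_refinement M Psi L B a F mz.
Local Notation b := (absdet M).
Local Notation ov := (@overlap R d L).
Variables (s : R) (p q : \bar R) (K : R).
Hypotheses (p1 : (1 <= p)%E) (q1 : (1 <= q)%E) (sp : recip p < s).

Let b0 := absdet_gt0 dM.
Let b1 := absdet_gt1 dM.
Let B0 : 0 <= B := wavelet_bound_ge0 dM fr.

Lemma recip_ge0 : 0 <= recip p.
Proof.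
case: p p1 => [r|//|//] /=; rewrite lee_fin => r1.
by rewrite invr_ge0 (le_trans _ r1).
Qed.

(** The ratio of consecutive uniform bounds on the details: coefficients of size
    [b ^ (-j (s + 1/2 - 1/p))] times functions of height [b ^ (j/2)]. It is below
    one exactly because [s > 1/p]. *)
Definition sup_rate : R := b `^ (- (s - recip p)).
Definition sup_const : R := (ndet M)%:R * (ov * (K * B)).

Lemma sup_rate_ge0 : 0 <= sup_rate. Proof. exact: powR_ge0. Qed.

Lemma sup_rate_lt1 : sup_rate < 1.
Proof. by apply: powR_lt1 => //; rewrite oppr_lt0 subr_gt0. Qed.

Definition partial_sum_bound : R :=
  ov * (K * B) + sup_const / (1 - sup_rate).

Section coefficients.
Variables (th : Zd -> R) (v : nat -> nat -> Zd -> R).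
Hypothesis hK : (besov_norm M s p q th v <= K%:E)%E.
Local Notation W := (besov_partial_sum M Psi th v).

Let D := [set kj : nat * nat | (0 < kj.1 < ndet M)%N].
Let D1 : D (1%N, 0%N).
Proof. by rewrite /D /= (ndet_gt1 dM). Qed.

Let lv_ge0 k j : (0 <= lnorm p setT (EFin \o v k j))%E.
Proof. exact: (lnorm_ge0 _ (i := 0 : Zd)). Qed.

Let lth_ge0 : (0 <= lnorm p setT (EFin \o th))%E.
Proof. exact: (lnorm_ge0 _ (i := 0 : Zd)). Qed.

Lemma besov_coef_scaling : (lnorm p setT (EFin \o th) <= K%:E)%E.
Proof.
apply: le_trans hK; rewrite /besov_norm leeDl//.
exact: (lnorm_ge0 _ q1 D1).
Qed.

Lemma besov_bound_ge0 : 0 <= K.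
Proof. by rewrite -lee_fin; exact: le_trans besov_coef_scaling. Qed.

Definition coef_bound (j : nat) : R := K * b `^ (- (j%:R * (s + 2^-1 - recip p))).

Lemma besov_coef_detail k j : (0 < k < ndet M)%N ->
  (lnorm p setT (EFin \o v k j) <= (coef_bound j)%:E)%E.
Proof.
move=> kn.
have H : ((b `^ (j%:R * (s + 2^-1 - recip p)))%:E * lnorm p setT (EFin \o v k j) <= K%:E)%E.
  apply: le_trans hK; rewrite /besov_norm.
  apply: (@le_trans _ _ (lnorm q D (fun kj => (b `^ (kj.2%:R * (s + 2^-1 - recip p)))%:E *
      lnorm p setT (EFin \o v kj.1 kj.2))%E)).
    have := @lnorm_ge_term _ _ q D (fun kj => (b `^ (kj.2%:R * (s + 2^-1 - recip p)))%:E *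
      lnorm p setT (EFin \o v kj.1 kj.2))%E (k, j) q1 kn.
    by rewrite /= gee0_abs// mule_ge0// lee_fin powR_ge0.
  by rewrite leeDr.
rewrite /coef_bound powRN EFinM -lee_pdivrMr ?invr_gt0 ?powR_gt0// invrK muleC.
exact: H.
Qed.

Lemma scaling_coef_le g : `|th g| <= K.
Proof.
have := @lnorm_ge_term _ _ p setT (EFin \o th) g p1 Logic.I.
by move/le_trans => /(_ _ besov_coef_scaling); rewrite lee_fin.
Qed.

Lemma detail_coef_le k j g : (0 < k < ndet M)%N -> `|v k j g| <= coef_bound j.
Proof.
move=> kn; have := @lnorm_ge_term _ _ p setT (EFin \o v k j) g p1 Logic.I.
by move/le_trans => /(_ _ (besov_coef_detail j kn)); rewrite lee_fin.
Qed.

Lemma detail_sup j x : `|detail M Psi v j x| <= sup_const * sup_rate ^+ j.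
Proof.
rewrite /detail (le_trans (ler_norm_sum _ _ _))//.
apply: (@le_trans _ _ (\sum_(1 <= k < ndet M)
    (ov * (coef_bound j * (b `^ (j%:R / 2) * B))))).
  apply: ler_sum_nat => k kn; apply: (lat_sum_bound fr); first by case/andP: kn.
  by move=> g; exact: detail_coef_le.
have E : coef_bound j * (b `^ (j%:R / 2) * B) = K * B * sup_rate ^+ j.
  rewrite /coef_bound /sup_rate -powR_exprn.
  rewrite (_ : j%:R * - (s - recip p) = - (j%:R * (s + 2^-1 - recip p)) + j%:R / 2); last by field.
  by rewrite powR_add//; ring.
rewrite E sumr_const_nat /sup_const -[leLHS]mulr_natl -!mulrA ler_wpM2r//.
  by rewrite !mulr_ge0 ?besov_bound_ge0// ?exprn_ge0 ?sup_rate_ge0// ler0n.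
by rewrite ler_nat leq_subr.
Qed.

Lemma sup_const_ge0 : 0 <= sup_const.
Proof. by rewrite /sup_const !mulr_ge0 ?besov_bound_ge0 ?ler0n. Qed.

(** The geometric series of the uniform bounds on the details. The bound depends on
    [f] only through [K]; it dominates the projection argument and bounds the
    densities of a Besov ball uniformly. *)
Lemma partial_sum_le j x : `|W x j| <= partial_sum_bound.
Proof.
have W0 : `|W x 0%N| <= ov * (K * B).
  rewrite /besov_partial_sum [X in _ + X]big1 ?addr0 => [|k _]; last by rewrite big_geq.
  have := lat_sum_bound fr 0 x (ndet_gt0 dM) scaling_coef_le.
  by rewrite mul0r powRr0 mul1r.
rewrite -[j]add0n partial_sum_details (le_trans (ler_normD _ _))// lerD//.
rewrite (le_trans (ler_norm_sum _ _ _))//.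
apply: (@le_trans _ _ (\sum_(0 <= l < j) sup_const * sup_rate ^+ l)).
  by apply: ler_sum_nat => l _; rewrite add0n; exact: detail_sup.
rewrite -mulr_sumr ler_wpM2l ?sup_const_ge0//.
exact: sum_geometric_le sup_rate_ge0 sup_rate_lt1.
Qed.

Lemma tail_sup (f : Rd -> R) j x : W x J @[J --> \oo] --> f x ->
  `|f x - W x j| <= sup_const / (1 - sup_rate) * sup_rate ^+ j.
Proof.
move=> fx.
have : `|W x (j + i)%N - W x j| @[i --> \oo] --> `|f x - W x j|.
  apply: cvg_norm; apply: cvgB; last exact: cvg_cst.
  move: fx; rewrite -(cvg_shiftn j) => fx; apply: cvg_trans fx.
  by apply: near_eq_cvg; apply: nearW => i /=; rewrite addnC.
move/cvgr_to_le; apply; apply: nearW => i.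
rewrite partial_sum_details addrAC subrr add0r (le_trans (ler_norm_sum _ _ _))//.
apply: (@le_trans _ _ (\sum_(0 <= l < i) sup_const * sup_rate ^+ j * sup_rate ^+ l)).
  by apply: ler_sum_nat => l _; rewrite -mulrA -exprD; exact: detail_sup.
rewrite -mulr_sumr mulrAC ler_wpM2r ?exprn_ge0 ?sup_rate_ge0//.
by rewrite ler_wpM2l ?sup_const_ge0//; exact: sum_geometric_le sup_rate_ge0 sup_rate_lt1.
Qed.

End coefficients.
End besov_bounds.

(** * Integrability of the tail of the expansion *)

Section tail.
Context {R : realType} {d : nat}.
Local Notation Rd := ('cV[R]_d.+1).
Local Notation Zd := ('cV[int]_d.+1).
Variables (M : 'M[R]_d.+1) (dM : dilation_matrix M).
Variables (Psi : nat -> Rd -> R) (L : nat) (B : R) (a : nat -> Zd -> R).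
Variables (F : {fset Zd}) (mz : Zd -> Zd).
Hypothesis fr : finite_refinement M Psi L B a F mz.
Local Notation b := (absdet M).
Local Notation ov := (@overlap R d L).
Variables (s : R) (p0 : R) (q : \bar R) (K : R).
Hypotheses (p1 : (1 <= p0%:E)%E) (q1 : (1 <= q)%E) (sp : p0^-1 < s).

Let b0 := absdet_gt0 dM.
Let b1 := absdet_gt1 dM.

Let p0_gt0 : 0 < p0.
Proof. by have := p1; rewrite lee_fin; exact: lt_le_trans. Qed.

Definition level_const (r : R) : R :=
  (ndet M)%:R `^ r * ((ndet M)%:R * (ov `^ r * (B `^ r * L%:R ^+ d.+1) * K `^ r)).

Section coefficients.
Variables (th : Zd -> R) (v : nat -> nat -> Zd -> R).
Hypothesis hK : (besov_norm M s p0%:E q th v <= K%:E)%E.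
Local Notation W := (besov_partial_sum M Psi th v).

(** The sequence norm with exponent [p0] controls the one with [r >= p0]; the
    scaling of [level_mass] turns the exponent [s + 1/2 - 1/p0] into
    [s + 1/r - 1/p0]. *)
Lemma integral_detail_powR (r : R) (l : nat) : p0 <= r ->
  (\int[leb d.+1]_x (`|detail M Psi v l x| `^ r)%:E <=
   (level_const r * b `^ (- (l%:R * (r * (s + r^-1 - p0^-1)))))%:E)%E.
Proof.
move=> pr.
have r0 : 0 < r by exact: lt_le_trans pr.
have K0 : 0 <= K := besov_bound_ge0 dM p1 q1 hK.
pose S (k : 'I_(ndet M)) x := if (0 < k)%N then
  \sum_(g \in setT) v k l g * dilate M (Psi k) l%:Z g x else 0.
have dE x : detail M Psi v l x = \sum_k S k x.
  rewrite /detail big_geq_mkord big_mkcond /=.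
  by apply: eq_bigr => k _; rewrite /S.
have mS k : measurable_fun [set: Rd] (S k).
  rewrite /S; case: (0 < k)%N; last exact: measurable_cst.
  exact: measurable_dilate_sum (fr_supp fr (ltn_ord k)) (fr_meas fr (ltn_ord k)).
apply: (@le_trans _ _ (\int[leb d.+1]_x (((ndet M)%:R `^ r)%:E * \sum_k (`|S k x| `^ r)%:E))%E).
  apply: le_integral_ge0 => x; first by rewrite lee_fin powR_ge0.
  rewrite sumEFin -EFinM lee_fin dE.
  by have := @powR_sum_le R _ (fun k => S k x) r r0; rewrite card_ord.
have mSr k : measurable_fun [set: Rd] (fun x => (`|S k x| `^ r)%:E).
  exact: measurable_norm_powR.
rewrite ge0_integralZl ?lee_fin ?powR_ge0//; last 2 first.
- exact: emeasurable_sum.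
- by move=> x _; apply: sume_ge0 => k _; rewrite lee_fin powR_ge0.
rewrite ge0_integral_sum//.
pose T := ov `^ r * (B `^ r * L%:R ^+ d.+1) * K `^ r *
  b `^ (- (l%:R * (r * (s + r^-1 - p0^-1)))).
have T0 : 0 <= T.
  by rewrite !mulr_ge0 ?powR_ge0// exprn_ge0.
have ST k : (\int[leb d.+1]_x (`|S k x| `^ r)%:E <= T%:E)%E.
  rewrite /S; case: (ltnP 0 k) => k0; last first.
    rewrite integral0_eq; first by rewrite lee_fin.
    by move=> x _; rewrite normr0 powR0// gt_eqF.
  have kn : (0 < k < ndet M)%N by rewrite k0 ltn_ord.
  apply: (le_trans (integral_lat_sum_powR dM fr l (v k l) (ltn_ord k) r0)).
  have := esum_powR_le p1 pr (besov_coef_detail dM p1 q1 hK l kn).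
  have c0 : (0 <= (ov `^ r * level_mass M L B r l)%:E)%E.
    by rewrite lee_fin mulr_ge0 ?powR_ge0// level_mass_ge0.
  move/(lee_wpmul2l c0)/le_trans; apply.
  rewrite -EFinM lee_fin /T /level_mass /coef_bound powRM ?powR_ge0// -powRrM.
  rewrite (_ : - (l%:R * (r * (s + r^-1 - p0^-1))) =
    l%:R * (r / 2 - 1) + - (l%:R * (s + 2^-1 - p0^-1)) * r); last first.
    by field; rewrite !gt_eqF.
  by rewrite powR_add//= le_eqVlt; apply/orP; left; apply/eqP; ring.
apply: (@le_trans _ _ (((ndet M)%:R `^ r)%:E * (\sum_(k < ndet M) T%:E))%E).
  by rewrite lee_wpmul2l ?lee_fin ?powR_ge0//; apply: lee_sum.
rewrite sumEFin sumr_const card_ord -EFinM lee_fin -(mulr_natl T) /level_const /T.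
by rewrite le_eqVlt; apply/orP; left; apply/eqP; ring.
Qed.

(** Details decay like [b ^ (-j sig)] with [sig = s + 1/r - 1/p0]. Half of this rate
    is spent on the weights [w ^+ l], the other half keeps the resulting series
    geometric. *)
Definition tail_const (r : R) : R :=
  let w := b `^ (- ((s + r^-1 - p0^-1) / 2)) in
  (1 - w)^-1 `^ r * (level_const r / (1 - w `^ r)).

(** The bound of [weighted_sum_powR_le] is uniform over finite partial sums, hence
    passes to their pointwise limit; the weighted series is then integrated term by
    term. *)
Lemma integral_tail_powR (r : R) (j : nat) (f : Rd -> R) : p0 <= r ->
  wavelet_expansion M Psi f th v ->
  (\int[leb d.+1]_x (`|f x - W x j| `^ r)%:E <=
   (tail_const r * b `^ (- (j%:R * (r * (s + r^-1 - p0^-1)))))%:E)%E.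
Proof.
move=> pr fE.
have r0 : 0 < r by exact: lt_le_trans pr.
have K0 : 0 <= K := besov_bound_ge0 dM p1 q1 hK.
set sig := s + r^-1 - p0^-1.
have sig0 : 0 < sig.
  by rewrite /sig addrAC addr_gt0 ?subr_gt0// invr_gt0.
rewrite /tail_const -/sig; set w := b `^ (- (sig / 2)).
have w0 : 0 < w by rewrite powR_gt0.
have w1 : w < 1 by apply: powR_lt1 => //; rewrite oppr_lt0 divr_gt0.
have wr1 : w `^ r < 1.
  by rewrite /w -powRrM powR_lt1// nmulr_rlt0// oppr_lt0 divr_gt0.
pose u l x := ((w `^ (- r)) ^+ l * `|detail M Psi v (j + l)%N x| `^ r)%:E.
have u0 l x : (0 <= u l x)%E by rewrite lee_fin mulr_ge0 ?exprn_ge0 ?powR_ge0.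
have mu l : measurable_fun [set: Rd] (u l).
  rewrite /u; under eq_fun do rewrite EFinM.
  apply: emeasurable_funM; first exact: measurable_cst.
  apply: measurable_norm_powR; exact: (measurable_detail fr).
pose T x := (((1 - w)^-1 `^ r)%:E * \sum_(l <oo) u l x)%E.
have T0 x : (0 <= T x)%E.
  by rewrite mule_ge0// ?lee_fin ?powR_ge0//; apply: nneseries_ge0.
have mS : measurable_fun [set: Rd] (fun x => \sum_(l <oo) u l x)%E.
  exact: ge0_emeasurable_sum.
have mT : measurable_fun [set: Rd] T.
  by apply: emeasurable_funM => //; exact: measurable_cst.
apply: (@le_trans _ _ (\int[leb d.+1]_x T x)%E).
  apply: ae_le_integral_ge0 => //.
  apply: filterS fE => x fx.
  (* [T x] bounds all partial sums of the tail; it may be infinite at some [x]. *)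
  have fin_le i : ((`|W x (j + i)%N - W x j| `^ r)%:E <= T x)%E.
    rewrite partial_sum_details addrAC subrr add0r.
    apply: (@le_trans _ _ (((1 - w)^-1 `^ r)%:E * \sum_(0 <= l < i) u l x)%E).
      rewrite sumEFin -EFinM lee_fin; exact: weighted_sum_powR_le.
    rewrite lee_wpmul2l ?lee_fin ?powR_ge0//.
    exact: nneseries_lim_ge.
  have [Tfin|] := boolP (T x \is a fin_num); last first.
    by rewrite ge0_fin_numE// -leNgt leye_eq => /eqP ->; rewrite leey.
  have : `|W x (j + i)%N - W x j| @[i --> \oo] --> `|f x - W x j|.
    apply: cvg_norm; apply: cvgB; last exact: cvg_cst.
    move: fx; rewrite -(cvg_shiftn j) => fx; apply: cvg_trans fx.
    by apply: near_eq_cvg; apply: nearW => i /=; rewrite addnC.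
  have fT0 : 0 <= fine (T x) by exact: fine_ge0.
  move=> /cvgr_to_le; move/(_ (fine (T x) `^ r^-1)).
  have : \forall i \near \oo, `|W x (j + i)%N - W x j| <= fine (T x) `^ r^-1.
    apply: nearW => i; have := fin_le i; rewrite -(fineK Tfin) lee_fin => h.
    rewrite -[leLHS]powRr1// -(@mulfV _ r) ?gt_eqF// powRrM.
    by rewrite ge0_ler_powR ?nnegrE ?invr_ge0 ?(ltW r0) ?powR_ge0.
  move=> h1 h2; rewrite -(fineK Tfin) lee_fin.
  rewrite -[leRHS]powRr1// -(@mulVf _ r) ?gt_eqF// powRrM.
  by rewrite ge0_ler_powR ?nnegrE ?(ltW r0) ?powR_ge0//; exact: h2.
rewrite ge0_integralZl ?lee_fin ?powR_ge0//; last by move=> x _; apply: nneseries_ge0.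
rewrite integral_nneseries//.
rewrite -mulrA EFinM lee_wpmul2l ?lee_fin ?powR_ge0//.
have L0 : 0 <= level_const r.
  by rewrite /level_const !mulr_ge0 ?powR_ge0 ?ler0n// exprn_ge0.
have q0 : 0 <= w `^ r by exact: powR_ge0.
have c0 : 0 <= level_const r * b `^ (- (j%:R * (r * sig))) by rewrite mulr_ge0 ?powR_ge0.
have := nneseries_geometric_le c0 q0 wr1.
rewrite [X in (_ <= X%:E)%E -> _]mulrAC; apply: le_trans.
apply: lee_nneseries => l _; first by move=> _; apply: integral_ge0 => x _; exact: u0.
rewrite /u; under eq_integral do rewrite EFinM.
rewrite ge0_integralZl ?lee_fin ?exprn_ge0 ?powR_ge0//; last first.
  by apply: measurable_norm_powR; exact: (measurable_detail fr).
have e0 : (0 <= ((w `^ (- r)) ^+ l)%:E)%E by rewrite lee_fin exprn_ge0 ?powR_ge0.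
have := integral_detail_powR (j + l) pr.
move/(lee_wpmul2l e0)/le_trans; apply.
rewrite -EFinM lee_fin -/sig mulrCA -mulrA ler_wpM2l//.
rewrite /w -!powRrM -!powR_exprn -!powR_add// natrD.
rewrite le_eqVlt; apply/orP; left; apply/eqP; congr (_ `^ _); by field.
Qed.

End coefficients.
End tail.

(** * The bias *)

Lemma mx_coord_le (K : realDomainType) m n (x : 'M[K]_(m, n)) i j :
  `|x i j| <= `|x|.
Proof.
rewrite [leRHS]mx_normrE.
exact: (le_bigmax _ (fun ij : 'I_m * 'I_n => `|x ij.1 ij.2|) (i, j)).
Qed.

Section bias.
Context {R : realType} {d : nat}.
Local Notation Rd := ('cV[R]_d.+1).
Local Notation Zd := ('cV[int]_d.+1).
Variables (M : 'M[R]_d.+1) (dM : dilation_matrix M).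
Variables (Psi : nat -> Rd -> R) (L : nat) (B : R) (a : nat -> Zd -> R).
Variables (F : {fset Zd}) (mz : Zd -> Zd).
Hypothesis fr : finite_refinement M Psi L B a F mz.
Local Notation b := (absdet M).
Local Notation Phi := (Psi 0%N).

Let b0 := absdet_gt0 dM.
Let b1 := absdet_gt1 dM.

Definition level_proj (f : Rd -> R) (j : nat) (x : Rd) : R :=
  \sum_(g \in setT) (\int[leb d.+1]_y (f y * dilate M Phi j%:Z g y)) * dilate M Phi j%:Z g x.

Lemma bounded_set_cube (A : set Rd) : bounded_set A ->
  exists2 c : R, 0 <= c & forall x, A x -> forall i, `|x i 0| <= c.
Proof.
move=> [c [_ hc]]; have cA x : A x -> `|x| <= c + 1.
  by move=> Ax; apply: (hc (c + 1)) => //; rewrite ltrDl.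
exists `|c + 1| => // x Ax i.
by rewrite (le_trans (mx_coord_le _ _ _))// (le_trans (cA x Ax))// ler_norm.
Qed.

(** A point in the support of the projection shares a wavelet with a point of [A],
    and by [dilation_expand] the support of a wavelet has diameter bounded
    independently of the level. *)
Lemma level_proj_support (A : set Rd) : bounded_set A ->
  exists2 c : R, 0 <= c & forall f : Rd -> R, (forall x, f x != 0 -> A x) ->
    forall (j : nat) x, f x - level_proj f j x != 0 -> forall i, `|x i 0| <= c.
Proof.
move=> /bounded_set_cube[c c0 cA].
have [Lam Lam1 hLam] := dilation_expand dM.
have Lam0 : 0 <= Lam by exact: le_trans Lam1.
exists (c + Lam * L%:R); first by rewrite addr_ge0// mulr_ge0.
move=> f fA j x fx i.
have [/eqP f0|/fA Ax] := boolP (f x == 0); last first.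
  by rewrite (le_trans (cA _ Ax i))// lerDl mulr_ge0.
move: fx; rewrite f0 sub0r oppr_eq0 => px.
have [g] : exists g, (\int[leb d.+1]_y (f y * dilate M Phi j%:Z g y)) * dilate M Phi j%:Z g x != 0.
  apply: contrapT => /forallNP H; move/eqP: px; apply.
  by apply: fsbig1 => g _; apply/eqP; apply: contrapT => /negP; exact: H.
rewrite mulf_eq0 negb_or => /andP[ig gx].
have [y] : exists y, f y * dilate M Phi j%:Z g y != 0.
  apply: contrapT => /forallNP H; move/eqP: ig; apply.
  rewrite /Rintegral integral0_eq// => y _; congr EFin.
  by apply/eqP; apply: contrapT => /negP; exact: H.
rewrite mulf_eq0 negb_or => /andP[/fA Ay gy].
have sx := supp_dilate (fr_supp fr (ndet_gt0 dM)) gx.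
have sy := supp_dilate (fr_supp fr (ndet_gt0 dM)) gy.
have xy k : `|(x - y) k 0| <= Lam * L%:R.
  apply: (hLam j) => l.
  have -> : M ^+ j *m (x - y) = (M ^+ j *m x - zvec g) - (M ^+ j *m y - zvec g).
    by rewrite mulmxBr opprB addrA subrK.
  move: (sx l) (sy l); set u := _ - _; set w := _ - _ => /andP[u1 u2] /andP[w1 w2].
  rewrite [X in `|X|](_ : _ = u l 0 - w l 0); last by rewrite [LHS]mxE [X in _ + X]mxE.
  by rewrite ler_norml; apply/andP; split; lra.
have -> : x i 0 = (x - y) i 0 + y i 0 by rewrite -[in LHS](subrK y x) mxE.
by rewrite (le_trans (ler_normD _ _))// addrC lerD// cA.
Qed.

(** A pointwise substitute for the inequality between norms of different exponents
    on a set of finite measure: values below [t] are bounded by [t], larger ones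
    gain from the higher exponent. *)
Lemma powR_split_le (t g r r' : R) : 0 < t -> 0 <= g -> 0 < r' -> r' <= r ->
  g `^ r' <= t `^ r' + t `^ (r' - r) * g `^ r.
Proof.
move=> t0 g0 r'0 rr.
have [gt|tg] := leP g t.
  rewrite -[leLHS]addr0 lerD ?mulr_ge0 ?powR_ge0//.
  by rewrite ge0_ler_powR ?nnegrE ?(ltW r'0) ?(ltW t0).
rewrite -[leLHS]add0r lerD ?powR_ge0//.
have gg : 0 < g by exact: lt_trans tg.
have -> : g `^ r' = g `^ (r' - r) * g `^ r by rewrite -powR_add// subrK.
rewrite ler_wpM2r ?powR_ge0//.
have tr : t `^ (r - r') <= g `^ (r - r').
  by rewrite ge0_ler_powR ?nnegrE ?subr_ge0 ?(ltW t0) ?(ltW tg).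
by rewrite -(opprB r r') !powRN lef_pV2 ?posrE ?powR_gt0.
Qed.

Variables (s : R) (p q : \bar R) (K p' : R) (A : set Rd).
Hypotheses (p1 : (1 <= p)%E) (q1 : (1 <= q)%E) (sp : recip p < s).
Hypotheses (p'1 : 1 <= p') (bA : (p'%:E < p)%E -> bounded_set A).

Let p'0 : 0 < p'. Proof. exact: lt_le_trans p'1. Qed.

(** For [p <= p'] the tail is integrated directly with exponent [p'], and
    [s' = s + 1/p' - 1/p]. For [p' < p] the set [A] is bounded, the error is
    supported in a fixed cube, and the rate [s' = s] of the exponent [p], or of the
    sup norm, transfers to [p']. *)
Lemma integral_bias : exists2 C : R, 0 <= C &
  forall (f : Rd -> R) th v, measurable_fun [set: Rd] f ->
    (forall x, f x != 0 -> A x) -> wavelet_expansion M Psi f th v ->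
    (besov_norm M s p q th v <= K%:E)%E -> forall j : nat,
  (\int[leb d.+1]_x (`|f x - level_proj f j x| `^ p')%:E <=
    (C * b `^ (- (j%:R * (p' * s_prime s p' p))))%:E)%E.
Proof.
have ae_eq (f : Rd -> R) th v j : measurable_fun [set: Rd] f ->
    wavelet_expansion M Psi f th v -> (besov_norm M s p q th v <= K%:E)%E ->
    {ae leb d.+1, forall x, besov_partial_sum M Psi th v x j = level_proj f j x}.
  move=> mf fE hK; apply: (projection_partial_sum dM fr) fE _ => //.
  by move=> i x; exact: (partial_sum_le dM fr p1 q1 sp hK).
have mW := measurable_partial_sum dM fr.
have mG (f : Rd -> R) th v j r : measurable_fun [set: Rd] f ->
    measurable_fun [set: Rd] (fun x => (`|f x - besov_partial_sum M Psi th v x j| `^ r)%:E).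
  by move=> mf; apply: measurable_norm_powR; apply: measurable_funB.
have [p'p|pp'] := boolP (p'%:E < p)%E; last first.
  rewrite -leNgt in pp'.
  have [p0 pE] : exists p0, p = p0%:E.
    by case: p p1 pp' => [r|//|//] _ _; exists r.
  rewrite pE lee_fin in pp'.
  have p1' : (1 <= p0%:E)%E by rewrite -pE.
  have p00 : 0 < p0 by rewrite lee_fin in p1'; exact: lt_le_trans p1'.
  have sp' : p0^-1 < s by move: sp; rewrite pE.
  have sE : s_prime s p' p = s + p'^-1 - p0^-1.
    rewrite /s_prime pE /= min_l ?addrA//.
    by rewrite subr_le0 lef_pV2// posrE.
  exists `|tail_const M L B s p0 K p'| => // f th v mf _ fE hK j.
  rewrite sE.
  apply: (@le_trans _ _ (\int[leb d.+1]_x (`|f x - besov_partial_sum M Psi th v x j| `^ p')%:E)%E).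
    apply: ae_le_integral_ge0 => //; first exact: mG.
    by apply: filterS (ae_eq _ _ _ j mf fE hK) => x ->.
  have hK' : (besov_norm M s p0%:E q th v <= K%:E)%E by rewrite -pE.
  apply: (le_trans (integral_tail_powR dM fr p1' q1 sp' hK' j pp' fE)).
  by rewrite lee_fin ler_wpM2r ?powR_ge0// ler_norm.
have [c c0 hc] := level_proj_support (bA p'p).
have cc : - c <= c by rewrite ge0_cp.
pose E := [set x : Rd | forall i, - c <= x i 0 <= c].
have mE : measurable E by exact: measurable_cube.
have lE : leb d.+1 E = ((c - - c) ^+ d.+1)%:E by exact: leb_cube.
set vol := (c - - c) ^+ d.+1 in lE.
have vol0 : 0 <= vol by rewrite exprn_ge0// subr_ge0.
have pos_E f j x : (forall x, f x != 0 -> A x) -> f x - level_proj f j x != 0 -> x \in E.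
  by move=> fA fx; rewrite inE => i; rewrite -ler_norml; exact: hc fx i.
have sE : s_prime s p' p = s.
  rewrite /s_prime min_r ?addr0// subr_ge0.
  case: p p'p p1 => [r| |] //=; last by rewrite invr_ge0 (ltW p'0).
  by rewrite lte_fin => pr _; rewrite lef_pV2 ?posrE ?(ltW pr)// (lt_trans p'0).
rewrite sE; case: p p'p p1 sp ae_eq => [p0| |] // p'p p1' sp' ae_eq.
  have p00 : 0 < p0 by rewrite lee_fin in p1'; exact: lt_le_trans p1'.
  exists (vol + `|tail_const M L B s p0 K p0|); first by rewrite addr_ge0.
  move=> f th v mf fA fE hK j.
  rewrite lte_fin in p'p.
  (* [t] is the order of the error in the exponent [p0], so both terms of the split are of
     order [t ^ p']. *)
  set t := b `^ (- (j%:R * s)).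
  have t0 : 0 < t by rewrite powR_gt0.
  pose H x := ((t `^ p')%:E * (\1_E x)%:E + (t `^ (p' - p0))%:E *
    (`|f x - besov_partial_sum M Psi th v x j| `^ p0)%:E)%E.
  have H1 x : (0 <= (t `^ p')%:E * (\1_E x)%:E)%E by rewrite mule_ge0 ?lee_fin ?powR_ge0.
  have H2 x : (0 <= (t `^ (p' - p0))%:E * (`|f x - besov_partial_sum M Psi th v x j| `^ p0)%:E)%E.
    by rewrite mule_ge0 ?lee_fin ?powR_ge0.
  have mH1 : measurable_fun [set: Rd] (fun x => (t `^ p')%:E * (\1_E x)%:E)%E.
    apply: emeasurable_funM; first exact: measurable_cst.
    by apply/measurable_EFinP; exact: measurable_indic.
  have mH2 : measurable_fun [set: Rd] (fun x => (t `^ (p' - p0))%:E *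
      (`|f x - besov_partial_sum M Psi th v x j| `^ p0)%:E)%E.
    by apply: emeasurable_funM; [exact: measurable_cst|exact: mG].
  apply: (@le_trans _ _ (\int[leb d.+1]_x H x)%E).
    apply: ae_le_integral_ge0 => //.
    - by move=> x; rewrite adde_ge0.
    - exact: emeasurable_funD.
    apply: filterS (ae_eq _ _ _ j mf fE hK) => x Wx; rewrite /H Wx.
    have [->|fx] := eqVneq (f x - level_proj f j x) 0.
      by rewrite normr0 powR0 ?gt_eqF// -!EFinM -EFinD lee_fin addr_ge0// mulr_ge0 ?powR_ge0.
    rewrite indicE (pos_E _ _ _ fA fx) mule1 -EFinM -EFinD lee_fin.
    by apply: powR_split_le => //; exact: ltW.
  rewrite ge0_integralD// ge0_integralZl ?lee_fin ?powR_ge0//; last first.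
    by apply/measurable_EFinP; exact: measurable_indic.
  rewrite integral_indic// setIT [X in (_ * X)%E]lE.
  rewrite ge0_integralZl ?lee_fin ?powR_ge0//; last exact: mG.
  have e0 : (0 <= (t `^ (p' - p0))%:E)%E by rewrite lee_fin powR_ge0.
  have := integral_tail_powR dM fr p1' q1 sp' hK j (lexx p0) fE.
  move/(lee_wpmul2l e0)/(leeD2l (t `^ p' * vol)%:E)/le_trans; apply.
  rewrite -EFinM -EFinD lee_fin mulrDl.
  have tp : t `^ p' = b `^ (- (j%:R * (p' * s))).
    by rewrite /t -powRrM; congr (_ `^ _); ring.
  rewrite tp [vol * _]mulrC lerD// mulrCA.
  have -> : t `^ (p' - p0) * b `^ (- (j%:R * (p0 * (s + p0^-1 - p0^-1)))) = b `^ (- (j%:R * (p' * s))).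
    by rewrite /t -powRrM -powR_add// addrK; congr (_ `^ _); ring.
  by rewrite ler_wpM2r ?powR_ge0// ler_norm.
set cs := sup_const M L B K / (1 - sup_rate M s +oo%E).
exists (`|cs| `^ p' * vol); first by rewrite mulr_ge0 ?powR_ge0.
move=> f th v mf fA fE hK j.
pose H x := ((`|cs| `^ p' * b `^ (- (j%:R * (p' * s))))%:E * (\1_E x)%:E)%E.
have k0 : 0 <= `|cs| `^ p' * b `^ (- (j%:R * (p' * s))) by rewrite mulr_ge0 ?powR_ge0.
apply: (@le_trans _ _ (\int[leb d.+1]_x H x)%E).
  apply: ae_le_integral_ge0 => //.
  - by move=> x; rewrite mule_ge0// lee_fin.
  - apply: emeasurable_funM; first exact: measurable_cst.
    by apply/measurable_EFinP; exact: measurable_indic.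
  apply: filterS2 fE (ae_eq _ _ _ j mf fE hK) => x fx Wx; rewrite /H -EFinM lee_fin.
  have [->|fx0] := eqVneq (f x - level_proj f j x) 0.
    by rewrite normr0 powR0 ?gt_eqF// mulr_ge0.
  rewrite indicE (pos_E _ _ _ fA fx0) mulr1.
  have -> : b `^ (- (j%:R * (p' * s))) = (sup_rate M s +oo%E ^+ j) `^ p'.
    by rewrite /sup_rate /= -powR_exprn -powRrM; congr (_ `^ _); ring.
  rewrite -powRM// ?exprn_ge0 ?powR_ge0// ge0_ler_powR ?nnegrE ?(ltW p'0)//.
    by rewrite mulr_ge0// exprn_ge0// powR_ge0.
  rewrite -Wx (le_trans (tail_sup dM fr p1' q1 sp' hK j fx))//.
  by rewrite ler_wpM2r ?exprn_ge0 ?powR_ge0// ler_norm.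
rewrite ge0_integralZl ?lee_fin//; last first.
  by apply/measurable_EFinP; exact: measurable_indic.
rewrite integral_indic// setIT [X in (_ * X)%E]lE -EFinM lee_fin.
by rewrite mulrAC.
Qed.

End bias.

(** * Bounded random variables and the covariance inequality *)

Section bounded_rv.
Context {R : realType} {dT} {T : measurableType dT} (P : probability T R).

(** Bounded measurable variables form an algebra on which the expectation is linear
    without integrability side conditions; all the variables of the moment bounds
    belong to it. *)
Definition bmf (X : T -> R) := measurable_fun [set: T] X /\
  exists c : R, forall w, `|X w| <= c.

Definition expect (X : T -> R) : R := \int[P]_w X w.

Notation "''E' X" := (expect X) (at level 10, X at level 9).

Lemma eq_expect X Y : (forall w, X w = Y w) -> 'E X = 'E Y.
Proof. by move=> /funext ->. Qed.

Lemma bmf_integrable X : bmf X -> P.-integrable setT (EFin \o X).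
Proof.
move=> [mX [c Xc]]; apply: measurable_bounded_integrable => //.
  by apply: (le_lt_trans (probability_le1 _ measurableT)); rewrite ltry.
by exists c; split => [|y cy x _]; [exact: num_real|exact: le_trans (Xc x) (ltW cy)].
Qed.

Lemma bmf_cst c : bmf (cst c).
Proof. by split; [exact: measurable_cst|exists `|c|]. Qed.

Lemma bmfD X Y : bmf X -> bmf Y -> bmf (fun w => X w + Y w).
Proof.
move=> [mX [c Xc]] [mY [e Ye]]; split; first exact: measurable_funD.
by exists (c + e) => w; rewrite (le_trans (ler_normD _ _))// lerD.
Qed.

Lemma bmfM X Y : bmf X -> bmf Y -> bmf (fun w => X w * Y w).
Proof.
move=> [mX [c Xc]] [mY [e Ye]]; split; first exact: measurable_funM.
by exists (c * e) => w; rewrite normrM ler_pM.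
Qed.

Lemma bmfZ c X : bmf X -> bmf (fun w => c * X w).
Proof. by move=> bX; exact: (bmfM (bmf_cst c)). Qed.

Lemma bmfN X : bmf X -> bmf (fun w => - X w).
Proof.
by move=> bX; under eq_fun do rewrite -mulN1r; exact: bmfZ.
Qed.

Lemma bmfB X Y : bmf X -> bmf Y -> bmf (fun w => X w - Y w).
Proof. by move=> bX bY; apply: bmfD => //; exact: bmfN. Qed.

Lemma bmf_abs X : bmf X -> bmf (fun w => `|X w|).
Proof.
move=> [mX [c Xc]]; split; first exact: (measurableT_comp _ mX).
by exists c => w; rewrite normr_id.
Qed.

Lemma bmfX X n : bmf X -> bmf (fun w => X w ^+ n).
Proof.
move=> bX; elim: n => [|n IH]; first by under eq_fun do rewrite expr0; exact: bmf_cst.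
by under eq_fun do rewrite exprS; exact: bmfM.
Qed.

Lemma bmf_sum (I : Type) (s : seq I) (p : pred I) (F : I -> T -> R) :
  (forall i, bmf (F i)) -> bmf (fun w => \sum_(i <- s | p i) F i w).
Proof.
move=> bF; elim: s => [|i s IH].
  by under eq_fun do rewrite big_nil; exact: bmf_cst.
under eq_fun do rewrite big_cons; case: (p i) => //.
exact: bmfD.
Qed.

Lemma bmf_prod (I : Type) (s : seq I) (p : pred I) (F : I -> T -> R) :
  (forall i, bmf (F i)) -> bmf (fun w => \prod_(i <- s | p i) F i w).
Proof.
move=> bF; elim: s => [|i s IH].
  by under eq_fun do rewrite big_nil; exact: bmf_cst.
under eq_fun do rewrite big_cons; case: (p i) => //.
exact: bmfM.
Qed.

Lemma bmf_indic A : measurable A -> bmf (\1_A).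
Proof.
move=> mA; split; first exact: measurable_indic.
by exists 1 => w; rewrite indicE; case: (w \in A); rewrite ?normr0 ?normr1.
Qed.

Lemma ED X Y : bmf X -> bmf Y -> 'E (fun w => X w + Y w) = 'E X + 'E Y.
Proof. by move=> bX bY; rewrite /expect RintegralD//; exact: bmf_integrable. Qed.

Lemma EB X Y : bmf X -> bmf Y -> 'E (fun w => X w - Y w) = 'E X - 'E Y.
Proof. by move=> bX bY; rewrite /expect RintegralB//; exact: bmf_integrable. Qed.

Lemma EZ c X : bmf X -> 'E (fun w => c * X w) = c * 'E X.
Proof. by move=> bX; rewrite /expect RintegralZl//; exact: bmf_integrable. Qed.

Lemma E_cst c : 'E (fun=> c) = c.
Proof. by rewrite /expect Rintegral_cst//= [X in fine X](@probability_setT _ _ _ P) mulr1. Qed.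

Lemma E_sum (I : Type) (s : seq I) (p : pred I) (F : I -> T -> R) :
  (forall i, bmf (F i)) ->
  'E (fun w => \sum_(i <- s | p i) F i w) = \sum_(i <- s | p i) 'E (F i).
Proof.
move=> bF; elim: s => [|i s IH].
  rewrite (@eq_expect _ (fun=> 0)) ?E_cst ?big_nil// => w.
  by rewrite big_nil.
rewrite big_cons -IH; case: ifPn => pi.
  rewrite -(ED (bF i) (bmf_sum _ _ bF)); apply: eq_expect => w.
  by rewrite big_cons pi.
by apply: eq_expect => w; rewrite big_cons (negbTE pi).
Qed.

Lemma E_ge0 X : (forall w, 0 <= X w) -> 0 <= 'E X.
Proof. by move=> X0; apply: Rintegral_ge0. Qed.

Lemma E_le X Y : bmf X -> bmf Y -> (forall w, X w <= Y w) -> 'E X <= 'E Y.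
Proof.
by move=> bX bY XY; apply: le_Rintegral => //; exact: bmf_integrable.
Qed.

Lemma E_norm X : bmf X -> `|'E X| <= 'E (fun w => `|X w|).
Proof. by move=> bX; apply: le_normr_Rintegral => //; exact: bmf_integrable. Qed.

Lemma E_norm_le X c : bmf X -> (forall w, `|X w| <= c) -> `|'E X| <= c.
Proof.
move=> bX Xc; rewrite (le_trans (E_norm bX))// -[leRHS]E_cst.
by apply: E_le => //; [exact: bmf_abs|exact: bmf_cst].
Qed.

(** The variance of [`|X|] is nonnegative. *)
Lemma E_sqr_norm X : bmf X -> ('E (fun w => `|X w|)) ^+ 2 <= 'E (fun w => X w ^+ 2).
Proof.
move=> bX; set m := 'E _; rewrite -subr_ge0.
have -> : 'E (fun w => X w ^+ 2) - m ^+ 2 = 'E (fun w => (`|X w| - m) ^+ 2).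
  transitivity ('E (fun w => X w ^+ 2 - (2 * m) * `|X w| + m ^+ 2)).
    have bA := bmf_abs bX; have bA2 := bmfZ (2 * m) bA; have b2 := bmfX 2 bX.
    rewrite (ED (bmfB b2 bA2) (bmf_cst (m ^+ 2))) (EB b2 bA2) (EZ _ bA) E_cst -/m.
    ring.
  apply: eq_expect => w; rewrite sqrrB real_normK ?num_real// -mulr_natl.
  by ring.
by apply: E_ge0 => w; exact: sqr_ge0.
Qed.

Lemma E_norm_sqrt X : bmf X -> 'E (fun w => `|X w|) <= Num.sqrt ('E (fun w => X w ^+ 2)).
Proof.
move=> bX; have m0 : 0 <= 'E (fun w => `|X w|) by apply: E_ge0.
by rewrite -[leLHS](ger0_norm m0) -sqrtr_sqr ler_wsqrtr// E_sqr_norm.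
Qed.

Lemma E_indic A : measurable A -> 'E (\1_A) = fine (P A).
Proof. by move=> mA; rewrite /expect /Rintegral integral_indic// setIT. Qed.

Section covariance.
Variables (G H : set (set T)) (al : R).
Hypothesis mixing : forall A C, G A -> H C ->
  `|fine (P (A `&` C)) - fine (P A) * fine (P C)| <= al.

Definition level_in (K : set (set T)) (X : T -> R) :=
  forall u : R, K [set w | u <= X w].

(** A variable with values in [0, 1] is, up to [1 / n.+1], the average of the
    indicators of its upper level sets. Mixing, which concerns events, passes in this
    way to variables, and averaging loses no constant. *)
Definition staircase (n : nat) (X : T -> R) (w : T) : R :=
  n.+1%:R^-1 * \sum_(i < n.+1) \1_[set w | i.+1%:R / n.+1%:R <= X w] w.

Lemma staircase_approx n X w : 0 <= X w <= 1 ->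
  X w - n.+1%:R^-1 <= staircase n X w <= X w.
Proof.
move=> /andP[X0 X1]; have n0 : 0 < n.+1%:R :> R by rewrite ltr0n.
pose k := Num.truncn (n.+1%:R * X w).
have nX0 : 0 <= n.+1%:R * X w by rewrite mulr_ge0 ?ler0n.
have /andP[k1 k2] := truncn_itv nX0; rewrite -/k in k1 k2.
have kn : (k <= n.+1)%N.
  rewrite -(ler_nat R) (le_trans k1)// -[leRHS]mulr1 ler_wpM2l// ler0n.
have -> : staircase n X w = n.+1%:R^-1 * k%:R.
  rewrite /staircase; congr (_ * _).
  rewrite (eq_bigr (fun i : 'I_n.+1 => ((i < k)%N)%:R)); last first.
    move=> i _; rewrite indicE; congr (nat_of_bool _)%:R; apply/idP/idP.
      rewrite inE /= ler_pdivrMr// mulrC => h.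
      rewrite ltnNge; apply/negP => ki.
      have : k.+1%:R <= i.+1%:R :> R by rewrite ler_nat ltnS.
      by move/le_trans => /(_ _ h); rewrite leNgt k2.
    move=> ik; rewrite inE /= ler_pdivrMr// mulrC (le_trans _ k1)//.
    by rewrite ler_nat.
  rewrite -natr_sum -(big_mkord xpredT (fun i => ((i < k)%N : nat))).
  rewrite (big_cat_nat (n := k))//= [X in (_ + X)%N](_ : _ = 0%N) ?addn0; last first.
    by rewrite big_nat_cond big1// => i /andP[/andP[ki _] _]; rewrite ltnNge ki.
  rewrite (eq_big_nat _ _ (F2 := fun=> 1%N)); last by move=> i /andP[_ ->].
  by rewrite sum_nat_const_nat subn0 muln1.
have -> : n.+1%:R^-1 * k%:R = k.+1%:R / n.+1%:R - n.+1%:R^-1 :> R by rewrite -(addn1 k) natrD; ring.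
rewrite lerBlDr subrK ler_pdivlMr// [X w * _]mulrC (ltW k2)/=.
by rewrite -(addn1 k) natrD mulrDl mul1r addrK ler_pdivrMr// [X w * _]mulrC.
Qed.

Lemma measurable_upper_level (X : T -> R) (u : R) : measurable_fun setT X ->
  measurable [set w | u <= X w].
Proof.
move=> mX; have := mX measurableT _ (@measurable_itv _ `[u, +oo[).
rewrite setTI (_ : _ @^-1` _ = [set w | u <= X w])//.
by apply/seteqP; split => w /=; rewrite in_itv/= andbT.
Qed.

Lemma bmf_staircase n X : measurable_fun setT X -> bmf (staircase n X).
Proof.
move=> mX; apply: bmfZ; apply: bmf_sum => i; apply: bmf_indic.
exact: measurable_upper_level.
Qed.

Lemma staircase_cov n X Y : measurable_fun setT X -> measurable_fun setT Y ->
  level_in G X -> level_in H Y ->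
  `|'E (fun w => staircase n X w * staircase n Y w) -
    'E (staircase n X) * 'E (staircase n Y)| <= al.
Proof.
move=> mX mY lX lY.
pose a (i : 'I_n.+1) := [set w | i.+1%:R / n.+1%:R <= X w].
pose b (i : 'I_n.+1) := [set w | i.+1%:R / n.+1%:R <= Y w].
have ma i : measurable (a i).
  exact: measurable_upper_level.
have mb i : measurable (b i).
  exact: measurable_upper_level.
have ba i := bmf_indic (ma i); have bb i := bmf_indic (mb i).
set m := n.+1%:R : R; have m0 : 0 < m by rewrite ltr0n.
have EX : 'E (staircase n X) = m^-1 * \sum_i fine (P (a i)).
  rewrite (EZ _ (bmf_sum _ _ ba)) E_sum//; congr (_ * _).
  by apply: eq_bigr => i _; rewrite E_indic.
have EY : 'E (staircase n Y) = m^-1 * \sum_i fine (P (b i)).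
  rewrite (EZ _ (bmf_sum _ _ bb)) E_sum//; congr (_ * _).
  by apply: eq_bigr => i _; rewrite E_indic.
have EXY : 'E (fun w => staircase n X w * staircase n Y w) =
    m^-1 * (m^-1 * \sum_i \sum_k fine (P (a i `&` b k))).
  rewrite (@eq_expect _ (fun w => m^-1 * (m^-1 *
     \sum_(i < n.+1) \sum_(k < n.+1) \1_(a i `&` b k) w))); last first.
    move=> w; rewrite [RHS]mulrA /staircase mulrACA -/m; congr (_ * _).
    rewrite mulr_suml; apply: eq_bigr => i _; rewrite mulr_sumr.
    by apply: eq_bigr => k _; rewrite indicI.
  have bI i k := bmf_indic (measurableI _ _ (ma i) (mb k)).
  have bS i := bmf_sum (index_enum 'I_n.+1) xpredT (bI i).
  rewrite EZ; last by apply: bmfZ; apply: bmf_sum => i; exact: bS.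
  rewrite EZ; last by apply: bmf_sum => i; exact: bS.
  rewrite E_sum; last by move=> i; exact: bS.
  congr (_ * (_ * _)); apply: eq_bigr => i _; rewrite E_sum; last exact: bI.
  by apply: eq_bigr => k _; rewrite E_indic//; exact: measurableI.
have -> : 'E (fun w => staircase n X w * staircase n Y w) -
    'E (staircase n X) * 'E (staircase n Y) =
    m^-1 * (m^-1 * \sum_i \sum_k (fine (P (a i `&` b k)) -
       fine (P (a i)) * fine (P (b k)))).
  rewrite EXY EX EY mulrACA -mulrA -!mulrBr; congr (_ * (_ * _)).
  rewrite mulr_suml -sumrB; apply: eq_bigr => i _.
  by rewrite mulr_sumr -sumrB.
rewrite mulrA normrM gtr0_norm ?mulr_gt0 ?invr_gt0// -invfM mulrC ler_pdivrMr ?mulr_gt0//.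
rewrite (le_trans (ler_norm_sum _ _ _))//.
have -> : al * (m * m) = \sum_(i < n.+1) \sum_(k < n.+1) al.
  by rewrite !sumr_const card_ord -mulrnA -natrM mulr_natr.
apply: ler_sum => i _; rewrite (le_trans (ler_norm_sum _ _ _))//.
by apply: ler_sum => k _; apply: mixing; [exact: lX|exact: lY].
Qed.

Lemma covariance01 X Y : measurable_fun setT X -> measurable_fun setT Y ->
  level_in G X -> level_in H Y ->
  (forall w, 0 <= X w <= 1) -> (forall w, 0 <= Y w <= 1) ->
  `|'E (fun w => X w * Y w) - 'E X * 'E Y| <= al.
Proof.
move=> mX mY lX lY X01 Y01.
have b01 (W : T -> R) : measurable_fun setT W -> (forall w, 0 <= W w <= 1) -> bmf W.
  move=> mW W01; split => //; exists 1 => w; have /andP[w0 w1] := W01 w.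
  by rewrite ger0_norm.
have bX := b01 X mX X01; have bY := b01 Y mY Y01.
apply/ler_addgt0Pr => e e0.
pose n := Num.truncn (4 / e); pose m := n.+1%:R : R.
have m0 : 0 < m by rewrite ltr0n.
have me : m^-1 * 4 <= e.
  rewrite mulrC ler_pdivrMr// mulrC -ler_pdivrMr//.
  by rewrite ltW// /m truncnS_gt.
have bXn := bmf_staircase n mX; have bYn := bmf_staircase n mY.
have ap (W : T -> R) w : (0 <= W w <= 1) ->
    `|W w - staircase n W w| <= m^-1 /\ `|staircase n W w| <= 1.
  move=> W01; have /andP[s1 s2] := staircase_approx n W01.
  have s0 : 0 <= staircase n W w.
    by rewrite mulr_ge0 ?invr_ge0 ?ler0n ?sumr_ge0// => i _; rewrite indicE ler0n.
  case/andP: W01 => W0 W1.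
  rewrite !ger0_norm ?subr_ge0//; split; last exact: le_trans s2 W1.
  by rewrite lerBlDr -lerBlDl.
have d1 : `|'E (fun w => X w * Y w) -
    'E (fun w => staircase n X w * staircase n Y w)| <= m^-1 * 2.
  rewrite -EB; [|exact: bmfM|exact: bmfM].
  apply: E_norm_le; first by apply: bmfB; exact: bmfM.
  move=> w; have [x1 x2] := ap X w (X01 w); have [y1 y2] := ap Y w (Y01 w).
  have -> : X w * Y w - staircase n X w * staircase n Y w =
    (X w - staircase n X w) * Y w + staircase n X w * (Y w - staircase n Y w) by ring.
  rewrite (le_trans (ler_normD _ _))// normrM [X in _ + X <= _]normrM mulr_natr mulr2n lerD//.
    rewrite -[leRHS]mulr1 ler_pM//; have /andP[w0 w1] := Y01 w; by rewrite ger0_norm.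
  by rewrite -[leRHS]mul1r ler_pM.
have EW (W : T -> R) : measurable_fun setT W -> (forall w, 0 <= W w <= 1) ->
    [/\ `|'E W| <= 1, `|'E W - 'E (staircase n W)| <= m^-1 &
        `|'E (staircase n W)| <= 1].
  move=> mW W01; have bW := b01 W mW W01; have bS := bmf_staircase n mW; split.
  - apply: E_norm_le => // w; have /andP[w0 w1] := W01 w; by rewrite ger0_norm.
  - rewrite -EB//; apply: E_norm_le; first exact: bmfB.
    by move=> w; case: (ap W w (W01 w)).
  - by apply: E_norm_le => // w; case: (ap W w (W01 w)).
have d2 : `|'E (staircase n X) * 'E (staircase n Y) - 'E X * 'E Y| <= m^-1 * 2.
  have [x1 x2 x3] := EW X mX X01; have [y1 y2 y3] := EW Y mY Y01.
  rewrite distrC.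
  have -> : 'E X * 'E Y - 'E (staircase n X) * 'E (staircase n Y) =
    ('E X - 'E (staircase n X)) * 'E Y +
      'E (staircase n X) * ('E Y - 'E (staircase n Y)) by ring.
  rewrite (le_trans (ler_normD _ _))// normrM [X in _ + X <= _]normrM mulr_natr mulr2n lerD//.
    by rewrite -[leRHS]mulr1 ler_pM.
  by rewrite -[leRHS]mul1r ler_pM.
have d3 := staircase_cov n mX mY lX lY.
move: d1 d2 d3; generalize ('E (fun w => X w * Y w))
  ('E (fun w => staircase n X w * staircase n Y w))
  ('E (staircase n X) * 'E (staircase n Y)) ('E X * 'E Y) => a1 a2 a4 a3 d1 d2 d3.
have -> : a1 - a3 = (a1 - a2) + ((a2 - a4) + (a4 - a3)) by ring.
rewrite (le_trans (ler_normD _ _))// (le_trans (lerD (lexx _) (ler_normD _ _)))//.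
rewrite (le_trans (lerD d1 (lerD d3 d2)))//.
have -> : m^-1 * 2 + (al + m^-1 * 2) = al + m^-1 * 4 by ring.
by rewrite lerD2l.
Qed.

(** Variables bounded by [b1] and [b2] are rescaled affinely to [0, 1]; the factor
    [4] is the product of the lengths [2 * b1] and [2 * b2] of the two ranges. *)
Lemma mixing_covariance_le X Y b1 b2 : measurable_fun setT X -> measurable_fun setT Y ->
  level_in G X -> level_in H Y -> 0 < b1 -> 0 < b2 ->
  (forall w, `|X w| <= b1) -> (forall w, `|Y w| <= b2) ->
  `|'E (fun w => X w * Y w) - 'E X * 'E Y| <= 4 * al * b1 * b2.
Proof.
move=> mX mY lX lY b10 b20 Xb Yb.
pose sc b (W : T -> R) w := (2 * b)^-1 * (W w + b).
have bW (W : T -> R) b : measurable_fun setT W -> (forall w, `|W w| <= b) -> bmf W.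
  by move=> mW Wb; split => //; exists b.
have bX := bW X b1 mX Xb; have bY := bW Y b2 mY Yb.
have scE b (W : T -> R) : bmf W -> 'E (sc b W) = (2 * b)^-1 * ('E W + b).
  by move=> hW; rewrite EZ; [rewrite (ED hW (bmf_cst b)) E_cst|apply: bmfD => //; exact: bmf_cst].
have sc01 (b : R) (W : T -> R) : 0 < b -> (forall w, `|W w| <= b) -> forall w, 0 <= sc b W w <= 1.
  move=> b0 Wb w; have := Wb w; rewrite ler_norml => /andP[w1 w2].
  rewrite /sc mulrC divr_ge0 ?ler_pdivrMr ?mulr_gt0//=; lra.
have scm b (W : T -> R) : bmf W -> bmf (sc b W).
  by move=> hW; apply: bmfZ; apply: bmfD => //; exact: bmf_cst.
have scl (K : set (set T)) (b : R) (W : T -> R) : 0 < b -> level_in K W -> level_in K (sc b W).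
  move=> b0 lW u; rewrite [X in K X](_ : _ = [set w | u * (2 * b) - b <= W w])//.
  apply/funext => w; rewrite /mkset /sc [_^-1 * _]mulrC.
  by rewrite ler_pdivlMr ?mulr_gt0// lerBlDr.
have := covariance01 (scm b1 X bX).1 (scm b2 Y bY).1 (scl _ _ _ b10 lX) (scl _ _ _ b20 lY)
   (sc01 _ _ b10 Xb) (sc01 _ _ b20 Yb).
have -> : 'E (fun w => sc b1 X w * sc b2 Y w) - 'E (sc b1 X) * 'E (sc b2 Y) =
    ((2 * b1)^-1 * (2 * b2)^-1) * ('E (fun w => X w * Y w) - 'E X * 'E Y).
  rewrite (@eq_expect _ (fun w => ((2 * b1)^-1 * (2 * b2)^-1) *
     (X w * Y w + (b2 * X w + b1 * (Y w + b2))))); last by move=> w; rewrite /sc; ring.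
  have bY2 : bmf (fun w => Y w + b2) := bmfD bY (bmf_cst b2).
  have EY2 : 'E (fun w => Y w + b2) = 'E Y + b2.
    by rewrite (ED bY (bmf_cst b2)) E_cst.
  rewrite EZ; last by apply: bmfD; [exact: bmfM|apply: bmfD; exact: bmfZ].
  rewrite (ED (bmfM bX bY) (bmfD (bmfZ b2 bX) (bmfZ b1 bY2))).
  rewrite (ED (bmfZ b2 bX) (bmfZ b1 bY2)) (EZ b2 bX) (EZ b1 bY2) EY2 !scE//.
  by ring.
rewrite normrM ger0_norm; last by rewrite mulr_ge0// invr_ge0 mulr_ge0// ltW.
rewrite -invfM mulrC ler_pdivrMr ?mulr_gt0// => /le_trans; apply.
by rewrite le_eqVlt; apply/orP; left; apply/eqP; ring.
Qed.

End covariance.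

End bounded_rv.

(** * Densities and mixing of the field *)

Section density.
Context {R : realType} {dT dU} {T : measurableType dT} {U : measurableType dU}.
Variables (P : probability T R) (X : T -> U) (mX : measurable_fun setT X).
Variables (nu : {measure set U -> \bar R}) (f : U -> R).
Hypothesis Xf : has_density P X nu f.
Local Open Scope ereal_scope.
Import HBNNSimple.

(** Holds by definition of the density for indicators, hence for simple functions,
    hence in general by monotone convergence. *)
Lemma density_integral (u : U -> \bar R) : measurable_fun setT u ->
  (forall x, 0 <= u x) ->
  \int[P]_w u (X w) = \int[nu]_x (u x * (f x)%:E).
Proof.
move=> mu u0; have [mf f0 Pf] := Xf.
have mfE : measurable_fun setT (EFin \o f) by exact/measurable_EFinP.
pose h := nnsfun_approx measurableT mu.
have hcvg x : EFin \o h^~ x @ \oo --> u x by apply: cvg_nnsfun_approx.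
have -> : \int[P]_w u (X w) = limn (fun n => \int[P]_w (h n (X w))%:E).
  rewrite -monotone_convergence//.
  - by apply: eq_integral => w _; apply/esym/cvg_lim => //; exact: hcvg.
  - by move=> n; apply/measurable_EFinP; apply: measurableT_comp.
  - by move=> n w _; rewrite lee_fin.
  - by move=> w _ m n mn; rewrite lee_fin; exact/lefP/nd_nnsfun_approx.
have -> : \int[nu]_x (u x * (f x)%:E) =
    limn (fun n => \int[nu]_x ((h n x)%:E * (f x)%:E)).
  rewrite -monotone_convergence//.
  - apply: eq_integral => x _; apply/esym/cvg_lim => //.
    by apply: cvgeZr => //; exact: hcvg.
  - by move=> n; apply: emeasurable_funM => //; exact/measurable_EFinP.
  - by move=> n x _; rewrite mule_ge0 ?lee_fin.
  - by move=> x _ m n mn; rewrite lee_wpmul2r ?lee_fin//; exact/lefP/nd_nnsfun_approx.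
congr (limn _); apply/funext => n.
have mh r : measurable (h n @^-1` [set r]) by [].
have mXh r : measurable (X @^-1` (h n @^-1` [set r])).
  by rewrite -[X in measurable X]setTI; exact: mX.
transitivity (\sum_(r \in range (h n))
    \int[P]_w (r * \1_(h n @^-1` [set r]) (X w))%:E).
  under eq_integral do rewrite fimfunE -fsumEFin//.
  rewrite ge0_integral_fsum//.
  - move=> r; apply/measurable_EFinP; apply: measurable_funM => //.
    by apply: measurableT_comp => //; exact: measurable_indic.
  - by move=> r w _; rewrite nnfun_muleindic_ge0.
transitivity (\sum_(r \in range (h n))
    \int[nu]_x ((r * \1_(h n @^-1` [set r]) x)%:E * (f x)%:E)); last first.
  rewrite -ge0_integral_fsum//; last 2 first.
  - by move=> r; apply: emeasurable_funM => //; exact/measurable_EFinP/measurable_funM.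
  - by move=> r x _; apply: mule_ge0; [exact: nnfun_muleindic_ge0|rewrite lee_fin].
  apply: eq_integral => x _; rewrite -ge0_mule_fsuml => [|y]; last exact: nnfun_muleindic_ge0.
  by rewrite fsumEFin// -(fimfunE _ x).
apply: eq_fsbigr => r /[!inE] -[x0 _ hr].
have r0 : (0 <= r)%R by rewrite -hr.
under [LHS]eq_integral do rewrite EFinM.
under [RHS]eq_integral do rewrite EFinM -muleA.
rewrite ge0_integralZl ?lee_fin//; last first.
- by apply/measurable_EFinP; apply: measurableT_comp => //; exact: measurable_indic.
rewrite ge0_integralZl ?lee_fin//; last 2 first.
- by apply: emeasurable_funM => //; exact/measurable_EFinP/measurable_indic.
- by move=> x _; rewrite mule_ge0 ?lee_fin.
congr (_ * _).
under [RHS]eq_integral do rewrite muleC.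
transitivity (\int[nu]_x ((EFin \o f) \_ (h n @^-1` [set r])) x); last first.
  by apply: eq_integral => x _; rewrite epatch_indic.
rewrite -integral_mkcondr setTI -(Pf _ (mh r)).
transitivity (\int[P]_w (\1_(X @^-1` (h n @^-1` [set r])) w)%:E) => //.
by rewrite integral_indic// setIT.
Qed.

End density.

Section field.
Context {R : realType} {d N : nat} {dT} {T : measurableType dT}
  (P : probability T R) (Z : 'cV[int]_N -> {RV P >-> 'cV[R]_d.+1}).
Local Notation S := ('cV[int]_N).

(** Generators of the sigma-algebra of the sites in [I]. Measurability with respect
    to it is expressed on a copy of the sample space that carries the generated
    sigma-algebra, so that all closure properties of measurable functions apply. *)
Definition field_gen (I : set S) : set (set T) :=
  \bigcup_(s in I) preimage_set_system setT (Z s) measurable.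

Definition field_meas (I : set S) (X : T -> R) : Prop :=
  @measurable_fun _ _ (g_sigma_algebraType (field_gen I)) R setT X.

Lemma field_sigma_measurable I A : field_sigma Z I A -> measurable A.
Proof.
move=> h; apply: h; split; first exact: sigma_algebra_measurable.
move=> _ [s _ [B mB <-]]; apply: measurable_funPT => //.
Qed.

Lemma field_meas_measurable I X : field_meas I X -> measurable_fun setT X.
Proof.
move=> mX _ B mB; apply: (@field_sigma_measurable I).
exact: (mX measurableT B mB).
Qed.

Lemma field_meas_level I X : field_meas I X -> level_in (field_sigma Z I) X.
Proof.
move=> mX u; have := mX measurableT _ (@measurable_itv _ `[u, +oo[).
rewrite setTI (_ : _ @^-1` _ = [set w | u <= X w])//.
by apply/seteqP; split => w /=; rewrite in_itv/= andbT.
Qed.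

Lemma field_meas_sub (I J : set S) X : I `<=` J -> field_meas I X -> field_meas J X.
Proof.
move=> IJ mX _ B mB; have := mX measurableT B mB.
by apply: sub_smallest2r; [exact: smallest_sigma_algebra|exact: bigcup_subset].
Qed.

Lemma field_meas_coord (I : set S) s (u : 'cV[R]_d.+1 -> R) : I s ->
  measurable_fun setT u -> field_meas I (fun w => u (Z s w)).
Proof.
move=> Is mu _ B mB; rewrite setTI; apply: sub_sigma_algebra.
exists s => //; exists (u @^-1` B); last by rewrite setTI.
by rewrite -[X in measurable X]setTI; exact: mu.
Qed.

Lemma field_meas_cst I c : field_meas I (fun=> c).
Proof. exact: measurable_cst. Qed.

Lemma field_measD I X Y : field_meas I X -> field_meas I Y ->
  field_meas I (fun w => X w + Y w).
Proof. exact: measurable_funD. Qed.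

Lemma field_measM I X Y : field_meas I X -> field_meas I Y ->
  field_meas I (fun w => X w * Y w).
Proof. exact: measurable_funM. Qed.

Lemma field_meas_comp I X (g : R -> R) : measurable_fun setT g ->
  field_meas I X -> field_meas I (fun w => g (X w)).
Proof. by move=> mg mX; exact: (measurableT_comp mg mX). Qed.

Lemma field_meas_sum I (K : Type) (r : seq K) (p : pred K) (F : K -> T -> R) :
  (forall i, p i -> field_meas I (F i)) ->
  field_meas I (fun w => \sum_(i <- r | p i) F i w).
Proof.
move=> mF; elim: r => [|i r IH].
  by under eq_fun do rewrite big_nil; exact: field_meas_cst.
have [pi|/negbTE pi] := boolP (p i); under eq_fun do rewrite big_cons pi; last by [].
by apply: field_measD => //; exact: mF.
Qed.

Lemma field_meas_prod I (K : Type) (r : seq K) (p : pred K) (F : K -> T -> R) :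
  (forall i, p i -> field_meas I (F i)) ->
  field_meas I (fun w => \prod_(i <- r | p i) F i w).
Proof.
move=> mF; elim: r => [|i r IH].
  by under eq_fun do rewrite big_nil; exact: field_meas_cst.
have [pi|/negbTE pi] := boolP (p i); under eq_fun do rewrite big_cons pi; last by [].
by apply: field_measM => //; exact: mF.
Qed.

Definition site_dist (s t : S) : nat := \max_i absz (s i 0 - t i 0)%R.

Lemma site_dist_norm (s t : S) : ((site_dist s t)%:Z <= `|s - t|)%R.
Proof.
rewrite /site_dist.
apply: (big_ind (fun n : nat => n%:Z <= `|s - t|)) => [|m n mb nb|i _].
- exact: normr_ge0.
- by rewrite /maxn; case: ifP.
- by have := mx_coord_le (s - t) i 0; rewrite !mxE abszE.
Qed.

Lemma site_dist_ge (s t : S) i : (absz (s i 0 - t i 0)%R <= site_dist s t)%N.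
Proof. exact: (leq_bigmax i). Qed.

Lemma site_distC s t : site_dist s t = site_dist t s.
Proof. by apply: eq_bigr => i _; rewrite distnC. Qed.

Lemma site_dist_triangle s t u : (site_dist s u <= site_dist s t + site_dist t u)%N.
Proof.
apply/bigmax_leqP => i _; apply: (leq_trans (leqD_dist _ (t i 0) _)).
by rewrite leq_add// site_dist_ge.
Qed.

Lemma site_dist_xx s : site_dist s s = 0%N.
Proof. by rewrite /site_dist big1// => i _; rewrite subrr. Qed.

(** The maximum with one makes the covariance bound below true at distance zero as
    well, where the mixing coefficient gives no information. *)
Definition mix_rate (c0 c1 : R) (k : nat) : R := Num.max c0 1 * expR (- c1 * k%:R).

Variables (c0 c1 : R) (f : 'cV[R]_d.+1 -> R).
Hypothesis SA : standing_assumptions Z c0 c1 f.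

(** The covariance inequality for sigma-algebras of the field. At distance zero it
    reduces to the trivial bound [2 * b1 * b2]. *)
Lemma field_covariance_le (I J : set S) k (X Y : T -> R) (b1 b2 : R) :
  (forall s t, I s -> J t -> (k <= site_dist s t)%N) ->
  field_meas I X -> field_meas J Y -> 0 < b1 -> 0 < b2 ->
  (forall w, `|X w| <= b1) -> (forall w, `|Y w| <= b2) ->
  `|expect P (fun w => X w * Y w) - expect P X * expect P Y| <=
  4 * mix_rate c0 c1 k * b1 * b2.
Proof.
move=> IJ mX mY b10 b20 Xb Yb.
have bX : bmf X by split; [exact: field_meas_measurable mX|exists b1].
have bY : bmf Y by split; [exact: field_meas_measurable mY|exists b2].
have [k0|k0] := posnP k.
  have h1 : `|expect P (fun w => X w * Y w)| <= b1 * b2.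
    by apply: E_norm_le => [|w]; [exact: bmfM|rewrite normrM ler_pM].
  have h2 : `|expect P X * expect P Y| <= b1 * b2.
    by rewrite normrM ler_pM//; exact: E_norm_le.
  rewrite (le_trans (ler_normB _ _))// (le_trans (lerD h1 h2))//.
  have c1le : 1 <= mix_rate c0 c1 k.
    by rewrite /mix_rate k0 mulr0 expR0 mulr1 le_max lexx orbT.
  have -> : b1 * b2 + b1 * b2 = 2 * (b1 * b2) by ring.
  rewrite -[leRHS]mulrA ler_wpM2r ?mulr_ge0 ?ltW//.
  by move: (mix_rate c0 c1 k) c1le => c; lra.
have mixing A C : field_sigma Z I A -> field_sigma Z J C ->
    `|fine (P (A `&` C)) - fine (P A) * fine (P C)| <= mix_rate c0 c1 k.
  move=> IA JC.
  have mA := field_sigma_measurable IA; have mC := field_sigma_measurable JC.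
  have h : (`|P (A `&` C) - P A * P C| <= alpha_mixing Z k)%E.
    apply: ereal_sup_ubound; exists I, J, A, C; split => //.
    apply: le_ereal_inf_tmp => _ [s [t [Is Jt ->]]].
    rewrite lee_fin -[k%:R]/(k%:Z%:~R) ler_int.
    by apply: le_trans (site_dist_norm s t); rewrite lez_nat IJ.
  have := le_trans h (field_mixing SA k0).
  rewrite -(fineK (fin_num_measure P _ mA)) -(fineK (fin_num_measure P _ mC)).
  rewrite -(fineK (fin_num_measure P _ (measurableI _ _ mA mC))).
  rewrite -EFinM -EFinB /= lee_fin => /le_trans; apply.
  by rewrite ler_wpM2r ?expR_ge0// le_max lexx.
apply: (mixing_covariance_le mixing) => //.
- exact: field_meas_measurable mX.
- exact: field_meas_measurable mY.
- exact: field_meas_level.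
- exact: field_meas_level.
Qed.

End field.

(** * First absolute moment of a sum *)

Lemma absz_sub_le (x y : int) (m : nat) : (absz x <= m)%N -> (absz y <= m)%N ->
  (absz (x - y)%R <= m + m)%N.
Proof. lia. Qed.

Section clipping.
Context {R : realType}.

Definition clip (l x : R) : R := Num.max (- l) (Num.min l x).

Lemma measurable_clip l : measurable_fun setT (clip l).
Proof.
by apply: measurable_maxr => //; apply: measurable_minr => //.
Qed.

Lemma clip_le (l x : R) : 0 <= l -> `|clip l x| <= l.
Proof.
move=> l0; rewrite ler_norml /clip le_max lexx/= ge_max ge_min lexx andbT.
by rewrite ge0_cp.
Qed.

Lemma clip_norm_le (l x : R) : 0 <= l -> `|clip l x| <= `|x|.
Proof.
move=> l0; rewrite /clip maxEle minEle; case: (ger0P x) => x0; repeat case: ifPn; rewrite -?ltNge => *; rewrite ?ler_norml; lra.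
Qed.

Lemma clip_err (l x : R) : 0 < l -> `|x - clip l x| <= x ^+ 2 / l.
Proof.
move=> l0; rewrite ler_pdivlMr//.
have [xl|xl] := leP `|x| l.
  have -> : clip l x = x.
    move: xl; rewrite ler_norml => /andP[h1 h2].
    by rewrite /clip (min_idPr h2) (max_idPr h1).
  by rewrite subrr normr0 mul0r sqr_ge0.
rewrite -real_normK ?num_real// expr2; apply: ler_pM; rewrite ?normr_ge0 ?(ltW l0) ?(ltW xl)//.
rewrite /clip maxEle minEle; move: xl; case: (ger0P x) => x0; repeat case: ifPn; rewrite -?ltNge => *; rewrite ler_norml; lra.
Qed.

(** One term of the exponential series. *)
Lemma exprn_expR_le r (c x : R) : (0 < r)%N -> 0 < c -> 0 <= x ->
  x ^+ r * expR (- c * x) <= r`!%:R / c ^+ r.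
Proof.
case: r => // r _ c0 x0; rewrite ler_pdivlMr ?exprn_gt0//.
rewrite mulNr expRN (mulrC c x) mulrAC -exprMn ler_pdivrMr ?expR_gt0//.
rewrite -ler_pdivrMl ?ltr0n ?fact_gt0// [leLHS]mulrC.
have := expR_ge1Dxn r (mulr_ge0 x0 (ltW c0)); apply: le_trans.
by rewrite lerDr.
Qed.

Lemma mix_rate_ge0 (c0 c1 : R) k : 0 <= mix_rate c0 c1 k.
Proof. by apply: mulr_ge0; [rewrite le_max ler01 orbT|exact: expR_ge0]. Qed.

End clipping.

Section centering.
Context {R : realType} {dT} {T : measurableType dT} (P : probability T R).
Notation "''E' X" := (expect P X) (at level 10, X at level 9).

Lemma E_centered X : bmf X -> 'E (fun w => X w - 'E X) = 0.
Proof.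
move=> bX; rewrite (EB P bX (bmf_cst _)).
by rewrite [X in _ - X]E_cst subrr.
Qed.

Lemma E_centered_mul X Y : bmf X -> bmf Y ->
  'E (fun w => (X w - 'E X) * (Y w - 'E Y)) = 'E (fun w => X w * Y w) - 'E X * 'E Y.
Proof.
move=> bX bY; set a := 'E X; set b := 'E Y.
rewrite (@eq_expect _ _ _ P _ (fun w => (X w * Y w - b * X w) - (a * Y w - a * b))).
  have bXY := bmfM bX bY; have bbX := bmfZ b bX; have baY := bmfZ a bY.
  rewrite (EB P (bmfB bXY bbX) (bmfB baY (bmf_cst (a * b)))) (EB P bXY bbX).
  have Ec : 'E (cst (a * b)) = a * b by exact: E_cst.
  rewrite (EB P baY (bmf_cst (a * b))) (EZ P b bX) (EZ P a bY) Ec -/a -/b; ring.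
by move=> w; ring.
Qed.

Lemma E_centered_sqr X : bmf X ->
  'E (fun w => (X w - 'E X) ^+ 2) <= 'E (fun w => X w ^+ 2).
Proof.
move=> bX; rewrite (@eq_expect _ _ _ P _ (fun w => (X w - 'E X) * (X w - 'E X))).
  rewrite (E_centered_mul bX bX) (@eq_expect _ _ _ P _ (fun w => X w ^+ 2)).
    by rewrite lerBlDr lerDl -expr2 sqr_ge0.
  by move=> w; rewrite expr2.
by move=> w; rewrite expr2.
Qed.

End centering.

Section dyadic.
Context {R : realType} {d N : nat} {dT} {T : measurableType dT}
  (P : probability T R) (Z : 'cV[int]_N -> {RV P >-> 'cV[R]_d.+1}).
Local Notation S := ('cV[int]_N).
Notation "''E' X" := (expect P X) (at level 10, X at level 9).
Hypothesis N_gt0 : (0 < N)%N.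
Variables (c0 c1 : R) (f : 'cV[R]_d.+1 -> R).
Hypothesis c1_gt0 : 0 < c1.
Hypothesis SA : standing_assumptions Z c0 c1 f.

(** Bounds [mix_rate (2 ^ l)] times the powers of [2 ^ l] lost in one dyadic step:
    exponential mixing beats every polynomial, with a factor [2 ^ (-l)] to spare,
    which makes the losses over all steps summable. *)
Definition dyadic_const : R := 4 * (2 ^ N)%:R ^+ 2 *
  (Num.max c0 1 * ((4 * N).+1`!%:R / c1 ^+ (4 * N).+1)).

Lemma dyadic_const_ge0 : 0 <= dyadic_const.
Proof.
apply: mulr_ge0; first by rewrite mulr_ge0// exprn_ge0.
by apply: mulr_ge0; [rewrite le_max ler01 orbT|rewrite divr_ge0// exprn_ge0// ltW].
Qed.

Lemma dyadic_rate l : 4 * (2 ^ N)%:R ^+ 2 * mix_rate c0 c1 (2 ^ l) *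
  (2 ^ N)%:R ^+ (4 * l) <= dyadic_const / 2 ^+ l.
Proof.
rewrite ler_pdivlMr ?exprn_gt0// /dyadic_const /mix_rate.
have := exprn_expR_le (ltn0Sn (4 * N)) c1_gt0 (ler0n R (2 ^ l)).
have -> : (2 ^ l)%:R ^+ (4 * N).+1 = (2 ^ N)%:R ^+ (4 * l) * 2 ^+ l :> R.
  rewrite !natrX -!exprM -exprD; congr (_ ^+ _).
  by rewrite mulnS addnC; lia.
have c00 : 0 <= Num.max c0 1 by rewrite le_max ler01 orbT.
move=> h; rewrite -!mulrA ler_wpM2l// ler_wpM2l ?exprn_ge0//.
by rewrite ler_wpM2l// ler_wpM2l// [leLHS]mulrC.
Qed.

Variables (X : S -> T -> R) (be V : R).
Hypothesis mX : forall s, field_meas Z [set s] (X s).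
Hypothesis Xbe : forall s w, `|X s w| <= be.
Hypothesis X0 : forall s, 'E (X s) = 0.
Hypothesis XV : forall s, 'E (fun w => X s w ^+ 2) <= V.
Hypothesis V_gt0 : 0 < V.

Let bX s : bmf (X s).
Proof. by split; [exact: field_meas_measurable (@mX s)|exists be]. Qed.

(** The sum over [I] is within [e * sqrt (|I| V)], in the mean, of a bounded centred
    variable of the right variance that only looks at the sites of [I]. Approximating
    in the mean, and keeping the second moment of the approximation, allows one to
    truncate, so that the covariance inequality can be used without any dependence
    on the sup norm of the summands. *)
Definition block_approx (I : seq S) (c e : R) : Prop := exists G : T -> R,
  [/\ field_meas Z [set` I] G, bmf G, 'E G = 0,
      'E (fun w => G w ^+ 2) <= c * ((size I)%:R * V) &
      'E (fun w => `|\sum_(s <- I) X s w - G w|) <=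
        e * Num.sqrt ((size I)%:R * V)].

Lemma block_approx1 I c e : (size I <= 1)%N -> 1 <= c -> 0 <= e -> block_approx I c e.
Proof.
case: I => [|s [|//]] _ c_ge e0.
  exists (fun=> 0); split.
  - exact: field_meas_cst.
  - exact: bmf_cst.
  - exact: E_cst.
  - by rewrite (@eq_expect _ _ _ P _ (fun=> 0)) ?E_cst ?mul0r ?mulr0// => w; rewrite expr0n.
  - rewrite (@eq_expect _ _ _ P _ (fun=> 0)) ?E_cst ?mulr_ge0 ?sqrtr_ge0// => w.
    by rewrite big_nil subr0 normr0.
exists (X s); split => //.
- apply: (@field_meas_sub _ _ _ _ _ _ _ [set s]) (@mX s).
  by move=> _ ->; rewrite /= mem_head.
- by rewrite (le_trans (XV s))// mul1r ler_peMl// ltW.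
- rewrite (@eq_expect _ _ _ P _ (fun=> 0)) ?E_cst ?mulr_ge0 ?sqrtr_ge0// => w.
  by rewrite big_seq1 subrr normr0.
Qed.

(** Sites are grouped by their residues modulo [2 ^ l]: distinct members of a class
    are at distance at least [2 ^ l], so finer classes are better separated. *)
Definition same_class (l : nat) (I : seq S) := forall s t i, s \in I -> t \in I ->
  (2 ^ l %| absz (s i 0 - t i 0)%R)%N.

Definition child (l : nat) (s0 s : S) : {ffun 'I_N -> bool} :=
  [ffun i => (2 ^ l.+1 %| absz (s i 0 - s0 i 0)%R)%N].

Lemma child_class l s0 (I : seq S) a : s0 \in I -> same_class l I ->
  same_class l.+1 [seq s <- I | child l s0 s == a].
Proof.
move=> s0I cI s t i; rewrite !mem_filter => /andP[/eqP sa sI] /andP[/eqP ta tI].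
have := congr1 (fun b : {ffun 'I_N -> bool} => b i) (etrans sa (esym ta)).
rewrite !ffunE.
have dz (n : nat) (x : int) : (n %| absz x)%N = (n%:Z %| x)%Z by rewrite dvdzE.
have := cI _ _ i sI s0I; have := cI _ _ i tI s0I; rewrite !dz.
move=> /dvdzP[v tv] /dvdzP[u su]; rewrite tv su.
have -> : s i 0 - t i 0 = (u - v) * (2 ^ l)%N%:Z by rewrite mulrBl -su -tv; ring.
rewrite expnS PoszM !dvdz_mul2r ?expn_eq0//; lia.
Qed.

Lemma child_dist l s0 (I : seq S) s t : same_class l I -> s \in I -> t \in I ->
  child l s0 s != child l s0 t -> (2 ^ l <= site_dist s t)%N.
Proof.
move=> cI sI tI st.
have [i sti] : exists i, s i 0 != t i 0.
  apply/existsP; apply: contraNT st; rewrite negb_exists => /forallP h.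
  by apply/eqP/ffunP => i; rewrite !ffunE; move: (h i) => /negPn/eqP ->.
apply: leq_trans (site_dist_ge s t i).
by rewrite dvdn_leq// ?cI// absz_gt0 subr_eq0.
Qed.

Let D : R := (2 ^ N)%:R.

Let D_ge2 : 2 <= D.
Proof. by rewrite /D ler_nat -[leqLHS]expn1 leq_exp2l. Qed.

Let K : R := dyadic_const.

Let c : R := 1 + 2 * K.

(** A class modulo [2 ^ l] splits into [D = 2 ^ N] classes modulo [2 ^ l.+1], which
    are at distance at least [2 ^ l] from each other. The approximations of the
    subclasses are truncated at height [la], recentred and added. Off-diagonal
    covariances are at most [4 * mix_rate (2 ^ l) * la ^ 2], which increases the
    variance constant by a summable amount; truncation costs at most the second
    moment over [la] in the mean. An error [e] at level [l.+1] becomes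
    [D * e + 2 * c / D ^+ (2 * l)] at level [l], which for
    [e = 4 * c / D ^+ (2 * l.+1)] is at most [4 * c / D ^+ (2 * l)] because [D >= 2]. *)
Lemma block_approx_step l (I : seq S) s0 : uniq I -> s0 \in I -> same_class l I ->
  (forall a, block_approx [seq s <- I | child l s0 s == a]
     (1 + 2 * K / 2 ^+ l.+1) (4 * c / D ^+ (2 * l.+1))) ->
  block_approx I (1 + 2 * K / 2 ^+ l) (4 * c / D ^+ (2 * l)).
Proof.
move=> uI s0I cI /choice[G GP].
have K0 : 0 <= K := dyadic_const_ge0.
have K20 : 0 <= 2 * K by apply: mulr_ge0.
have D0 : 0 < D by apply: lt_le_trans D_ge2.
pose Ia a := [seq s <- I | child l s0 s == a].
pose n := (size I)%:R : R.
have n0 : 0 < n by rewrite ltr0n; case: (I) s0I.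
pose w0 := Num.sqrt (n * V).
have nV0 : 0 < n * V by exact: mulr_gt0.
have w00 : 0 < w0 by rewrite sqrtr_gt0.
have w0sq : w0 ^+ 2 = n * V by rewrite sqr_sqrtr ?ltW.
(* The standard deviation of the block, enlarged by a power that the mixing rate can
   afford. *)
pose la := w0 * D ^+ (2 * l).
have la0 : 0 < la by rewrite mulr_gt0// exprn_gt0.
pose Tr a w := clip la (G a w).
have bG a : bmf (G a) by case: (GP a).
have bTr a : bmf (Tr a).
  split; last by exists la => w; rewrite clip_le// ltW.
  exact: measurableT_comp (measurable_clip la) (bG a).1.
pose H a w := Tr a w - 'E (Tr a).
have bH a : bmf (H a) by exact: (bmfB (bTr a) (bmf_cst _)).
have sumn : \sum_a (size (Ia a))%:R = n.
  rewrite /n -sum1_size natr_sum (partition_big (child l s0) xpredT)//=.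
  by apply: eq_bigr => a _; rewrite -sum1_size natr_sum big_filter.
have EG2 a : 'E (fun w => G a w ^+ 2) <= (1 + 2 * K / 2 ^+ l.+1) * ((size (Ia a))%:R * V).
  by case: (GP a).
have EG2c a : 'E (fun w => G a w ^+ 2) <= c * ((size (Ia a))%:R * V).
  apply: (le_trans (EG2 a)); rewrite ler_wpM2r ?mulr_ge0 ?(ltW V_gt0)//.
  rewrite /c lerD2l ler_pdivrMr ?exprn_gt0// ler_peMr//.
  by rewrite exprn_ege1// ler1n.
have err a : 'E (fun w => `|G a w - Tr a w|) <= c * ((size (Ia a))%:R * V) / la.
  apply: (le_trans (E_le _ _ _ (Y := fun w => la^-1 * G a w ^+ 2) _)).
  - by apply: bmf_abs; exact: bmfB.
  - by apply: bmfZ; exact: bmfX.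
  - by move=> w; rewrite [leRHS]mulrC; exact: clip_err.
  rewrite EZ; last exact: bmfX.
  by rewrite [leLHS]mulrC ler_wpM2r ?invr_ge0 ?(ltW la0).
have errE a : `|'E (Tr a)| <= c * ((size (Ia a))%:R * V) / la.
  have -> : 'E (Tr a) = - 'E (fun w => G a w - Tr a w).
    by rewrite EB//; case: (GP a) => _ _ -> _ _; rewrite sub0r opprK.
  rewrite normrN; apply: le_trans (err a); apply: E_norm; exact: bmfB.
exists (fun w => \sum_a H a w); split.
- apply: field_meas_sum => a _; apply: field_measD; last exact: field_meas_cst.
  apply: field_meas_comp; first exact: measurable_clip.
  have [mG _ _ _ _] := GP a; apply: field_meas_sub mG.
  by move=> s /=; rewrite mem_filter => /andP[].
- exact: bmf_sum.
- by rewrite E_sum// big1// => a _; exact: E_centered.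
- have -> : 'E (fun w => (\sum_a H a w) ^+ 2) = \sum_a \sum_b 'E (fun w => H a w * H b w).
    rewrite (@eq_expect _ _ _ P _ (fun w => \sum_a \sum_b H a w * H b w)).
      rewrite E_sum; last by move=> a; apply: bmf_sum => b; exact: bmfM.
      by apply: eq_bigr => a _; rewrite E_sum// => b; exact: bmfM.
    by move=> w; rewrite expr2 mulr_suml; apply: eq_bigr => a _; rewrite mulr_sumr.
  pose m := 4 * mix_rate c0 c1 (2 ^ l) * la * la.
  have m0 : 0 <= m.
    apply: mulr_ge0; last exact: ltW; apply: mulr_ge0; last exact: ltW.
    by apply: mulr_ge0 => //; exact: mix_rate_ge0.
  have HH a b : 'E (fun w => H a w * H b w) <=
      (if a == b then 'E (fun w => G a w ^+ 2) else 0) + m.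
    case: eqVneq => [<-|ab].
      rewrite (@eq_expect _ _ _ P _ (fun w => H a w ^+ 2)); last by move=> w; rewrite expr2.
      rewrite -[leLHS]addr0 lerD//; apply: (le_trans (E_centered_sqr P (bTr a))).
      apply: E_le; [exact: bmfX|exact: bmfX|move=> w].
      rewrite -[leLHS]real_normK ?num_real// -[leRHS]real_normK ?num_real//.
      by rewrite ler_pXn2r ?nnegrE// clip_norm_le// ltW.
    rewrite add0r E_centered_mul//; apply: (le_trans (ler_norm _)).
    have [mGa _ _ _ _] := GP a; have [mGb _ _ _ _] := GP b.
    apply: (field_covariance_le SA (I := [set` Ia a]) (J := [set` Ia b])) => //.
    + move=> s t; rewrite /= !mem_filter => /andP[/eqP sa sI] /andP[/eqP tb tI].
      by apply: (child_dist (s0 := s0) cI) => //; rewrite sa tb.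
    + exact: field_meas_comp (measurable_clip la) mGa.
    + exact: field_meas_comp (measurable_clip la) mGb.
    + by move=> w; rewrite clip_le// ltW.
    + by move=> w; rewrite clip_le// ltW.
  apply: (le_trans (ler_sum _ (fun a _ => ler_sum _ (fun b _ => HH a b)))).
  have -> : \sum_a \sum_b ((if a == b then 'E (fun w => G a w ^+ 2) else 0) + m) =
      \sum_a 'E (fun w => G a w ^+ 2) + D ^+ 2 * m.
    under eq_bigr => a _ do rewrite big_split /= -big_mkcond/= (big_pred1 a)// ?sumr_const.
    rewrite big_split/= sumr_const -mulrnA card_ffun card_bool card_ord.
    by rewrite -mulr_natl natrM /D expr2.
  apply: (le_trans (lerD (ler_sum _ (fun a _ => EG2 a)) (lexx _))).
  rewrite -mulr_sumr -mulr_suml sumn.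
  have -> : D ^+ 2 * m = (4 * D ^+ 2 * mix_rate c0 c1 (2 ^ l) * D ^+ (4 * l)) * (n * V).
    have -> : D ^+ (4 * l) = D ^+ (2 * l) * D ^+ (2 * l) by rewrite -exprD -mulnDl.
    by rewrite -w0sq /m /la; ring.
  apply: (le_trans (lerD (lexx _) (ler_wpM2r (ltW nV0) (dyadic_rate l)))).
  rewrite -mulrDl ler_wpM2r ?(ltW nV0)// exprS -/K.
  by rewrite le_eqVlt; apply/orP; left; apply/eqP; field; rewrite expf_neq0// pnatr_eq0.
- have split_sum w : \sum_(s <- I) X s w = \sum_a \sum_(s <- Ia a) X s w.
    rewrite (partition_big (child l s0) xpredT)//=.
    by apply: eq_bigr => a _; rewrite big_filter.
  have bS (J : seq S) : bmf (fun w => \sum_(s <- J) X s w) by exact: bmf_sum.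
  apply: (@le_trans _ _ (\sum_a ('E (fun w => `|\sum_(s <- Ia a) X s w - G a w|) +
     ('E (fun w => `|G a w - Tr a w|) + `|'E (Tr a)|)))).
    have b1 a : bmf (fun w => `|\sum_(s <- Ia a) X s w - G a w|).
      by apply: bmf_abs; exact: bmfB.
    have b2 a : bmf (fun w => `|G a w - Tr a w|) by apply: bmf_abs; exact: bmfB.
    have b3 a : bmf (fun w => `|G a w - Tr a w| + `|'E (Tr a)|).
      by exact: (bmfD (b2 a) (bmf_cst _)).
    have Ea a : 'E (fun w => `|\sum_(s <- Ia a) X s w - G a w| +
        (`|G a w - Tr a w| + `|'E (Tr a)|)) =
       'E (fun w => `|\sum_(s <- Ia a) X s w - G a w|) +
       ('E (fun w => `|G a w - Tr a w|) + `|'E (Tr a)|).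
      rewrite (ED P (b1 a) (b3 a)); congr (_ + _).
      by rewrite (ED P (b2 a) (bmf_cst _)); congr (_ + _); exact: E_cst.
    under eq_bigr do rewrite -Ea.
    rewrite -E_sum; last by move=> a; exact: bmfD.
    apply: E_le.
    + by apply: bmf_abs; apply: bmfB => //; exact: bmf_sum.
    + by apply: bmf_sum => a; exact: bmfD.
    move=> w; rewrite split_sum -sumrB; apply: (le_trans (ler_norm_sum _ _ _)).
    apply: ler_sum => a _; rewrite /H.
    have -> : \sum_(s <- Ia a) X s w - (Tr a w - 'E (Tr a)) =
      (\sum_(s <- Ia a) X s w - G a w) + ((G a w - Tr a w) + 'E (Tr a)) by ring.
    by rewrite (le_trans (ler_normD _ _))// lerD2l (le_trans (ler_normD _ _)).
  apply: (@le_trans _ _ (\sum_(a : {ffun 'I_N -> bool}) (4 * c / D ^+ (2 * l.+1) * w0 +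
      2 * (c * ((size (Ia a))%:R * V) / la)))).
    apply: ler_sum => a _; apply: lerD.
      have [_ _ _ _ h] := GP a; apply: (le_trans h).
      rewrite ler_wpM2l ?divr_ge0 ?mulr_ge0 ?exprn_ge0 ?(ltW D0)//.
        by rewrite /c addr_ge0.
      rewrite ler_wsqrtr// ler_wpM2r ?(ltW V_gt0)// ler_nat size_filter.
      exact: count_size.
    by rewrite mulr_natl mulr2n lerD.
  rewrite big_split/= sumr_const card_ffun card_bool card_ord.
  rewrite -mulr_sumr -mulr_suml -mulr_sumr -mulr_suml sumn -/D -[X in X + _]mulr_natl -/D.
  rewrite -/w0 -w0sq /la.
  have c0' : 0 <= c by rewrite /c addr_ge0.
  have -> : 2 * (c * w0 ^+ 2 / (w0 * D ^+ (2 * l))) = 2 * c / D ^+ (2 * l) * w0.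
    by field; rewrite ?(gt_eqF w00) ?expf_neq0 ?(gt_eqF D0).
  have -> : D * (4 * c / D ^+ (2 * l.+1) * w0) = (4 * c / D) / D ^+ (2 * l) * w0.
    have -> : D ^+ (2 * l.+1) = D * D * D ^+ (2 * l) by rewrite mulnS exprD expr2.
    by field; rewrite ?expf_neq0 ?(gt_eqF D0).
  rewrite -mulrDl -mulrDl ler_wpM2r ?(ltW w00)// ler_wpM2r ?invr_ge0 ?exprn_ge0 ?(ltW D0)//.
  have : 4 * c / D <= 2 * c.
    rewrite ler_pdivrMr//; have := ler_wpM2l c0' D_ge2; lra.
  by move=> h; lra.
Qed.

(** Descending induction on the level: a class whose members are closer than the
    modulus has at most one element. *)
Lemma block_approx_dyadic m l (I : seq S) : uniq I -> same_class l I ->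
  (forall s t i, s \in I -> t \in I -> (absz (s i 0 - t i 0)%R < 2 ^ (l + m))%N) ->
  block_approx I (1 + 2 * K / 2 ^+ l) (4 * c / D ^+ (2 * l)).
Proof.
have K0 : 0 <= K := dyadic_const_ge0.
have K20 : 0 <= 2 * K by apply: mulr_ge0.
have D0 : 0 < D by apply: lt_le_trans D_ge2.
have triv l' (J : seq S) : (size J <= 1)%N ->
    block_approx J (1 + 2 * K / 2 ^+ l') (4 * c / D ^+ (2 * l')).
  move=> J1; apply: block_approx1 => //.
    by rewrite lerDl divr_ge0// exprn_ge0.
  rewrite divr_ge0 ?exprn_ge0 ?(ltW D0)//; apply: mulr_ge0 => //.
  by rewrite /c addr_ge0.
elim: m l I => [|m IH] l I uI cI mI.
  apply: triv; case: I uI cI mI => [//|s [//|t I]] /= /andP[sI _] cI mI.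
  have tin : t \in [:: s, t & I] by rewrite !inE eqxx orbT.
  have sin : s \in [:: s, t & I] by rewrite !inE eqxx.
  have st : s = t.
    apply/colP => i; apply/eqP; rewrite -subr_eq0 -absz_eq0; apply/negPn/negP => h.
    have := mI s t i sin tin; rewrite addn0 ltnNge dvdn_leq ?lt0n//.
    exact: cI.
  by rewrite st mem_head in sI.
case: I uI cI mI => [|s0 I'] uI cI mI; first exact: triv.
set I := s0 :: I' in uI cI mI *; have s0I : s0 \in I by rewrite mem_head.
apply: (block_approx_step uI s0I cI) => a; apply: IH.
- exact: filter_uniq.
- exact: child_class.
- by move=> s t i; rewrite !mem_filter addSnnS => /andP[_ ?] /andP[_ ?]; exact: mI.
Qed.

Lemma sum_norm_le_pos (I : seq S) : uniq I ->
  'E (fun w => `|\sum_(s <- I) X s w|) <= 5 * c * Num.sqrt ((size I)%:R * V).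
Proof.
move=> uI.
have K0 : 0 <= K := dyadic_const_ge0.
have c_ge1 : 1 <= c by rewrite lerDl mulr_ge0.
have [m mI] : exists m, forall s t i, s \in I -> t \in I ->
    (absz (s i 0 - t i 0)%R < 2 ^ (0 + m))%N.
  pose m := (\sum_(s <- I) \sum_i absz (s i 0)%R)%N; exists (m + m)%N => s t i sI tI.
  have le_m u : u \in I -> (absz (u i 0)%R <= m)%N.
    move=> uI'; by rewrite /m (big_rem u)//= (bigD1 i)//= -addnA leq_addr.
  apply: leq_ltn_trans (ltn_expl _ (ltnSn 1)); rewrite add0n.
  by apply: absz_sub_le; exact: le_m.
have cI : same_class 0 I by move=> s t i _ _; rewrite expn0 dvd1n.
have := block_approx_dyadic uI cI mI.
rewrite muln0 !expr0 !divr1 -/c => -[G [mG bG G0 G2 GS]].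
have bS : bmf (fun w => \sum_(s <- I) X s w) by exact: bmf_sum.
have bSG := bmf_abs (bmfB bS bG); have baG := bmf_abs bG.
apply: (@le_trans _ _ ('E (fun w => `|\sum_(s <- I) X s w - G w| + `|G w|))).
  apply: E_le; [exact: bmf_abs|exact: bmfD|move=> w].
  by rewrite -[X in `|X|](subrK (G w)) ler_normD.
rewrite (ED P bSG baG).
have -> : 5 * c * Num.sqrt ((size I)%:R * V) =
  4 * c * Num.sqrt ((size I)%:R * V) + c * Num.sqrt ((size I)%:R * V) by ring.
apply: lerD => //; apply: (le_trans (E_norm_sqrt P bG)).
have c0' : 0 <= c by rewrite (le_trans ler01).
rewrite -[X in X * _](ger0_norm c0') -sqrtr_sqr -sqrtrM ?sqr_ge0// ler_wsqrtr//.
apply: (le_trans G2); rewrite ler_wpM2r ?mulr_ge0 ?(ltW V_gt0)//.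
by rewrite expr2 ler_peMr.
Qed.

End dyadic.

Section sum_norm.
Context {R : realType} {d N : nat} {dT} {T : measurableType dT}
  (P : probability T R) (Z : 'cV[int]_N -> {RV P >-> 'cV[R]_d.+1}).
Local Notation S := ('cV[int]_N).
Notation "''E' X" := (expect P X) (at level 10, X at level 9).

(** The order of an independent sum, with a constant depending only on the mixing
    rate. In particular the bound on the summands, which grows with the resolution
    level, does not enter. *)
Lemma sum_norm_le (c0 c1 : R) (f : 'cV[R]_d.+1 -> R) (X : S -> T -> R) (be V : R)
    (I : seq S) : (0 < N)%N -> 0 < c1 -> standing_assumptions Z c0 c1 f ->
  (forall s, field_meas Z [set s] (X s)) -> (forall s w, `|X s w| <= be) ->
  (forall s, 'E (X s) = 0) -> (forall s, 'E (fun w => X s w ^+ 2) <= V) ->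
  uniq I ->
  'E (fun w => `|\sum_(s <- I) X s w|) <=
    5 * (1 + 2 * @dyadic_const R N c0 c1) * Num.sqrt ((size I)%:R * V).
Proof.
move=> N0 c10 SA mX Xbe X0 XV uI.
have : 0 <= V by apply: le_trans (XV 0); apply: E_ge0 => w; exact: sqr_ge0.
rewrite le_eqVlt => /orP[/eqP V0|V0]; last exact: (sum_norm_le_pos N0 c10 SA mX Xbe).
have bX s : bmf (X s).
  by split; [exact: field_meas_measurable (mX s)|exists be].
rewrite -V0 mulr0 sqrtr0 mulr0.
apply: (@le_trans _ _ ('E (fun w => \sum_(s <- I) `|X s w|))).
  apply: E_le; [by apply: bmf_abs; exact: bmf_sum| |by move=> w; exact: ler_norm_sum].
  by apply: bmf_sum => s; exact: bmf_abs.
rewrite E_sum; last by move=> s; exact: bmf_abs.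
apply: sumr_le0 => s _; apply: (le_trans (E_norm_sqrt P (bX s))).
by rewrite -(@sqrtr0 R) ler_wsqrtr// V0.
Qed.

End sum_norm.

(** * Moments of sums with decaying covariances *)

(** Measure the coordinates of a tuple by their distance [D] to [a0] and let [k] be
    the largest distance divided by [Q]. Of the [Q] intervals of length [k] one
    contains none of the at most [Q - 1] nonzero distances; the coordinates before
    and after this gap form the two groups. *)
Lemma gap_split (Q : nat) (D : 'I_Q -> nat) (A : {set 'I_Q}) (a0 : 'I_Q) :
  a0 \in A -> D a0 = 0%N -> (1 < #|A|)%N ->
  exists (A1 : {set 'I_Q}) (k : nat), [/\ A1 \subset A, A1 != finset.set0,
    A :\: A1 != finset.set0,
    forall i j, i \in A1 -> j \in A :\: A1 -> (k <= D j - D i)%N &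
    forall i, i \in A -> (D i <= Q * k + Q)%N].
Proof.
move=> a0A D0 A2.
have Q0 : (0 < Q)%N by apply: leq_trans (ltn_ord a0).
pose rho := (\max_(i in A) D i)%N.
have rhoD i : i \in A -> (D i <= rho)%N by move=> iA; rewrite /rho (bigD1 i)//= leq_maxl.
pose k := (rho %/ Q)%N.
have bound i : i \in A -> (D i <= Q * k + Q)%N.
  move=> /rhoD h; apply: (leq_trans h); rewrite /k {1}(divn_eq rho Q) mulnC.
  by rewrite leq_add2l ltnW// ltn_mod.
have [k0|k0] := posnP k.
  exists [set a0]%SET, 0%N; split => //.
  - by rewrite finset.sub1set.
  - by apply/set0Pn; exists a0; rewrite !inE.
  - apply/negP => /eqP h; have := cardsD1 a0 A; rewrite a0A h cards0 addn0 => h1.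
    by rewrite h1 in A2.
  - by rewrite -k0.
have [i1 i1A Di1] : exists2 i, i \in A & D i = rho.
  have A0 : (0 < #|A|)%N by apply: ltnW.
  by have [i iA e] := eq_bigmax_cond D A0; exists i.
(* The interval [(j k, (j + 1) k]] containing [D i]; there are fewer than [Q] values, so
   some [j] is missed. *)
pose idx (i : 'I_Q) : 'I_Q := insubd i ((D i).-1 %/ k)%N.
have [j jN] : exists j : 'I_Q, j \notin [set idx i | i in A :\ a0]%SET.
  apply/existsP; apply: contraT; rewrite negb_exists => /forallP h.
  have : (Q <= #|[set idx i | i in A :\ a0]%SET|)%N.
    rewrite -{1}(card_ord Q); apply: subset_leq_card; apply/fintype.subsetP => i _.
    by have := h i; rewrite negbK.
  rewrite leqNgt => /negP[]; apply: (leq_ltn_trans (leq_imset_card _ _)).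
  have := cardsD1 a0 A; rewrite a0A add1n => h1.
  by rewrite -h1 -[leqRHS]card_ord max_card.
have gap i : i \in A -> (j * k < D i)%N -> (j.+1 * k < D i)%N.
  move=> iA jD; rewrite ltnNge; apply/negP => Dj.
  have ia0 : i != a0 by apply/eqP => ia; move: jD; rewrite ia D0.
  move/negP: jN; apply; apply/imsetP; exists i; first by rewrite !inE ia0.
  have e : ((D i).-1 %/ k)%N = j.
    apply/eqP; rewrite eqn_leq leq_divRL//; apply/andP; split.
      rewrite -ltnS ltn_divLR//; apply: leq_trans Dj.
      by rewrite prednK// (leq_ltn_trans _ jD).
    by rewrite -ltnS prednK// (leq_ltn_trans _ jD).
  by apply: ord_inj; rewrite /idx val_insubd e ltn_ord.
exists [set i in A | (D i <= j * k)%N]%SET, k; split => //.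
- by apply/fintype.subsetP => i; rewrite inE => /andP[].
- by apply/set0Pn; exists a0; rewrite inE a0A D0.
- apply/set0Pn; exists i1; rewrite !inE i1A andbT -ltnNge Di1.
  apply: (@leq_trans (Q * k)); last by rewrite mulnC leq_divM.
  by rewrite ltn_mul2r k0 ltn_ord.
- move=> i l; rewrite !inE => /andP[iA Di] /andP[]; case: (l \in A) / idP => //= lA.
  rewrite -ltnNge => lD _; have := gap l lA lD.
  rewrite mulSn => h; rewrite leq_subRL; last by rewrite (leq_trans Di)// ltnW.
  by apply: leq_trans (ltnW h); rewrite addnC leq_add2l.
Qed.

Section lattice_sum.
Context {R : realType}.

Lemma sum_inj_le (I J : finType) (p : pred I) (q : pred J) (h : I -> J) (F : J -> R) :
  {in p &, injective h} -> (forall i, p i -> q (h i)) -> (forall j, 0 <= F j) ->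
  \sum_(i | p i) F (h i) <= \sum_(j | q j) F j.
Proof.
move=> hi pq F0.
pose B : {set J} := imset h (mem p).
have -> : \sum_(i | p i) F (h i) = \sum_(j in B) F j.
  by rewrite big_imset; last exact: hi.
rewrite [leLHS]big_mkcond [leRHS]big_mkcond; apply: ler_sum => j _.
case: ifPn => [jB|_]; last by case: ifP.
by have /imsetP[i pi ->] := jB; rewrite pq.
Qed.

(** The sup distance is at least the average of the coordinate distances, so the
    sum is bounded by a product of [N] geometric series; each coordinate is
    encoded by its sign and its absolute value. *)
Lemma site_exp_sum_le (N n : nat) (x : 'I_n -> 'cV[int]_N) (y : 'cV[int]_N) (z : R) :
  injective x -> 0 < z < 1 ->
  \sum_(t < n) z ^+ (N * site_dist (x t) y) <= (2 / (1 - z)) ^+ N.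
Proof.
move=> xi /andP[z0 z1].
pose B := (\max_(t < n) site_dist (x t) y)%N.
have tB t i : (absz (x t i 0 - y i 0)%R < B.+1)%N.
  rewrite ltnS; apply: (leq_trans (site_dist_ge _ _ _)).
  exact: (leq_bigmax (F := fun t => site_dist (x t) y)).
pose h t : {ffun 'I_N -> bool * 'I_B.+1} :=
  [ffun i => ((0 <= x t i 0 - y i 0)%R, Ordinal (tB t i))].
pose F (g : {ffun 'I_N -> bool * 'I_B.+1}) := \prod_i z ^+ (g i).2.
apply: (@le_trans _ _ (\sum_(t < n) F (h t))).
  apply: ler_sum => t _; rewrite /F prodrXr.
  apply: ler_wiXn2l; [exact: ltW|exact: ltW|].
  rewrite [leqRHS](_ : _ = \sum_(i < N) site_dist (x t) y)%N; last first.
    by rewrite sum_nat_const card_ord.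
  apply: leq_sum => i _.
  by rewrite ffunE /= site_dist_ge.
apply: (@le_trans _ _ (\sum_g F g)).
  apply: sum_inj_le => //.
    move=> s t _ _ st; apply: xi; apply/colP => i; apply: (@addIr _ (- y i 0)).
    have := congr1 (fun g : {ffun 'I_N -> bool * 'I_B.+1} => g i) st.
    rewrite !ffunE => -[]; move: (x s i 0 - _) (x t i 0 - _) => u v.
    by case: u v => u [] v //= _ [->].
  by move=> g; apply: prodr_ge0 => i _; rewrite exprn_ge0// ltW.
rewrite -(bigA_distr_bigA (fun (_ : 'I_N) (p : bool * 'I_B.+1) => z ^+ p.2)).
rewrite prodr_const card_ord; apply: lerXn2r; rewrite ?nnegrE.
- by apply: sumr_ge0 => i _; rewrite exprn_ge0// ltW.
- by rewrite divr_ge0// subr_ge0 ltW.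
rewrite -(pair_bigA _ (fun (b : bool) (m : 'I_B.+1) => z ^+ m))/=.
rewrite big_bool/= -mulr2n -[leLHS]mulr_natl ler_wpM2l//.
by rewrite -(big_mkord xpredT (fun m => z ^+ m)) sum_geometric_le// ltW.
Qed.

End lattice_sum.

Section moments.
Context {R : realType} {dT} {T : measurableType dT} (P : probability T R).
Notation "''E' X" := (expect P X) (at level 10, X at level 9).
Variables (Q n : nat) (i0 : 'I_n) (X : 'I_n -> T -> R) (dst : 'I_n -> 'I_n -> nat).
Variables (K v v0 r z H : R).
Hypothesis bX : forall t, bmf (X t).
Hypothesis X0 : forall t, 'E (X t) = 0.
Hypothesis K_ge0 : 0 <= K.
Hypothesis v_ge0 : 0 <= v.
Hypothesis v_le : v <= v0.
Hypothesis r_sqr : r ^+ 2 = n%:R.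
Hypothesis r_ge0 : 0 <= r.
Hypothesis z01 : 0 < z < 1.
Hypothesis H_ge1 : 1 <= H.
Hypothesis dst_tri : forall a b c, (dst a c <= dst a b + dst b c)%N.
Hypothesis dst_sum : forall u, \sum_t z ^+ dst t u <= H.
Hypothesis dst_xx : forall u, dst u u = 0%N.
Local Notation tup := {ffun 'I_Q -> 'I_n}.
Local Notation idx := {set 'I_Q}.

Definition prodX (s : tup) (A : idx) (w : T) : R := \prod_(i in A) X (s i) w.

(** The only probabilistic input: products over groups at distance [k] are almost
    uncorrelated, linearly in the standard deviation [v]. Each of the two groups
    saves one power of the scale [r], which pays for the [n = r ^ 2] positions of the
    whole tuple. *)
Hypothesis cov : forall (s : tup) (A1 A2 : idx) (k : nat),
  A1 != finset.set0 -> A2 != finset.set0 -> A1 :&: A2 = finset.set0 ->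
  (forall i j, i \in A1 -> j \in A2 -> (k <= dst (s j) (s i))%N) ->
  `|'E (fun w => prodX s A1 w * prodX s A2 w) -
     'E (prodX s A1) * 'E (prodX s A2)| <=
  K * v * r ^+ (#|A1| + #|A2| - 2) * z ^+ (Q * Q * k).

Definition pin (A : idx) (s : tup) : tup := [ffun i => if i \in A then s i else i0].

(** Sum of the absolute expectations over all tuples indexed by [A]. The coordinates
    outside [A] are pinned to [i0], so that one type of tuples serves all [A]. *)
Definition moment_sum (A : idx) : R := \sum_(s : tup | pin A s == s) `|'E (prodX s A)|.

Let bprod s A : bmf (prodX s A).
Proof. by apply: bmf_prod. Qed.

Lemma moment_sum_ge0 A : 0 <= moment_sum A.
Proof. by apply: sumr_ge0. Qed.

Lemma pinK A s : pin A (pin A s) = pin A s.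
Proof. by apply/ffunP => i; rewrite !ffunE; case: (i \in A). Qed.

Lemma prodX_pin A s : prodX (pin A s) A = prodX s A.
Proof.
by apply/funext => w; apply: eq_bigr => i iA; rewrite ffunE iA.
Qed.

Lemma moment_sum_mul (A A1 : idx) : A1 \subset A ->
  \sum_(s : tup | pin A s == s) `|'E (prodX s A1)| * `|'E (prodX s (A :\: A1))| <=
  moment_sum A1 * moment_sum (A :\: A1).
Proof.
move=> A1A; rewrite /moment_sum big_distrlr/= pair_big/=.
pose h (s : tup) := (pin A1 s, pin (A :\: A1) s).
pose F (p : tup * tup) := `|'E (prodX p.1 A1)| * `|'E (prodX p.2 (A :\: A1))|.
rewrite (eq_bigr (fun s => F (h s))); last first.
  by move=> s _; rewrite /F /h /= !prodX_pin.
apply: (sum_inj_le (q := fun p : tup * tup => (pin A1 p.1 == p.1) && (pin (A :\: A1) p.2 == p.2))).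
- move=> s t /eqP ps /eqP pt [e1 e2]; apply/ffunP => i.
  have [iA|iA] := boolP (i \in A); last first.
    by rewrite -ps -pt !ffunE (negbTE iA).
  have [iA1|iA1] := boolP (i \in A1).
    by have := congr1 (fun u : tup => u i) e1; rewrite !ffunE iA1.
  by have := congr1 (fun u : tup => u i) e2; rewrite !ffunE !inE iA iA1.
- by move=> s _; rewrite /h /= !pinK !eqxx.
- by move=> p; exact: mulr_ge0.
Qed.

(** The tuples clustered around their own site [s a0]: the choice of the centre
    costs [n], and each of the other sites is summed with geometric weights. *)
Lemma decay_sum_le (A : idx) a0 :
  \sum_(s : tup | pin A s == s) \prod_(i in A) z ^+ dst (s i) (s a0) <= n%:R * H ^+ Q.
Proof.
have /andP[z0 z1] := z01.
pose g u t := z ^+ dst t u.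
have g0 u t : 0 <= g u t by rewrite exprn_ge0// ltW.
apply: (@le_trans _ _ (\sum_(u < n) \sum_(s : tup | pin A s == s) \prod_(i in A) g u (s i))).
  rewrite exchange_big/=; apply: ler_sum => s _; rewrite (bigD1 (s a0))//= lerDl.
  by apply: sumr_ge0 => u _; apply: prodr_ge0.
have -> : n%:R * H ^+ Q = \sum_(u < n) H ^+ Q.
  by rewrite sumr_const card_ord mulr_natl.
apply: ler_sum => u _.
pose G (i : 'I_Q) t := if i \in A then g u t else (t == i0)%:R.
have G0 i t : 0 <= G i t by rewrite /G; case: ifP.
apply: (@le_trans _ _ (\sum_(s : tup) \prod_i G i (s i))).
  rewrite [leLHS]big_mkcond; apply: ler_sum => s _; case: ifPn => [/eqP ps|_]; last exact: prodr_ge0.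
  rewrite big_mkcond; apply: ler_prod => i _; rewrite /G; case: ifPn => iA; first by rewrite g0 lexx.
  by rewrite ler01 -ps ffunE (negbTE iA) eqxx lexx.
rewrite -(bigA_distr_bigA G).
have -> : H ^+ Q = \prod_(i < Q) H by rewrite prodr_const card_ord.
apply: ler_prod => i _; rewrite sumr_ge0//= /G; case: (i \in A); first exact: dst_sum.
by rewrite (bigD1 i0)//= eqxx big1 ?addr0// => t /negbTE ->.
Qed.

(** Each tuple is split at its own gap; the covariance across the gap decays in the
    gap length, hence in all the distances to [s a0], and is summable. What is left
    factors into lower order sums. As the position of the gap depends on the tuple,
    all partitions are summed. *)
Lemma moment_recursion (A : idx) a0 : a0 \in A -> (1 < #|A|)%N ->
  moment_sum A <= \sum_(A1 : idx | [&& A1 \subset A, A1 != finset.set0 & A :\: A1 != finset.set0])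
     moment_sum A1 * moment_sum (A :\: A1) +
  K / z ^+ (Q * Q) * H ^+ Q * v * r ^+ #|A|.
Proof.
move=> a0A A2; have /andP[z0 z1] := z01.
pose p (A1 : idx) := [&& A1 \subset A, A1 != finset.set0 & A :\: A1 != finset.set0].
pose e := K * v * r ^+ (#|A| - 2) / z ^+ (Q * Q).
have e0 : 0 <= e by rewrite /e !mulr_ge0 ?exprn_ge0 ?invr_ge0 ?exprn_ge0// ltW.
apply: (@le_trans _ _ (\sum_(s : tup | pin A s == s) (\sum_(A1 | p A1)
   `|'E (prodX s A1)| * `|'E (prodX s (A :\: A1))| +
   e * \prod_(i in A) z ^+ dst (s i) (s a0)))).
  apply: ler_sum => s _.
  have [A1 [k [A1A A10 A20 kA Dk]]] := gap_split (D := fun i => dst (s i) (s a0)) a0A (dst_xx _) A2.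
  have pA1 : p A1 by rewrite /p A1A A10.
  have prodE : 'E (prodX s A) = 'E (fun w => prodX s A1 w * prodX s (A :\: A1) w).
    apply: eq_expect => w; rewrite /prodX (big_setID A1)/=.
    by move/finset.setIidPr: A1A => ->.
  have c1 : `|'E (prodX s A)| <= `|'E (prodX s A1)| * `|'E (prodX s (A :\: A1))| +
      K * v * r ^+ (#|A| - 2) * z ^+ (Q * Q * k).
    have disj : A1 :&: (A :\: A1) = finset.set0.
      by apply/setP => i; rewrite !inE; case: (i \in A1).
    have kd i j : i \in A1 -> j \in A :\: A1 -> (k <= dst (s j) (s i))%N.
      move=> iA jA; apply: (leq_trans (kA i j iA jA)).
      by rewrite leq_subLR addnC dst_tri.
    have := cov A10 A20 disj kd; rewrite -prodE.
    have -> : (#|A1| + #|A :\: A1|)%N = #|A|.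
      by rewrite -(cardsID A1 A); move/finset.setIidPr: A1A => ->.
    rewrite -normrM; set c := 'E _ * 'E _; set b := 'E _ => h.
    rewrite -[b](subrK c) addrC; apply: (le_trans (ler_normD _ _)).
    by rewrite lerD2l.
  apply: (le_trans c1); apply: lerD.
    by rewrite (bigD1 A1)//= lerDl sumr_ge0// => B _; exact: mulr_ge0.
  rewrite /e -!mulrA; do 3! (rewrite ler_wpM2l ?exprn_ge0//).
  rewrite mulrC ler_pdivlMr ?exprn_gt0// -exprD prodrXr ler_wiXn2l ?ltW//.
  apply: (@leq_trans (\sum_(i in A) (Q * k + Q))%N); first exact: leq_sum.
  rewrite sum_nat_const (leq_trans (leq_mul (max_card _) (leqnn _)))// card_ord.
  by rewrite mulnDr mulnA.
rewrite big_split/= exchange_big/=; apply: lerD.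
  by apply: ler_sum => A1 /and3P[A1A _ _]; exact: moment_sum_mul.
rewrite -mulr_sumr; apply: (le_trans (ler_wpM2l e0 (decay_sum_le A a0))).
rewrite -r_sqr /e.
have -> : r ^+ #|A| = r ^+ (#|A| - 2) * r ^+ 2 by rewrite -exprD subnK.
by rewrite le_eqVlt; apply/orP; left; apply/eqP; ring.
Qed.

Definition moment_const : nat -> R :=
  fix c q := if q is q'.+1
    then c q' + 2 ^+ Q * v0 * c q' ^+ 2 + K / z ^+ (Q * Q) * H ^+ Q else 0.

(** In each product of two lower order sums one factor [v] is bounded by [v0], so
    that the bound remains linear in [v]. *)
Lemma moment_sum_le q (A : idx) : (0 < #|A| <= q.+1)%N ->
  moment_sum A <= moment_const q * v * r ^+ #|A|.
Proof.
have /andP[z0 z1] := z01.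
have v00 : 0 <= v0 by apply: le_trans v_le.
have c0 m : 0 <= moment_const m.
  elim: m => [//|m IH] /=; rewrite !addr_ge0// ?mulr_ge0 ?exprn_ge0 ?invr_ge0 ?exprn_ge0 ?(ltW z0)//.
  exact: le_trans H_ge1.
have one (B : idx) : #|B| = 1%N -> moment_sum B = 0.
  move=> /eqP/cards1P[b ->]; apply: big1 => s _.
  rewrite (@eq_expect _ _ _ P _ (X (s b))) ?X0 ?normr0// => w.
  by rewrite /prodX big_set1.
elim: q A => [|q IH] A /andP[A0 Aq].
  by rewrite (one A) ?mul0r//; apply/eqP; rewrite eqn_leq Aq.
have [A1|A1] := leqP #|A| 1.
  by rewrite (one A) ?mulr_ge0 ?exprn_ge0//; apply/eqP; rewrite eqn_leq A1.
have [a0 a0A] : exists a0, a0 \in A by apply/set0Pn; rewrite -card_gt0.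
apply: (le_trans (moment_recursion a0A A1)).
rewrite [moment_const _.+1]/= !mulrDl; apply: lerD => //.
set c := moment_const q.
have cq0 : 0 <= c := c0 q.
rewrite -[leLHS]add0r; apply: lerD; first by rewrite !mulr_ge0 ?exprn_ge0.
apply: (@le_trans _ _ (\sum_(A1 : idx) v0 * c ^+ 2 * v * r ^+ #|A|)).
  rewrite [leLHS]big_mkcond; apply: ler_sum => A3 _.
  have nn : 0 <= v0 * c ^+ 2 * v * r ^+ #|A| by rewrite !mulr_ge0 ?exprn_ge0.
  case: ifPn => // /and3P[A3A A30 A40].
  have cardA : (#|A3| + #|A :\: A3|)%N = #|A|.
    by rewrite -(cardsID A3 A); move/finset.setIidPr: A3A => ->.
  rewrite -card_gt0 in A30; rewrite -card_gt0 in A40.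
  have h3 : moment_sum A3 <= c * v * r ^+ #|A3|.
    by apply: IH; rewrite A30 /= -ltnS (leq_trans _ Aq)// -cardA -addn1 leq_add2l.
  have h4 : moment_sum (A :\: A3) <= c * v * r ^+ #|A :\: A3|.
    by apply: IH; rewrite A40 /= -ltnS (leq_trans _ Aq)// -cardA -add1n leq_add2r.
  apply: (le_trans (ler_pM (moment_sum_ge0 _) (moment_sum_ge0 _) h3 h4)).
  rewrite -cardA exprD.
  have -> : c * v * r ^+ #|A3| * (c * v * r ^+ #|A :\: A3|) =
     c ^+ 2 * v * (r ^+ #|A3| * r ^+ #|A :\: A3|) * v by ring.
  have -> : v0 * c ^+ 2 * v * (r ^+ #|A3| * r ^+ #|A :\: A3|) =
     c ^+ 2 * v * (r ^+ #|A3| * r ^+ #|A :\: A3|) * v0 by ring.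
  by rewrite ler_wpM2l// !mulr_ge0 ?exprn_ge0.
rewrite sumr_const -cardsT -powersetT card_powerset cardsT card_ord.
by rewrite -[leLHS]mulr_natl natrX !mulrA.
Qed.

(** Expansion of the power over tuples. *)
Lemma moment_le : (1 < Q)%N ->
  'E (fun w => (\sum_t X t w) ^+ Q) <= moment_const Q.-1 * v * r ^+ Q.
Proof.
move=> Q1.
rewrite (@eq_expect _ _ _ P _ (fun w => \sum_(s : tup) prodX s [set: 'I_Q]%SET w)); last first.
  move=> w; rewrite -[Q in LHS]card_ord -prodr_const.
  rewrite (bigA_distr_bigA (fun _ t => X t w)); apply: eq_bigr => s _.
  by rewrite /prodX; apply: eq_bigl => i; rewrite inE.
rewrite E_sum; last by move=> s; exact: bprod.
apply: (@le_trans _ _ (moment_sum [set: 'I_Q]%SET)).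
  rewrite /moment_sum [leRHS]big_mkcond; apply: ler_sum => s _.
  rewrite ifT ?ler_norm//; apply/eqP/ffunP => i; by rewrite ffunE inE.
have := @moment_sum_le Q.-1 [set: 'I_Q]%SET.
have Q0 : (0 < Q)%N by exact: ltn_trans Q1.
by rewrite cardsT card_ord prednK// leqnn Q0; exact.
Qed.

End moments.

(** * Even moments of a mixing field *)

Section field_moments.
Context {R : realType} {d N : nat} {dT} {T : measurableType dT}
  (P : probability T R) (Z : 'cV[int]_N -> {RV P >-> 'cV[R]_d.+1}).
Local Notation S := ('cV[int]_N).
Notation "''E' X" := (expect P X) (at level 10, X at level 9).
Variables (c0 c1 : R) (f : 'cV[R]_d.+1 -> R).
Hypothesis c1_gt0 : 0 < c1.
Hypothesis SA : standing_assumptions Z c0 c1 f.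
Variables (X : S -> T -> R) (b v v0 D0 Cd Cb r : R) (L n Q : nat) (x : 'I_n -> S).
Hypothesis mX : forall s, field_meas Z [set s] (X s).
Hypothesis Xb : forall s w, `|X s w| <= b ^+ L.
Hypothesis X0 : forall s, 'E (X s) = 0.
Hypothesis XV : forall s, 'E (fun w => X s w ^+ 2) <= v ^+ 2.
Hypothesis XX : forall s t, s != t -> `|'E (fun w => X s w * X t w)| <= D0.
Hypothesis v_ge0 : 0 <= v.
Hypothesis v_le : v <= v0.
Hypothesis v0_ge1 : 1 <= v0.
Hypothesis b_ge1 : 1 <= b.
Hypothesis L_ge2 : (2 <= L)%N.
Hypothesis bD0 : (b ^+ L) ^+ 2 * D0 <= Cd.
Hypothesis D0_ge0 : 0 <= D0.
Hypothesis br : b ^+ L.+1 <= Cb * r.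
Hypothesis Cb_ge1 : 1 <= Cb.
Hypothesis r_ge0 : 0 <= r.

Let C0 : R := Num.max c0 1.

(** One summand for each of the three regimes of the next covariance bound:
    coinciding sites, two distinct sites, at least three factors. *)
Definition pair_const : R := v0 + (1 + 4 * C0 * Cd) + Cb ^+ Q * (16 * v0 ^+ 2 * C0).

Let bX s : bmf (X s).
Proof. by split; [exact: field_meas_measurable (@mX s)|exists (b ^+ L)]. Qed.

Let b_ge0 : 0 <= b. Proof. exact: le_trans b_ge1. Qed.

Let v0_ge0 : 0 <= v0. Proof. exact: le_trans v0_ge1. Qed.

Let C0_ge1 : 1 <= C0. Proof. by rewrite le_max lexx orbT. Qed.

Let C0_ge0 : 0 <= C0. Proof. exact: le_trans C0_ge1. Qed.

Let Cd_ge0 : 0 <= Cd.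
Proof. by apply: le_trans bD0; rewrite mulr_ge0// !exprn_ge0. Qed.

Let E_mul_le s t : 'E (fun w => `|X s w * X t w|) <= v ^+ 2.
Proof.
have b2 u : bmf (fun w => X u w ^+ 2) by exact: bmfX.
apply: (@le_trans _ _ ('E (fun w => 2^-1 * (X s w ^+ 2 + X t w ^+ 2)))).
  apply: E_le; [by apply: bmf_abs; exact: bmfM|by apply: bmfZ; exact: bmfD|move=> w].
  rewrite normrM [leRHS]mulrC ler_pdivlMr// -[X in _ <= X + _]real_normK ?num_real//.
  rewrite -[X in _ <= _ + X]real_normK ?num_real//.
  rewrite -subr_ge0 (_ : _ - _ = (`|X s w| - `|X t w|) ^+ 2) ?sqr_ge0//; ring.
rewrite EZ; last exact: bmfD.
rewrite ED// mulrC ler_pdivrMr// mulr_natr mulr2n; exact: lerD.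
Qed.

Let E_abs_le s : 'E (fun w => `|X s w|) <= v.
Proof.
apply: (le_trans (E_norm_sqrt P (bX s))).
by rewrite -[leRHS](ger0_norm v_ge0) -sqrtr_sqr ler_wsqrtr.
Qed.

Section pair.
Variables (I : finType) (y : I -> S) (A : {set I}) (a : I).
Hypothesis aA : a \in A.

Let prodA w := \prod_(i in A) X (y i) w.

Lemma prod_norm_le w : `|prodA w| <= (b ^+ L) ^+ #|A|.-1 * `|X (y a) w|.
Proof.
rewrite /prodA (bigD1 a)//= normrM mulrC ler_wpM2r// normr_prod.
have -> : (b ^+ L) ^+ #|A|.-1 = \prod_(i in A :\ a) b ^+ L.
  by rewrite prodr_const (cardsD1 a A) aA.
rewrite [leLHS](eq_bigl (mem (A :\ a))) => [|i]; last by rewrite !inE andbC.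
by apply: ler_prod => i _; rewrite normr_ge0 Xb.
Qed.

Lemma E_prod_norm_le : `|'E prodA| <= (b ^+ L) ^+ #|A|.-1 * v.
Proof.
have bP : bmf prodA by exact: bmf_prod.
apply: (le_trans (E_norm P bP)).
apply: (@le_trans _ _ ('E (fun w => (b ^+ L) ^+ #|A|.-1 * `|X (y a) w|))).
  apply: E_le; [exact: bmf_abs|by apply: bmfZ; exact: bmf_abs|exact: prod_norm_le].
rewrite EZ; last exact: bmf_abs.
by rewrite ler_wpM2l ?E_abs_le// !exprn_ge0.
Qed.

Lemma prod_bound w : `|prodA w| <= (b ^+ L) ^+ #|A|.
Proof.
rewrite /prodA normr_prod -prodr_const.
by apply: ler_prod => i _; rewrite normr_ge0 Xb.
Qed.

Lemma prod_field : field_meas Z [set y i | i in [set` A]] prodA.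
Proof.
apply: field_meas_prod => i iA; apply: field_meas_sub (@mX (y i)).
by move=> _ ->; exists i.
Qed.

End pair.

Local Notation be := (b ^+ L).

(** The covariance has two bounds: the variances (or the joint density) with no
    decay, and mixing with the sup norms of the summands, which are too large. A
    geometric mean of them keeps a fraction [1 / (2 L)] of the exponential decay and
    only a small power [b] of the sup norm [b ^+ L]. For two distinct sites the joint
    density bound [D0] compensates this power; for more factors the excess factors
    are bounded by [b ^+ L.+1 <= Cb * r] each, which leaves room for it. *)
Lemma prod_covariance_le (y : {ffun 'I_Q -> 'I_n}) (A1 A2 : {set 'I_Q}) (k : nat) :
  A1 != finset.set0 -> A2 != finset.set0 -> A1 :&: A2 = finset.set0 ->
  (forall i j, i \in A1 -> j \in A2 -> (k <= site_dist (x (y j)) (x (y i)))%N) ->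
  `|'E (fun w => (\prod_(i in A1) X (x (y i)) w) * (\prod_(i in A2) X (x (y i)) w)) -
    'E (fun w => \prod_(i in A1) X (x (y i)) w) *
    'E (fun w => \prod_(i in A2) X (x (y i)) w)| <=
  pair_const * v * r ^+ (#|A1| + #|A2| - 2) * expR (- c1 / (2 * L%:R)) ^+ k.
Proof.
move=> /set0Pn[a1 a1A] /set0Pn[a2 a2A] A12 kd.
set U1 := fun w => \prod_(i in A1) _; set U2 := fun w => \prod_(i in A2) _.
set e := expR _; have e0 : 0 <= e by exact: expR_ge0.
have e2L : (e ^+ k) ^+ (2 * L) = expR (- c1 * k%:R).
  rewrite -exprM -expRM_natl; congr expR; rewrite natrM natrM.
  by field; rewrite pnatr_eq0; case: (L) L_ge2.
have e1 : e ^+ k <= 1.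
  apply: exprn_ile1 => //; rewrite -[leRHS]expR0 ler_expR.
  by rewrite mulNr oppr_le0 divr_ge0// ?ltW// mulr_ge0.
have be0 : 0 <= be by rewrite exprn_ge0.
have be_gt0 : 0 < be by rewrite exprn_gt0// (lt_le_trans ltr01).
have A1c : (0 < #|A1|)%N by rewrite card_gt0; apply/set0Pn; exists a1.
have A2c : (0 < #|A2|)%N by rewrite card_gt0; apply/set0Pn; exists a2.
have mixb : `|'E (fun w => U1 w * U2 w) - 'E U1 * 'E U2| <=
    4 * mix_rate c0 c1 k * be ^+ #|A1| * be ^+ #|A2|.
  apply: (field_covariance_le SA (I := [set (fun i => x (y i)) i | i in [set` A1]])
     (J := [set (fun i => x (y i)) i | i in [set` A2]])).
  - by move=> _ _ [i /= iA <-] [j /= jA <-]; rewrite site_distC kd.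
  - exact: prod_field.
  - exact: prod_field.
  - exact: exprn_gt0.
  - exact: exprn_gt0.
  - by move=> w; exact: (prod_bound (fun i => x (y i)) A1).
  - by move=> w; exact: (prod_bound (fun i => x (y i)) A2).
pose cv := `|'E (fun w => U1 w * U2 w) - 'E U1 * 'E U2|; rewrite -[leLHS]/cv -/cv in mixb *.
have cv0 : 0 <= cv by exact: normr_ge0.
have K1 : v0 <= pair_const.
  rewrite /pair_const -addrA lerDl addr_ge0 ?mulr_ge0 ?exprn_ge0 ?(le_trans ler01 Cb_ge1)//.
  by rewrite addr_ge0// !mulr_ge0.
have K2 : 1 + 4 * C0 * Cd <= pair_const.
  rewrite /pair_const [v0 + _]addrC -addrA lerDl addr_ge0// ?mulr_ge0 ?exprn_ge0 ?(le_trans ler01 Cb_ge1)//.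
have K3 : Cb ^+ Q * (16 * v0 ^+ 2 * C0) <= pair_const.
  by rewrite /pair_const lerDr addr_ge0// addr_ge0// !mulr_ge0.
have [q2|q3] := leqP (#|A1| + #|A2|) 2.
  have /eqP/cards1P[a1' eA1] : #|A1| = 1%N.
    by apply/eqP; rewrite eqn_leq A1c andbT -(leq_add2r #|A2|) (leq_trans q2)// addnC addn1 ltnS.
  have /eqP/cards1P[a2' eA2] : #|A2| = 1%N.
    by apply/eqP; rewrite eqn_leq A2c andbT -(leq_add2l #|A1|) (leq_trans q2)// addn1 ltnS.
  move: a1A; rewrite eA1 finset.in_set1 => /eqP a1E; move: a2A; rewrite eA2 finset.in_set1 => /eqP a2E.
  pose s := x (y a1); pose t := x (y a2).
  have cvE : cv = `|'E (fun w => X s w * X t w)|.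
    rewrite /cv (_ : 'E U1 = 0) ?mul0r ?subr0; last first.
      rewrite -(X0 s); apply: eq_expect => w.
      by rewrite /U1 eA1 big_set1 /s a1E.
    congr `|_|; apply: eq_expect => w.
    by rewrite /U1 /U2 eA1 eA2 !big_set1 /s /t a1E a2E.
  have cvv : cv <= v ^+ 2.
    by rewrite cvE (le_trans (E_norm P (bmfM (bX s) (bX t))))// E_mul_le.
  rewrite !cards1 subnn expr0 mulr1.
  have [st|st] := eqVneq s t.
    have k0 : k = 0%N.
      apply/eqP; rewrite -leqn0 (leq_trans (kd a1 a2 _ _))// ?eA1 ?eA2 ?finset.in_set1 ?a1E ?a2E//.
      by move: st; rewrite /s /t a1E a2E => ->; rewrite site_dist_xx.
    rewrite k0 expr0 mulr1 (le_trans cvv)// expr2 ler_wpM2r//.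
    exact: le_trans K1.
  have cvD : cv <= D0 by rewrite cvE XX.
  apply: (@le_trans _ _ ((1 + 4 * C0 * Cd) * v * e ^+ k)); last first.
    by rewrite ler_wpM2r ?exprn_ge0// ler_wpM2r.
  have K20 : 0 <= 4 * C0 * Cd by rewrite !mulr_ge0.
  (* Fourth power: two factors [cv] are bounded by the variance, one by mixing and one by the
     joint density. *)
  rewrite -(@ler_pXn2r _ 4)// ?nnegrE; last first.
    by rewrite mulr_ge0 ?exprn_ge0// mulr_ge0// addr_ge0.
  apply: (@le_trans _ _ ((v ^+ 2 * v ^+ 2) * ((4 * mix_rate c0 c1 k * be ^+ 2) * D0))).
    rewrite (_ : cv ^+ 4 = (cv * cv) * (cv * cv)); last by ring.
    apply: ler_pM; rewrite ?mulr_ge0//; apply: ler_pM => //.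
    by apply: (le_trans mixb); rewrite eA1 eA2 !cards1 !expr1 expr2 mulrA.
  rewrite !exprMn -exprD mulrA (_ : 2 + 2 = 4)%N//.
  have -> : v ^+ 4 * (4 * mix_rate c0 c1 k * be ^+ 2) * D0 =
     v ^+ 4 * ((4 * mix_rate c0 c1 k) * (be ^+ 2 * D0)) by ring.
  have -> : (1 + 4 * C0 * Cd) ^+ 4 * v ^+ 4 * e ^+ k ^+ 4 =
     v ^+ 4 * ((1 + 4 * C0 * Cd) ^+ 4 * e ^+ k ^+ 4) by ring.
  rewrite ler_wpM2l ?exprn_ge0//.
  apply: (@le_trans _ _ ((4 * mix_rate c0 c1 k) * Cd)).
    by rewrite ler_wpM2l// mulr_ge0// mix_rate_ge0.
  rewrite /mix_rate -/C0 -e2L.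
  rewrite (_ : _ * Cd = (4 * C0 * Cd) * e ^+ k ^+ (2 * L)); last by ring.
  apply: ler_pM; rewrite ?exprn_ge0//.
    apply: (@le_trans _ _ (1 + 4 * C0 * Cd)); first by rewrite lerDr.
    by apply: ler_eXnr => //; rewrite lerDl.
  apply: ler_wiXn2l; rewrite ?exprn_ge0//.
  by rewrite -[4%N]/(2 * 2)%N leq_mul2l.
pose q := (#|A1| + #|A2| - 2)%N; rewrite -/q.
have q_gt0 : (0 < q)%N by rewrite subn_gt0.
have qQ : (q <= Q)%N.
  rewrite (leq_trans (leq_subr _ _))//.
  have := cardsUI A1 A2; rewrite A12 cards0 addn0 => <-.
  by rewrite -[leqRHS]card_ord max_card.
have qE : (#|A1| + #|A2| = q + 2)%N by rewrite subnK// ltnW.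
have cv1 : cv <= be ^+ q * (4 * mix_rate c0 c1 k * be ^+ 2).
  by apply: (le_trans mixb); rewrite -mulrA -exprD qE exprD mulrCA mulrA.
have qE' : (#|A1|.-1 + #|A2|.-1 = q)%N.
  by rewrite /q -{2}(prednK A1c) -{2}(prednK A2c) addSn addnS subSS subSS subn0.
have bU1 : bmf U1 by exact: bmf_prod.
have bU2 : bmf U2 by exact: bmf_prod.
have cv2 : cv <= be ^+ q * (2 * v ^+ 2).
  apply: (le_trans (ler_normB _ _)); rewrite normrM.
  have h1 : `|'E U1| * `|'E U2| <= be ^+ q * v ^+ 2.
    rewrite -qE' exprD (_ : _ * v ^+ 2 = (be ^+ #|A1|.-1 * v) * (be ^+ #|A2|.-1 * v)); last by ring.
    by apply: ler_pM => //; [exact: (E_prod_norm_le _ a1A)|exact: (E_prod_norm_le _ a2A)].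
  have h2 : `|'E (fun w => U1 w * U2 w)| <= be ^+ q * v ^+ 2.
    apply: (le_trans (E_norm P (bmfM bU1 bU2))).
    apply: (@le_trans _ _ ('E (fun w => be ^+ q * `|X (x (y a1)) w * X (x (y a2)) w|))).
      apply: E_le; [by apply: bmf_abs; exact: bmfM|by apply: bmfZ; apply: bmf_abs; exact: bmfM|move=> w].
      rewrite -qE' exprD !normrM mulrACA.
      apply: ler_pM => //; [exact: (prod_norm_le (fun i => x (y i)) a1A)|exact: (prod_norm_le (fun i => x (y i)) a2A)].
    rewrite EZ; last by apply: bmf_abs; exact: bmfM.
    by rewrite ler_wpM2l ?exprn_ge0.
  apply: (le_trans (lerD h2 h1)).
  by rewrite le_eqVlt; apply/orP; left; apply/eqP; ring.
have beq : 0 < be ^+ q by rewrite exprn_gt0.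
have [t [tE t0 t1 t2]] : exists t : R, [/\ cv = be ^+ q * t, 0 <= t,
    t <= 4 * mix_rate c0 c1 k * be ^+ 2 & t <= 2 * v ^+ 2].
  exists (cv / be ^+ q); split.
  - by rewrite mulrC divfK// gt_eqF.
  - by rewrite divr_ge0// ltW.
  - by rewrite ler_pdivrMr// mulrC.
  - by rewrite ler_pdivrMr// mulrC.
have v2 : v ^+ 2 <= v0 ^+ 2 by rewrite ler_pXn2r.
pose C3 := 16 * v0 ^+ 2 * C0.
have v02 : 1 <= v0 ^+ 2 by rewrite exprn_ege1.
have C3_ge1 : 1 <= C3.
  rewrite /C3; have : 1 <= v0 ^+ 2 * C0 by rewrite -[leLHS]mulr1 ler_pM.
  by rewrite -mulrA; move: (v0 ^+ 2 * C0) => u; lra.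
have C3_ge0 : 0 <= C3 by apply: le_trans C3_ge1.
(* Power [2 L]: all factors but one are bounded by the variances, the last one by mixing. *)
have tle : t <= C3 * v * b * e ^+ k.
  have L0 : (0 < 2 * L)%N by rewrite muln_gt0 (ltn_trans _ L_ge2).
  rewrite -(@ler_pXn2r _ (2 * L))// ?nnegrE ?mulr_ge0 ?exprn_ge0//.
  have -> : (C3 * v * b * e ^+ k) ^+ (2 * L) =
      (v ^+ 2) ^+ L * (C3 ^+ L * C3 ^+ L) * (be ^+ 2 * expR (- c1 * k%:R)).
    have -> : C3 ^+ L * C3 ^+ L = C3 ^+ (2 * L) by rewrite -exprD addnn mul2n.
    have -> : (v ^+ 2) ^+ L = v ^+ (2 * L) by rewrite exprM.
    have -> : be ^+ 2 = b ^+ (2 * L) by rewrite mulnC exprM.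
    by rewrite -e2L 3!exprMn (mulrC (C3 ^+ _) (v ^+ _)) !mulrA.
  have -> : t ^+ (2 * L) = t ^+ L * (t ^+ L.-1 * t).
    by rewrite -exprSr prednK ?(ltn_trans _ L_ge2)// -exprD addnn mul2n.
  apply: (@le_trans _ _ ((2 * v ^+ 2) ^+ L * ((2 * v0 ^+ 2) ^+ L.-1 * (4 * mix_rate c0 c1 k * be ^+ 2)))).
    apply: ler_pM; rewrite ?mulr_ge0 ?exprn_ge0//.
      by apply: lerXn2r; rewrite ?nnegrE// mulr_ge0// exprn_ge0.
    apply: ler_pM; rewrite ?exprn_ge0//.
    apply: lerXn2r; rewrite ?nnegrE//; first by rewrite mulr_ge0// exprn_ge0.
    by apply: (le_trans t2); rewrite ler_wpM2l.
  rewrite /mix_rate -/C0.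
  have -> : (2 * v ^+ 2) ^+ L * ((2 * v0 ^+ 2) ^+ L.-1 * (4 * (C0 * expR (- c1 * k%:R)) * be ^+ 2)) =
    (v ^+ 2) ^+ L * (2 ^+ L * ((2 * v0 ^+ 2) ^+ L.-1 * (4 * C0))) * (be ^+ 2 * expR (- c1 * k%:R)).
    rewrite exprMn; move: (v ^+ 2 ^+ L) (2 ^+ L) ((2 * v0 ^+ 2) ^+ L.-1) (be ^+ 2) (expR _) => *; ring.
  rewrite ler_wpM2r ?mulr_ge0 ?exprn_ge0 ?expR_ge0// ler_wpM2l ?exprn_ge0//.
  rewrite -[leLHS]mulr1; apply: ler_pM => //.
  - by rewrite !mulr_ge0 ?exprn_ge0// mulr_ge0// exprn_ge0.
  - rewrite /C3 (_ : 16 * v0 ^+ 2 * C0 = 2 * ((2 * v0 ^+ 2) * (4 * C0))); last by ring.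
    rewrite [leRHS]exprMn ler_wpM2l ?exprn_ge0// [leRHS]exprMn.
    have h2v : 1 <= 2 * v0 ^+ 2 by move: (v0 ^+ 2) v02 => u; lra.
    have h4C : 1 <= 4 * C0 by move: C0 C0_ge1 => u; lra.
    apply: ler_pM; rewrite ?exprn_ge0 ?mulr_ge0 ?exprn_ge0//.
      by apply: ler_weXn2l => //; exact: leq_pred.
    by apply: ler_eXnr => //; rewrite (ltn_trans _ L_ge2).
  - by rewrite exprn_ege1.
rewrite tE; apply: (le_trans (ler_wpM2l (ltW beq) tle)).
have bq : b <= b ^+ q by apply: ler_eXnr.
have -> : be ^+ q * (C3 * v * b * e ^+ k) = C3 * v * e ^+ k * (be ^+ q * b) by ring.
apply: (@le_trans _ _ (C3 * v * e ^+ k * (Cb ^+ Q * r ^+ q))).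
  rewrite ler_wpM2l ?mulr_ge0 ?exprn_ge0//.
  apply: (@le_trans _ _ (be ^+ q * b ^+ q)); first by rewrite ler_wpM2l// ltW.
  rewrite -exprMn -exprSr; apply: (@le_trans _ _ ((Cb * r) ^+ q)).
    by apply: lerXn2r; rewrite ?nnegrE ?exprn_ge0// mulr_ge0// (le_trans ler01).
  rewrite exprMn ler_wpM2r ?exprn_ge0//.
  exact: ler_weXn2l.
have -> : C3 * v * e ^+ k * (Cb ^+ Q * r ^+ q) = (Cb ^+ Q * C3) * v * r ^+ q * e ^+ k by ring.
by rewrite !ler_wpM2r ?exprn_ge0.
Qed.

End field_moments.

(** Moment bound of the order of an independent sum, but linear in the standard
    deviation [v] of the summands. This linearity is what makes the sum over all
    translates of a wavelet finite. *)
Lemma field_moment_le (R : realType) (N : nat) (c0 c1 v0 Cd Cb : R) (L Q : nat) :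
  (0 < N)%N -> 0 < c1 -> 1 <= v0 -> 0 <= Cd -> 1 <= Cb -> (2 <= L)%N -> (1 < Q)%N ->
  exists2 C : R, 0 <= C & forall (d : nat) (dT : measure_display)
    (T : measurableType dT) (P : probability T R)
    (Z : 'cV[int]_N -> {RV P >-> 'cV[R]_d.+1}) (f : 'cV[R]_d.+1 -> R)
    (X : 'cV[int]_N -> T -> R) (b v D0 r : R) (n : nat) (x : 'I_n -> 'cV[int]_N),
    standing_assumptions Z c0 c1 f ->
    (forall s, field_meas Z [set s] (X s)) -> (forall s w, `|X s w| <= b ^+ L) ->
    (forall s, expect P (X s) = 0) ->
    (forall s, expect P (fun w => X s w ^+ 2) <= v ^+ 2) ->
    (forall s t, s != t -> `|expect P (fun w => X s w * X t w)| <= D0) ->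
    0 <= v -> v <= v0 -> 1 <= b -> (b ^+ L) ^+ 2 * D0 <= Cd -> 0 <= D0 ->
    b ^+ L.+1 <= Cb * r -> 0 <= r -> r ^+ 2 = n%:R -> (0 < n)%N -> injective x ->
    expect P (fun w => (\sum_t X (x t) w) ^+ Q) <= C * v * r ^+ Q.
Proof.
move=> N0 c10 v01 Cd0 Cb1 L2 Q1.
have Q0 : (0 < Q)%N by exact: ltn_trans Q1.
have L0 : (0 < L)%N by exact: ltn_trans L2.
(* [z ^ (Q * Q)] with [z = ze ^ N] must be the decay rate left after interpolation. *)
pose ze : R := expR (- c1 / (2 * L%:R * (N * (Q * Q))%:R)).
have ze01 : 0 < ze < 1.
  rewrite expR_gt0/= -[X in _ < X]expR0 ltr_expR mulNr oppr_lt0.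
  by rewrite divr_gt0// mulr_gt0 ?ltr0n ?muln_gt0 ?N0 ?Q0// mulr_gt0// ltr0n.
have /andP[ze0 ze1] := ze01.
pose z := ze ^+ N.
have z01 : 0 < z < 1 by rewrite exprn_gt0//= exprn_ilt1 ?ltW// -lt0n.
have zQ k : z ^+ (Q * Q * k) = expR (- c1 / (2 * L%:R)) ^+ k.
  rewrite /z -exprM -!expRM_natl; congr expR.
  rewrite !natrM; field.
  by rewrite !pnatr_eq0 -!lt0n N0 Q0 L0.
pose H : R := (2 / (1 - ze)) ^+ N.
have H1 : 1 <= H.
  apply: exprn_ege1; rewrite ler_pdivlMr ?subr_gt0//; lra.
pose K := pair_const c0 v0 Cd Cb Q.
have K0 : 0 <= K.
  have C00 : 0 <= Num.max c0 1 by rewrite le_max ler01 orbT.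
  have v00 : 0 <= v0 by apply: le_trans v01.
  rewrite /K /pair_const addr_ge0//; last first.
    by rewrite mulr_ge0 ?exprn_ge0 ?(le_trans ler01 Cb1)// mulr_ge0// mulr_ge0// exprn_ge0.
  by rewrite addr_ge0// addr_ge0// mulr_ge0// mulr_ge0.
exists (Num.max 0 (moment_const Q K v0 z H Q.-1)); first by rewrite le_max lexx.
move=> d dT T P Z f X b v D0 r n x SA mX Xb X0 XV XX v_ge0 v_le b1 bD0 D00 br r0 rn n0 xi.
have bX t : bmf (X (x t)).
  by split; [exact: field_meas_measurable (@mX (x t))|exists (b ^+ L)].
have dsum u : \sum_t z ^+ site_dist (x t) (x u) <= H.
  rewrite (eq_bigr (fun t => ze ^+ (N * site_dist (x t) (x u)))); last first.
    by move=> t _; rewrite exprM.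
  exact: site_exp_sum_le.
have covh (s : {ffun 'I_Q -> 'I_n}) (A1 A2 : {set 'I_Q}) (k : nat) :
  A1 != finset.set0 -> A2 != finset.set0 -> A1 :&: A2 = finset.set0 ->
  (forall i j, i \in A1 -> j \in A2 -> (k <= site_dist (x (s j)) (x (s i)))%N) ->
  `|expect P (fun w => prodX (fun t => X (x t)) s A1 w * prodX (fun t => X (x t)) s A2 w) -
     expect P (prodX (fun t => X (x t)) s A1) * expect P (prodX (fun t => X (x t)) s A2)| <=
  K * v * r ^+ (#|A1| + #|A2| - 2) * z ^+ (Q * Q * k).
  move=> h1 h2 h3 h4; rewrite zQ.
  exact: (prod_covariance_le c10 SA mX Xb X0 XV XX v_ge0 v_le v01 b1 L2 bD0 D00 br Cb1 r0).
have := moment_le (Ordinal n0) bX (fun t => X0 (x t)) K0 v_ge0 v_le rn r0 z01 H1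
  (fun a b c => site_dist_triangle (x a) (x b) (x c)) dsum (fun u => site_dist_xx (x u)) covh Q1.
move=> h; apply: (le_trans h).
by rewrite ler_wpM2r ?exprn_ge0// ler_wpM2r// le_max lexx orbT.
Qed.

(** * Radial envelopes *)

Section radial.
Context {R : realType} {d : nat}.
Local Notation Rd := ('cV[R]_d.+1).

Lemma norm2_le (x y : Rd) : (norm2 y <= norm2 x) = (\sum_i y i 0 ^+ 2 <= \sum_i x i 0 ^+ 2).
Proof. by rewrite /norm2 ler_sqrt// sumr_ge0// => i _; exact: sqr_ge0. Qed.

(** A radial non-increasing function is a monotone function of the squared norm. *)
Lemma measurable_radial (h : Rd -> R) :
  (forall x y, norm2 y <= norm2 x -> h x <= h y) -> measurable_fun [set: Rd] h.
Proof.
move=> hr.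
(* A measurable curve meeting every sphere. *)
pose ray (t : R) : Rd := \col_i (if i == ord0 then Num.sqrt (Num.max t 0) else 0).
have rayE t : \sum_i ray t i 0 ^+ 2 = Num.max t 0.
  rewrite (bigD1 ord0)//= mxE eqxx sqr_sqrtr ?le_max ?lexx ?orbT//.
  by rewrite big1 ?addr0// => i /negbTE i0; rewrite mxE i0 expr0n.
pose H t := h (ray t).
have mH : measurable_fun [set: R] (fun t => - H t).
  apply: nondecreasing_measurable => // s t st.
  rewrite lerN2; apply: hr; rewrite norm2_le !rayE ge_max !le_max st lexx !orbT//.
have -> : h = (fun t => - - H t) \o (fun x : Rd => \sum_i x i 0 ^+ 2).
  apply/funext => x /=; rewrite opprK.
  have e : \sum_i ray (\sum_i x i 0 ^+ 2) i 0 ^+ 2 = \sum_i x i 0 ^+ 2.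
    by rewrite rayE max_l// sumr_ge0// => i _; exact: sqr_ge0.
  by apply/eqP; rewrite eq_le; apply/andP; split; apply: hr; rewrite norm2_le e.
apply: (@measurableT_comp _ _ _ _ _ _ (fun t : R => - - H t)).
  exact: measurable_funN mH.
apply: measurable_sum => i; apply: measurable_funX; exact: measurable_coord.
Qed.

End radial.

Section envelope.
Context {R : realType} {d : nat}.
Local Notation Rd := ('cV[R]_d.+1).
Local Notation Zd := ('cV[int]_d.+1).
Variables (M : 'M[R]_d.+1) (dM : dilation_matrix M).
Variables (Psi : nat -> Rd -> R) (L : nat) (B : R) (a : nat -> Zd -> R).
Variables (F : {fset Zd}) (mz : Zd -> Zd).
Hypothesis fr : finite_refinement M Psi L B a F mz.
Local Notation Phi := (Psi 0%N).
Local Notation b := (absdet M).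
Variables (h : Rd -> R) (Bh : R).
Hypothesis h_ge0 : forall x, 0 <= h x.
Hypothesis h_le : forall x, h x <= Bh.
Hypothesis h_radial : forall x y, norm2 y <= norm2 x -> h x <= h y.
Hypothesis h_int : (\int[leb d.+1]_x (Num.sqrt (h x))%:E < +oo)%E.

(** Bound for the second moment of the wavelet coefficient of one observation. *)
Definition env_moment (j : nat) (g : Zd) : R :=
  \int[leb d.+1]_x (h x * dilate M Phi j%:Z g x ^+ 2).

Let mh : measurable_fun [set: Rd] h := measurable_radial h_radial.

Let Bh_ge0 : 0 <= Bh. Proof. exact: le_trans (h_le 0). Qed.

Let bcs_sqr j g : bcs (fun x => dilate M Phi j%:Z g x ^+ 2).
Proof.
have [m0 [c cb] [e eb]] := bcs_wavelet dM fr j g (ndet_gt0 dM).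
split; first exact: measurable_funX.
  by exists (c ^+ 2) => x; rewrite normrX ler_pXn2r// nnegrE// (le_trans (normr_ge0 _) (cb x)).
by exists e => x; rewrite sqrf_eq0; exact: eb.
Qed.

Let bcs_hsqr j g : bcs (fun x => h x * dilate M Phi j%:Z g x ^+ 2).
Proof.
by apply: bcs_mul => //; exists Bh => x; rewrite ger0_norm.
Qed.

Lemma integral_dilate_sqr j g : \int[leb d.+1]_x (dilate M Phi j%:Z g x ^+ 2) = 1.
Proof.
have := orthonormal_level dM fr j g g; rewrite eqxx mulr1n => <-.
by apply: eq_Rintegral => x _; rewrite expr2.
Qed.

Lemma env_moment_le_cst j g c : (forall y, dilate M Phi j%:Z g y != 0 -> h y <= c) ->
  env_moment j g <= c.
Proof.
move=> hc; rewrite -[leRHS]mulr1 -(integral_dilate_sqr j g).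
rewrite -RintegralZl//; last exact: bcs_integrable (bcs_sqr j g).
apply: le_Rintegral => //.
- exact: bcs_integrable (bcs_hsqr j g).
- apply: bcs_integrable; apply: (bcs_mul (v := cst c)) (bcs_sqr j g) => //.
  by exists `|c|.
- move=> y _; have [->|y0] := eqVneq (dilate M Phi j%:Z g y) 0.
    by rewrite expr0n !mulr0.
  by rewrite ler_wpM2r ?sqr_ge0// hc.
Qed.

Lemma env_moment_ge0 j g : 0 <= env_moment j g.
Proof. by apply: Rintegral_ge0 => x _; rewrite mulr_ge0// sqr_ge0. Qed.

Lemma env_moment_le j g : env_moment j g <= Bh.
Proof. exact: env_moment_le_cst. Qed.

Definition unit_cell (x : Rd) : R := \1_[set x : Rd | forall i, 0 <= x i 0 <= 1] x.

Lemma unit_cell_supp : supp_cube 1 unit_cell.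
Proof.
move=> x; rewrite /unit_cell indicE; case: (boolP (x \in _)) => [|_]; last by rewrite eqxx.
by rewrite inE /= => hx _ i.
Qed.

Lemma measurable_unit_cell : measurable_fun [set: Rd] unit_cell.
Proof. by apply: measurable_indic; exact: measurable_cube. Qed.

Lemma unit_cell_sum_le (y : Rd) (s : seq Zd) : uniq s ->
  \sum_(g <- s) unit_cell (y - zvec g) <= @overlap R d 1.
Proof.
move=> us; pose c := codom (@lat _ _ 1 y).
apply: (@le_trans _ _ (\sum_(g <- s | g \in c) 1)).
  rewrite [leRHS]big_mkcond; apply: ler_sum => g _.
  have [->|h1] := eqVneq (unit_cell (y - zvec g)) 0; first by case: ifP.
  have [e ->] := lat_cover unit_cell_supp h1.
  by rewrite codom_f /unit_cell indicE; case: (_ \in _).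
rewrite -big_filter (_ : \sum_(g <- _) 1 = (size [seq g <- s | g \in c])%:R); last first.
  by rewrite -sum1_size natr_sum.
rewrite ler_nat (leq_trans (uniq_leq_size (filter_uniq _ us) (s2 := c) _))//.
  by move=> g; rewrite mem_filter => /andP[].
by rewrite size_codom.
Qed.

Variables (Lam : R) (Lam_ge1 : 1 <= Lam).
Hypothesis Lam_expand : forall j (x : Rd) (b : R), (forall i, `|(M ^+ j *m x) i 0| <= b) ->
    forall i, `|x i 0| <= Lam * b.

Let rad : R := Lam * L.+1%:R.

Let rad_ge0 : 0 <= rad. Proof. by rewrite mulr_ge0// (le_trans ler01). Qed.

Let crad_ge0 : 0 <= 2 * d.+1%:R * rad.
Proof. by apply: mulr_ge0 => //; exact: mulr_ge0. Qed.

Definition env_cube : set Rd :=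
  [set x | forall i, - (2 * d.+1%:R * rad) <= x i 0 <= 2 * d.+1%:R * rad].

(** Dominates [sqrt h] on the support of the wavelet attached to the cell of [x]:
    the support is within distance [rad] of [x], so near the origin the bound
    [sqrt Bh] is used, and far away [|y| >= |x| / 2] and [h] is radial. *)
Definition env_majorant (x : Rd) : R :=
  Num.sqrt Bh * \1_env_cube x + Num.sqrt (h (2^-1 *: x)).

Lemma env_majorant_ge0 x : 0 <= env_majorant x.
Proof. by rewrite addr_ge0 ?mulr_ge0 ?sqrtr_ge0// indicE ler0n. Qed.

(** Outside of the cube [|x - y| <= |x| / 2]. *)
Let half_norm2 (x y : Rd) : (forall i, `|(x - y) i 0| <= rad) -> ~ env_cube x ->
  norm2 (2^-1 *: x) <= norm2 y.
Proof.
move=> xy nx.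
have [i xi] : exists i, 2 * d.+1%:R * rad < `|x i 0|.
  apply: contrapT => /forallNP h0; apply: nx => i.
  by have := h0 i; rewrite -ler_norml leNgt => /negP.
rewrite norm2_le; pose sq (u : Rd) := \sum_i u i 0 ^+ 2.
have -> : \sum_i (2^-1 *: x) i 0 ^+ 2 = 4^-1 * sq x.
  rewrite /sq mulr_sumr; apply: eq_bigr => k _; rewrite mxE exprMn; congr (_ * _).
  by field.
have D1 : 1 <= d.+1%:R :> R by rewrite ler1n.
have sq1 : 4 * (d.+1%:R * rad ^+ 2) <= sq x.
  rewrite /sq (bigD1 i)//= -[leLHS]addr0 lerD//; last first.
    by apply: sumr_ge0 => k _; exact: sqr_ge0.
  rewrite -[leRHS]real_normK ?num_real//.
  apply: (@le_trans _ _ ((2 * d.+1%:R * rad) ^+ 2)).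
    have -> : (2 * d.+1%:R * rad) ^+ 2 = 4 * (d.+1%:R ^+ 2 * rad ^+ 2).
      by move: rad (d.+1%:R : R) => u v; ring.
    by rewrite ler_wpM2l// ler_wpM2r ?sqr_ge0// expr2 ler_peMr.
  by rewrite ler_pXn2r// ?nnegrE// ltW.
have sq2 : sq x <= 2 * sq y + 2 * (d.+1%:R * rad ^+ 2).
  have -> : d.+1%:R * rad ^+ 2 = \sum_(i < d.+1) rad ^+ 2.
    by rewrite sumr_const card_ord mulr_natl.
  rewrite /sq !mulr_sumr -big_split/=; apply: ler_sum => k _.
  have := xy k; rewrite !mxE => xyk.
  have : (x k 0 - y k 0) ^+ 2 <= rad ^+ 2.
    by rewrite -[leLHS]real_normK ?num_real// ler_pXn2r// nnegrE.
  move: (x k 0) (y k 0) => u v uv.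
  have := sqr_ge0 (u - 2 * v) => uv2.
  have -> : u ^+ 2 = 2 * v ^+ 2 + 2 * (u - v) ^+ 2 - (u - 2 * v) ^+ 2 by ring.
  by move: (v ^+ 2) ((u - v) ^+ 2) ((u - 2 * v) ^+ 2) (rad ^+ 2) uv uv2 => *; lra.
rewrite -/(sq y); move: (sq x) (sq y) (d.+1%:R * rad ^+ 2) sq1 sq2 => *; lra.
Qed.

Lemma env_majorant_sqr j g x y : unit_cell (M ^+ j *m x - zvec g) != 0 ->
  dilate M Phi j%:Z g y != 0 -> h y <= env_majorant x ^+ 2.
Proof.
move=> /unit_cell_supp hx /(supp_dilate (fr_supp fr (ndet_gt0 dM))) hy.
have xy i : `|(x - y) i 0| <= rad.
  apply: (Lam_expand (j := j)) => k.
  have := hx k; have := hy k; rewrite mulmxBr !mxE -natr1.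
  move: (\sum_ _ _) (\sum_ _ _) (_%:~R) => u v w /andP[h1 h2] /andP[h3 h4].
  have L0 : 0 <= L%:R :> R by [].
  by rewrite ler_norml; apply/andP; split; lra.
have s0 := sqrtr_ge0 Bh; have s1 := sqrtr_ge0 (h (2^-1 *: x)).
rewrite /env_majorant indicE; case: (boolP (x \in env_cube)) => [xc|].
  rewrite mulr1 sqrrD sqr_sqrtr// -addrA (le_trans (h_le y))// lerDl.
  by rewrite addr_ge0 ?sqr_ge0// mulrn_wge0// mulr_ge0.
rewrite notin_setE => xc; rewrite mulr0 add0r sqr_sqrtr//.
by apply: h_radial; exact: half_norm2.
Qed.

Let sqrt_env_le j g x : unit_cell (M ^+ j *m x - zvec g) != 0 ->
  Num.sqrt (env_moment j g) <= env_majorant x.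
Proof.
move=> xg; rewrite -[leRHS](ger0_norm (env_majorant_ge0 x)) -sqrtr_sqr ler_wsqrtr//.
by apply: env_moment_le_cst => y; exact: env_majorant_sqr.
Qed.

Lemma measurable_env_majorant : measurable_fun [set: Rd] env_majorant.
Proof.
apply: measurable_funD.
  apply: measurable_funM => //; apply: measurable_indic; exact: measurable_cube.
apply: measurable_radial => x y xy; rewrite ler_wsqrtr//; apply: h_radial.
move: xy; rewrite !norm2_le => xy.
have e (u : Rd) : \sum_i (2^-1 *: u) i 0 ^+ 2 = 4^-1 * \sum_i u i 0 ^+ 2.
  rewrite mulr_sumr; apply: eq_bigr => k _; rewrite mxE exprMn; congr (_ * _).
  by field.
by rewrite !e ler_wpM2l.
Qed.

Lemma integral_env_majorant :
  exists2 C : R, 0 <= C & (\int[leb d.+1]_x (env_majorant x)%:E <= C%:E)%E.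
Proof.
pose I := (\int[leb d.+1]_x (env_majorant x)%:E)%E.
suff Ioo : (I < +oo)%E.
  have I0 : (0 <= I)%E by apply: integral_ge0 => x _; rewrite lee_fin env_majorant_ge0.
  by exists (fine I); [exact: fine_ge0|rewrite fineK// ge0_fin_numE].
have m1 : measurable_fun [set: Rd] (fun x => (Num.sqrt Bh * \1_env_cube x)%:E).
  apply/measurable_EFinP; apply: measurable_funM => //.
  by apply: measurable_indic; exact: measurable_cube.
have msq : measurable_fun [set: Rd] (fun x => (Num.sqrt (h x))%:E).
  apply/measurable_EFinP; apply: measurable_radial => x y xy.
  by rewrite ler_wsqrtr// h_radial.
have Eh (x : Rd) : 2^-1 *: x = (2^-1)%:M *m x + 0 by rewrite mul_scalar_mx addr0.
have uh : (2^-1)%:M \in @unitmx R d.+1.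
  by rewrite unitmxE det_scalar unitfE expf_neq0// invr_neq0.
have m2 : measurable_fun [set: Rd] (fun x => (Num.sqrt (h ((2^-1)%:M *m x + 0)))%:E).
  apply: (measurableT_comp msq).
  exact: (measurableT_comp (measurable_addmx _) (measurable_mulmx _)).
rewrite /I; under eq_integral do rewrite /env_majorant EFinD Eh.
rewrite ge0_integralD//.
apply: lte_add_pinfty.
  under eq_integral do rewrite EFinM.
  rewrite ge0_integralZl ?lee_fin ?sqrtr_ge0//; last first.
    by apply/measurable_EFinP; apply: measurable_indic; exact: measurable_cube.
  rewrite integral_indic//; last exact: measurable_cube.
  rewrite setIT [X in (_ * X < _)%E](@leb_cube R d.+1); first by rewrite -EFinM ltry.
  by rewrite ge0_cp.
rewrite (ge0_integral_affine 0 uh msq) => [|x]; last by rewrite lee_fin sqrtr_ge0.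
by rewrite lte_mul_pinfty ?lee_fin ?invr_ge0.
Qed.

(** A Riemann sum: the root of the moment of the [g]-th wavelet is at most the
    majorant on the [g]-th cell, which has volume [b ^- j], and the cells have bounded
    overlap. *)
Lemma esum_sqrt_env_le C : (\int[leb d.+1]_x (env_majorant x)%:E <= C%:E)%E ->
  0 <= C -> forall j : nat,
  (\esum_(g in [set: Zd]) (Num.sqrt (env_moment j g))%:E <=
   (b ^+ j * (@overlap R d 1 * C))%:E)%E.
Proof.
move=> GC C0 j.
have b0 : 0 < b ^+ j by rewrite exprn_gt0// (lt_trans _ (absdet_gt1 dM)).
pose cell g x := unit_cell (M ^+ j *m x - zvec g).
have mcell g : measurable_fun [set: Rd] (cell g).
  apply: (measurableT_comp measurable_unit_cell).
  exact: (measurableT_comp (measurable_addmx _) (measurable_mulmx _)).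
have cell0 g x : 0 <= cell g x by rewrite /cell /unit_cell indicE ler0n.
have icell g : (\int[leb d.+1]_x (cell g x)%:E = (b ^- j)%:E)%E.
  rewrite (ge0_integral_affine (- zvec g) (dilation_unit dM j) (u := EFin \o unit_cell)).
  - rewrite -/(absdet _) absdetX [X in (_ * X)%E](_ : _ = 1%E) ?mule1//.
    rewrite /= /unit_cell integral_indic//; last exact: measurable_cube.
    rewrite setIT [LHS](@leb_cube R d.+1)//.
    by rewrite subr0 expr1n.
  - by apply/measurable_EFinP; exact: measurable_unit_cell.
  - by move=> x; rewrite lee_fin /unit_cell indicE.
have one g : ((Num.sqrt (env_moment j g))%:E <=
    (b ^+ j)%:E * \int[leb d.+1]_x (cell g x * env_majorant x)%:E)%E.
  apply: (@le_trans _ _ ((b ^+ j)%:E * \int[leb d.+1]_x (cell g x * Num.sqrt (env_moment j g))%:E)%E).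
    under eq_integral do rewrite mulrC EFinM.
    rewrite ge0_integralZl ?lee_fin ?sqrtr_ge0//; last first.
    - by move=> x _; rewrite lee_fin.
    - by apply/measurable_EFinP.
    rewrite icell -!EFinM lee_fin mulrCA mulfV ?mulr1// gt_eqF//.
  rewrite lee_wpmul2l ?lee_fin ?(ltW b0)//; apply: le_integral_ge0 => x.
    by rewrite lee_fin mulr_ge0 ?sqrtr_ge0.
  rewrite lee_fin; have [->|c0] := eqVneq (cell g x) 0; first by rewrite !mul0r.
  by rewrite ler_wpM2l// sqrt_env_le.
apply: ge_ereal_sup => _ [X [finX _] <-].
rewrite fsbig_finite//=.
apply: (@le_trans _ _ (\sum_(g <- fset_set X) (b ^+ j)%:E * \int[leb d.+1]_x (cell g x * env_majorant x)%:E)%E).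
  by apply: lee_sum => g _; exact: one.
rewrite -ge0_sume_distrr => [|g _]; last first.
  by apply: integral_ge0 => x _; rewrite lee_fin mulr_ge0 ?env_majorant_ge0.
rewrite EFinM lee_wpmul2l ?lee_fin ?(ltW b0)//.
rewrite -ge0_integral_sum//; last 2 first.
- move=> g; apply/measurable_EFinP; apply: measurable_funM => //.
  exact: measurable_env_majorant.
- by move=> g x _; rewrite lee_fin mulr_ge0 ?env_majorant_ge0.
have ov0 : 0 <= @overlap R d 1 by [].
apply: (@le_trans _ _ (\int[leb d.+1]_x ((@overlap R d 1)%:E * (env_majorant x)%:E))%E).
  apply: le_integral_ge0 => x.
    by apply: sume_ge0 => g _; rewrite lee_fin mulr_ge0 ?env_majorant_ge0.
  rewrite sumEFin -EFinM lee_fin -mulr_suml ler_wpM2r ?env_majorant_ge0//.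
  by apply: unit_cell_sum_le; exact: fset_uniq.
rewrite ge0_integralZl ?lee_fin//; last first.
- by move=> x _; rewrite lee_fin env_majorant_ge0.
- by apply/measurable_EFinP; exact: measurable_env_majorant.
by rewrite EFinM lee_wpmul2l ?lee_fin.
Qed.

End envelope.

(** * Covariance of two sites from the joint density *)

Section density_expect.
Context {R : realType} {dT dU} {T : measurableType dT} {U : measurableType dU}.
Variables (P : probability T R) (X : T -> U) (mX : measurable_fun setT X).
Variables (nu : {measure set U -> \bar R}) (f : U -> R).
Hypothesis Xf : has_density P X nu f.

Lemma bmf_comp (u : U -> R) c : measurable_fun setT u -> (forall x, `|u x| <= c) ->
  bmf (fun w => u (X w)).
Proof. by move=> mu uc; split; [exact: measurableT_comp mu mX|exists c]. Qed.

Lemma density_expect_ge0 (u : U -> R) c : measurable_fun setT u ->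
  (forall x, 0 <= u x <= c) ->
  ((expect P (fun w => u (X w)))%:E = \int[nu]_x (u x * f x)%:E)%E.
Proof.
move=> mu uc.
have uc' x : `|u x| <= c by have /andP[u0 u1] := uc x; rewrite ger0_norm.
rewrite /expect /Rintegral fineK; last first.
  by apply: integrable_fin_num => //; exact: (bmf_integrable P (bmf_comp mu uc')).
rewrite (density_integral mX Xf (u := EFin \o u)).
- by apply: eq_integral => x _; rewrite EFinM.
- exact/measurable_EFinP.
- by move=> x; rewrite lee_fin; case/andP: (uc x).
Qed.

End density_expect.

Section joint.
Context {R : realType} {d N : nat} {dT} {T : measurableType dT}
  (P : probability T R) (Z : 'cV[int]_N -> {RV P >-> 'cV[R]_d.+1}).
Local Notation Rd := ('cV[R]_d.+1).
Variables (f : Rd -> R) (h0 : R).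
Hypothesis Zf : forall s, has_density P (Z s) (leb d.+1) f.
Hypothesis h0_ge0 : 0 <= h0.
Hypothesis Zjoint : joint_bounded Z h0 f.

Let f0 x : 0 <= f x. Proof. by have [_ + _] := Zf 0; exact. Qed.
Let mf : measurable_fun [set: Rd] f. Proof. by have [+ _ _] := Zf 0. Qed.

(** The covariance is the integral of [u1 u2] against the difference of the joint
    density and the product density; keeping the two densities on different sides of
    an inequality avoids subtracting integrals. *)
Lemma pair_covariance_ge0 (u1 u2 : Rd -> R) c s t (i1 i2 : R) : s != t ->
  measurable_fun [set: Rd] u1 -> measurable_fun [set: Rd] u2 ->
  (forall x, 0 <= u1 x <= c) -> (forall x, 0 <= u2 x <= c) ->
  (\int[leb d.+1]_x (u1 x)%:E = i1%:E)%E -> (\int[leb d.+1]_x (u2 x)%:E = i2%:E)%E ->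
  `|expect P (fun w => u1 (Z s w) * u2 (Z t w)) -
    expect P (fun w => u1 (Z s w)) * expect P (fun w => u2 (Z t w))| <= h0 * (i1 * i2).
Proof.
move=> st mu1 mu2 u1c u2c I1 I2.
have [f2 Jf2 f2h] := Zjoint st.
pose nu := (leb d.+1 \x leb d.+1 : {measure set (Rd * Rd) -> \bar R})%E.
have mXY : measurable_fun [set: T] (fun w => (Z s w, Z t w)).
  by apply: measurable_fun_pair => /=; exact: measurable_funPT.
have u10 x : 0 <= u1 x by case/andP: (u1c x).
have u20 x : 0 <= u2 x by case/andP: (u2c x).
have c0 : 0 <= c by apply: le_trans (u10 0) _; case/andP: (u1c 0).
have [mf2 f20 _] := Jf2.
have m1 (v : Rd -> R) : measurable_fun setT v -> measurable_fun [set: Rd * Rd] (fun z => v z.1).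
  by move=> mv; exact: measurableT_comp mv measurable_fst.
have m2 (v : Rd -> R) : measurable_fun setT v -> measurable_fun [set: Rd * Rd] (fun z => v z.2).
  by move=> mv; exact: measurableT_comp mv measurable_snd.
have m12 : measurable_fun [set: Rd * Rd] (fun z => u1 z.1 * u2 z.2).
  by apply: measurable_funM; [exact: m1|exact: m2].
have mff : measurable_fun [set: Rd * Rd] (fun z => f z.1 * f z.2).
  by apply: measurable_funM; [exact: m1|exact: m2].
have tonelli (v1 v2 : Rd -> R) k1 k2 : measurable_fun setT v1 -> measurable_fun setT v2 ->
    (forall x, 0 <= v1 x) -> (forall x, 0 <= v2 x) ->
    (\int[leb d.+1]_x (v1 x)%:E = k1%:E)%E -> (\int[leb d.+1]_x (v2 x)%:E = k2%:E)%E ->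
    (\int[nu]_z (v1 z.1 * v2 z.2)%:E = (k1 * k2)%:E)%E.
  move=> mv1 mv2 v10 v20 Ik1 Ik2.
  rewrite fubini_tonelli1; last 2 first.
  - by apply/measurable_EFinP; apply: measurable_funM; [exact: m1|exact: m2].
  - by move=> z; rewrite lee_fin mulr_ge0.
  rewrite /fubini_F /=.
  have k20 : 0 <= k2 by rewrite -lee_fin -Ik2 integral_ge0// => x _; rewrite lee_fin.
  transitivity (\int[leb d.+1]_x (k2%:E * (v1 x)%:E))%E.
    apply: eq_integral => x _; under eq_integral do rewrite EFinM.
    rewrite ge0_integralZl ?lee_fin//; last 2 first.
    - by apply/measurable_EFinP.
    - by move=> y _; rewrite lee_fin.
    by rewrite Ik2 muleC.
  rewrite ge0_integralZl ?lee_fin//; last 2 first.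
  - by apply/measurable_EFinP.
  - by move=> y _; rewrite lee_fin.
  by rewrite Ik1 -EFinM mulrC.
have E12 : ((expect P (fun w => u1 (Z s w) * u2 (Z t w)))%:E =
    \int[nu]_z (u1 z.1 * u2 z.2 * f2 z)%:E)%E.
  apply: (@density_expect_ge0 _ _ _ _ _ P (fun w => (Z s w, Z t w)) mXY nu f2 Jf2
    (fun z => u1 z.1 * u2 z.2) (c * c)) => // z.
  by rewrite mulr_ge0//= ler_pM//; [case/andP: (u1c z.1)|case/andP: (u2c z.2)].
have E1 : (\int[leb d.+1]_x (u1 x * f x)%:E = (expect P (fun w => u1 (Z s w)))%:E)%E.
  by rewrite (density_expect_ge0 (measurable_funPT (Z s)) (Zf s) mu1 u1c).
have E2 : (\int[leb d.+1]_x (u2 x * f x)%:E = (expect P (fun w => u2 (Z t w)))%:E)%E.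
  by rewrite (density_expect_ge0 (measurable_funPT (Z t)) (Zf t) mu2 u2c).
set e1 := expect P (fun w => u1 (Z s w)) in E1 *; set e2 := expect P (fun w => u2 _) in E2 *.
set e12 := expect _ _ in E12 *.
have J12 : (\int[nu]_z (u1 z.1 * u2 z.2 * (f z.1 * f z.2))%:E = (e1 * e2)%:E)%E.
  rewrite -(tonelli (fun x => u1 x * f x) (fun x => u2 x * f x) e1 e2)//.
  - by apply: eq_integral => z _; rewrite mulrACA.
  - exact: measurable_funM.
  - exact: measurable_funM.
  - by move=> x; rewrite mulr_ge0.
  - by move=> x; rewrite mulr_ge0.
have J : (\int[nu]_z (h0 * (u1 z.1 * u2 z.2))%:E = (h0 * (i1 * i2))%:E)%E.
  under eq_integral do rewrite EFinM.
  rewrite ge0_integralZl ?lee_fin//; last 2 first.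
  - exact/measurable_EFinP.
  - by move=> z _; rewrite lee_fin mulr_ge0.
  by rewrite (tonelli _ _ i1 i2)// -EFinM.
have half (g1 g2 : Rd * Rd -> R) k1 k2 : measurable_fun setT g1 -> measurable_fun setT g2 ->
    (forall z, 0 <= g1 z) -> (forall z, 0 <= g2 z) -> (forall z, g1 z <= g2 z + h0) ->
    (\int[nu]_z (u1 z.1 * u2 z.2 * g1 z)%:E = k1%:E)%E ->
    (\int[nu]_z (u1 z.1 * u2 z.2 * g2 z)%:E = k2%:E)%E -> k1 <= k2 + h0 * (i1 * i2).
  move=> mg1 mg2 g10 g20 g12 K1 K2.
  rewrite -lee_fin EFinD -K1 -K2 -J -ge0_integralD//; last 4 first.
  - by move=> z _; rewrite lee_fin !mulr_ge0.
  - by apply/measurable_EFinP; exact: measurable_funM.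
  - by move=> z _; rewrite lee_fin !mulr_ge0.
  - by apply/measurable_EFinP; exact: measurable_funM.
  apply: le_integral_ge0 => z; first by rewrite lee_fin !mulr_ge0.
  rewrite -EFinD lee_fin [h0 * _]mulrC -mulrDr ler_wpM2l//.
  by rewrite mulr_ge0.
have ff0 (z : Rd * Rd) : 0 <= f z.1 * f z.2 by rewrite mulr_ge0.
have a1 : e12 <= e1 * e2 + h0 * (i1 * i2).
  apply: (half f2 (fun z => f z.1 * f z.2)) => // z.
  by have := f2h z.1 z.2; rewrite -surjective_pairing ler_norml => /andP[_]; rewrite lerBlDl.
have a2 : e1 * e2 <= e12 + h0 * (i1 * i2).
  apply: (half (fun z => f z.1 * f z.2) f2) => // z.
  have := f2h z.1 z.2; rewrite -surjective_pairing ler_norml => /andP[+ _].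
  by rewrite lerBrDr [- h0 + _]addrC lerBlDr.
rewrite ler_norml; apply/andP; split; last by rewrite lerBlDl.
by rewrite lerBrDr [- _ + _]addrC lerBlDr.
Qed.

(** Decomposition into positive and negative parts; the four bounds add up to the
    square of the full integral. *)
Lemma pair_covariance_le (u : Rd -> R) c s t (i1 : R) : s != t ->
  measurable_fun [set: Rd] u -> (forall x, `|u x| <= c) ->
  (\int[leb d.+1]_x (`|u x|)%:E <= i1%:E)%E ->
  `|expect P (fun w => u (Z s w) * u (Z t w)) -
    expect P (fun w => u (Z s w)) * expect P (fun w => u (Z t w))| <= h0 * i1 ^+ 2.
Proof.
move=> st mu uc I1.
pose up x := Num.max (u x) 0; pose um x := Num.max (- u x) 0.
have mup : measurable_fun [set: Rd] up by apply: measurable_maxr.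
have mum : measurable_fun [set: Rd] um by apply: measurable_maxr => //; exact: measurable_funN.
have c0 : 0 <= c by apply: le_trans (uc 0).
have upc x : 0 <= up x <= c.
  by rewrite le_max lexx orbT ge_max c0 (le_trans (ler_norm _) (uc x)).
have umc x : 0 <= um x <= c.
  by rewrite le_max lexx orbT ge_max c0 andbT (le_trans (ler_norm _))// normrN.
have uE x : u x = up x - um x.
  by rewrite /up /um; case: (leP 0 (u x)) => h; [rewrite !maxEle|rewrite !maxEle]; repeat case: ifPn; rewrite -?ltNge; lra.
have nE x : `|u x| = up x + um x.
  rewrite /up /um; case: (ger0P (u x)) => h; rewrite !maxEle; repeat case: ifPn; rewrite -?ltNge; lra.
have up0 x : 0 <= up x by case/andP: (upc x).
have um0 x : 0 <= um x by case/andP: (umc x).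
have fin (v : Rd -> R) : measurable_fun setT v -> (forall x, 0 <= v x) -> (forall x, v x <= `|u x|) ->
    exists2 i, 0 <= i & (\int[leb d.+1]_x (v x)%:E = i%:E)%E.
  move=> mv v0 vu.
  have i0 : (0 <= \int[leb d.+1]_x (v x)%:E)%E by apply: integral_ge0 => x _; rewrite lee_fin.
  exists (fine (\int[leb d.+1]_x (v x)%:E)); first exact: fine_ge0.
  rewrite fineK// ge0_fin_numE//; apply: (@le_lt_trans _ _ i1%:E); last exact: ltry.
  by apply: le_trans I1; apply: le_integral_ge0 => x; rewrite lee_fin.
have [ip ip0 Ip] : exists2 i, 0 <= i & (\int[leb d.+1]_x (up x)%:E = i%:E)%E.
  by apply: fin => // x; rewrite nE lerDl.
have [im im0 Im] : exists2 i, 0 <= i & (\int[leb d.+1]_x (um x)%:E = i%:E)%E.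
  by apply: fin => // x; rewrite nE lerDr.
have ipm : ip + im <= i1.
  rewrite -lee_fin EFinD -Ip -Im -ge0_integralD//; last 4 first.
  - by move=> x _; rewrite lee_fin.
  - exact/measurable_EFinP.
  - by move=> x _; rewrite lee_fin.
  - exact/measurable_EFinP.
  apply: le_trans I1; apply: le_integral_ge0 => x; first by rewrite -EFinD lee_fin addr_ge0.
  by rewrite -EFinD nE.
pose cv v1 v2 := expect P (fun w => v1 (Z s w) * v2 (Z t w)) -
    expect P (fun w => v1 (Z s w)) * expect P (fun w => v2 (Z t w)).
have cpp : `|cv up up| <= h0 * (ip * ip) by exact: (pair_covariance_ge0 st mup mup upc upc Ip Ip).
have cpm : `|cv up um| <= h0 * (ip * im) by exact: (pair_covariance_ge0 st mup mum upc umc Ip Im).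
have cmp : `|cv um up| <= h0 * (im * ip) by exact: (pair_covariance_ge0 st mum mup umc upc Im Ip).
have cmm : `|cv um um| <= h0 * (im * im) by exact: (pair_covariance_ge0 st mum mum umc umc Im Im).
have bnd (v : Rd -> R) r : measurable_fun setT v -> (forall x, 0 <= v x <= c) -> bmf (fun w => v (Z r w)).
  move=> mv vc; apply: (bmf_comp (measurable_funPT (Z r)) mv (c := c)) => x.
  by have /andP[v0 v1] := vc x; rewrite ger0_norm.
have bps := bnd up s mup upc; have bpt := bnd up t mup upc.
have bms := bnd um s mum umc; have bmt := bnd um t mum umc.
have Eu r (bp : bmf (fun w => up (Z r w))) (bm : bmf (fun w => um (Z r w))) :
    expect P (fun w => u (Z r w)) = expect P (fun w => up (Z r w)) - expect P (fun w => um (Z r w)).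
  by rewrite -(EB P bp bm); apply: eq_expect => w; exact: uE.
have -> : expect P (fun w => u (Z s w) * u (Z t w)) -
    expect P (fun w => u (Z s w)) * expect P (fun w => u (Z t w)) =
    (cv up up - cv up um) - (cv um up - cv um um).
  rewrite (Eu s bps bms) (Eu t bpt bmt) /cv.
  rewrite (@eq_expect _ _ _ P _ (fun w => (up (Z s w) * up (Z t w) - up (Z s w) * um (Z t w)) -
     (um (Z s w) * up (Z t w) - um (Z s w) * um (Z t w)))); last by move=> w; rewrite !uE; ring.
  have b1 := bmfM bps bpt; have b2 := bmfM bps bmt.
  have b3 := bmfM bms bpt; have b4 := bmfM bms bmt.
  rewrite (EB P (bmfB b1 b2) (bmfB b3 b4)) (EB P b1 b2) (EB P b3 b4).
  by ring.
apply: (le_trans (ler_normB _ _)).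
apply: (le_trans (lerD (ler_normB _ _) (ler_normB _ _))).
apply: (le_trans (lerD (lerD cpp cpm) (lerD cmp cmm))).
have -> : h0 * (ip * ip) + h0 * (ip * im) + (h0 * (im * ip) + h0 * (im * im)) =
  h0 * (ip + im) ^+ 2 by ring.
by rewrite ler_wpM2l// lerXn2r// ?nnegrE ?addr_ge0// (le_trans _ ipm)// addr_ge0.
Qed.

End joint.

(** * Moments of an empirical coefficient *)

Lemma one_powR (R : realType) (x : R) : 1 `^ x = 1 :> R.
Proof. by rewrite powR1. Qed.

(** Real moments are controlled by the first absolute moment and an even moment,
    both of which are linear in the standard deviation. *)
Lemma powR_le_add (R : realType) (y p' : R) (Q : nat) : 0 <= y -> 1 <= p' ->
  p' <= Q%:R -> y `^ p' <= y + y ^+ Q.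
Proof.
move=> y0 p1 pQ; have p0 : 0 < p' by exact: lt_le_trans p1.
have [y1|y1] := leP y 1.
  rewrite -[leLHS]addr0 lerD ?exprn_ge0// -(mulr_powRB1 y0 p0) ler_piMr//.
  by rewrite -[leRHS](one_powR (p' - 1)) ge0_ler_powR ?nnegrE// subr_ge0.
rewrite -[leLHS]add0r lerD// -powR_mulrn//.
by apply: ler_powR => //; exact: ltW.
Qed.

Section density_signed.
Context {R : realType} {dT dU} {T : measurableType dT} {U : measurableType dU}.
Variables (P : probability T R) (X : T -> U) (mX : measurable_fun setT X).
Variables (nu : {measure set U -> \bar R}) (f : U -> R).
Hypothesis Xf : has_density P X nu f.

Lemma density_integrable : nu.-integrable setT (EFin \o f).
Proof.
have [mf f0 Pf] := Xf; apply/integrableP; split; first exact/measurable_EFinP.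
under eq_integral do rewrite /= ger0_norm//.
by rewrite -Pf// preimage_setT probability_setT ltry.
Qed.

(** Adding the constant [c] reduces to nonnegative [u]. *)
Lemma density_expect (u : U -> R) c : measurable_fun setT u ->
  (forall x, `|u x| <= c) ->
  expect P (fun w => u (X w)) = \int[nu]_x (f x * u x).
Proof.
move=> mu uc; have [mf f0 Pf] := Xf.
have fi := density_integrable.
have ui : nu.-integrable setT (fun x => (f x * u x)%:E).
  have cfi : nu.-integrable setT (fun x => (c%:E * (f x)%:E)%E) by exact: integrableZl.
  apply: (le_integrable _ _ _ cfi) => //.
    by apply/measurable_EFinP; exact: measurable_funM.
  move=> x _; rewrite -EFinM !abse_EFin lee_fin !normrM mulrC ler_wpM2r//.
  by rewrite (le_trans (uc x))// ler_norm.
have If : \int[nu]_x f x = 1.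
  by rewrite /Rintegral -(Pf setT)// preimage_setT probability_setT.
have vc x : 0 <= u x + c <= c + c.
  by have := uc x; rewrite ler_norml => /andP[h1 h2]; rewrite -lerBlDr sub0r h1 lerD2r.
have muc : measurable_fun setT (fun x => u x + c) by apply: measurable_funD.
have h := density_expect_ge0 mX Xf muc vc.
have h2 : expect P (fun w => u (X w)) + c = \int[nu]_x (f x * u x + c * f x).
  rewrite /Rintegral (eq_integral (fun x => ((u x + c) * f x)%:E)); last first.
    by move=> x _; congr (_%:E); ring.
  rewrite -h /= (ED P (bmf_comp mX mu uc) (bmf_cst c)); congr (_ + _).
  by rewrite [RHS]E_cst.
apply: (@addIr _ c); rewrite h2 RintegralD//; last first.
  by rewrite (_ : _ \o _ = (fun x => (c%:E * (f x)%:E)%E))//; exact: integrableZl.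
by congr (_ + _); rewrite RintegralZl// If mulr1.
Qed.

End density_signed.

Section stochastic.
Context {R : realType} {d : nat}.
Local Notation Rd := ('cV[R]_d.+1).
Local Notation Zd := ('cV[int]_d.+1).
Variables (M : 'M[R]_d.+1) (dM : dilation_matrix M).
Variables (Psi : nat -> Rd -> R) (L : nat) (B : R) (a : nat -> Zd -> R).
Variables (F : {fset Zd}) (mz : Zd -> Zd).
Hypothesis fr : finite_refinement M Psi L B a F mz.
Local Notation Phi := (Psi 0%N).
Local Notation b := (absdet M).
Variables (h : Rd -> R) (Bh : R).
Hypothesis h_ge0 : forall x, 0 <= h x.
Hypothesis h_le : forall x, h x <= Bh.
Hypothesis h_radial : forall x y, norm2 y <= norm2 x -> h x <= h y.
Variables (N : nat) (c0 c1 h0 p' s' : R).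
Hypothesis N_gt0 : (0 < N)%N.
Hypothesis c1_gt0 : 0 < c1.
Hypothesis h0_ge0 : 0 <= h0.
Hypothesis p'_ge1 : 1 <= p'.
Hypothesis s'_gt0 : 0 < s'.

Let b_gt1 : 1 < b := absdet_gt1 dM.
Let b_gt0 : 0 < b. Proof. exact: lt_trans b_gt1. Qed.
Let B_ge0 : 0 <= B := wavelet_bound_ge0 dM fr.

Let be (j : nat) : R := 2 * (B + 1) * b `^ (j%:R / 2).

Let be_ge1 j : 1 <= be j.
Proof.
rewrite -[leLHS]mulr1 ler_pM//; first by move: B_ge0; lra.
by rewrite -[leLHS](one_powR (j%:R / 2)) ge0_ler_powR ?nnegrE// ltW.
Qed.

(** The sup norm of a wavelet is of order [b ^ (j/2)]; at the chosen level it remains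
    below the root of the sample size even when raised to a power slightly above
    one. *)
Let root_le j (r : R) (l nn : nat) : (2 <= l)%N -> l%:R^-1 <= 2 * s' ->
  b ^+ j <= nn%:R `^ (2 * s' + 1)^-1 -> (0 < nn)%N -> r = Num.sqrt nn%:R ->
  (be j `^ l%:R^-1) ^+ l.+1 <= (2 * (B + 1)) ^+ 2 * r.
Proof.
move=> l2 ls bj nn0 ->.
have l0 : 0 < l%:R :> R by rewrite ltr0n (ltn_trans _ l2).
have B1 : 1 <= 2 * (B + 1) by move: B_ge0; lra.
have B0 : 0 <= 2 * (B + 1) by exact: le_trans B1.
have li : l%:R^-1 <= 2^-1 :> R by rewrite lef_pV2 ?posrE// ler_nat.
pose e : R := 1 + l%:R^-1.
have e0 : 0 < e by rewrite addr_gt0// invr_gt0.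
have -> : (be j `^ l%:R^-1) ^+ l.+1 = be j `^ e.
  rewrite -powR_mulrn ?powR_ge0// -powRrM /e -natr1 mulrDr mulVf ?gt_eqF//.
  by rewrite mulr1.
rewrite /be powRM ?powR_ge0//; apply: ler_pM; rewrite ?powR_ge0//.
  rewrite -powR_mulrn//; apply: ler_powR => //; rewrite /e; move: li; lra.
rewrite -powRrM -(powR12_sqrt (ler0n _ _)).
have -> : j%:R / 2 * e = j%:R * (e / 2) by ring.
rewrite powRrM powR_mulrn ?(ltW b_gt0)//.
apply: (@le_trans _ _ ((nn%:R `^ (2 * s' + 1)^-1) `^ (e / 2))).
  by rewrite ge0_ler_powR ?nnegrE ?powR_ge0 ?exprn_ge0 ?(ltW b_gt0)// divr_ge0// ltW.
have s0 : 0 < 2 * s' + 1 by move: s'_gt0; lra.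
rewrite -powRrM; apply: ler_powR; first by rewrite ler1n.
rewrite mulrC ler_pdivrMr// /e; move: (l%:R^-1) ls => u; lra.
Qed.

(** The normalized sum [Y] satisfies [|Y| ^ p' <= |Y| + Y ^ Q] for an even [Q]; the
    first moment is bounded by [sum_norm_le] and the other one by [field_moment_le],
    both linearly in the root of [env_moment]. *)
Lemma coef_moment_le : exists2 C : R, 0 <= C &
  forall (dT : measure_display) (T : measurableType dT) (P : probability T R)
    (Z : 'cV[int]_N -> {RV P >-> Rd}) (f : Rd -> R) (I : seq 'cV[int]_N) (j : nat) (g : Zd),
    standing_assumptions Z c0 c1 f -> {ae leb d.+1, forall x, f x <= h x} ->
    joint_bounded Z h0 f -> uniq I -> (0 < size I)%N ->
    b ^+ j <= (size I)%:R `^ (2 * s' + 1)^-1 ->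
    bmf (fun w => `|\int[leb d.+1]_y (f y * dilate M Phi j%:Z g y) -
        (size I)%:R^-1 * \sum_(s <- I) dilate M Phi j%:Z g (Z s w)| `^ p') /\
    expect P (fun w => `|\int[leb d.+1]_y (f y * dilate M Phi j%:Z g y) -
        (size I)%:R^-1 * \sum_(s <- I) dilate M Phi j%:Z g (Z s w)| `^ p') <=
    Num.sqrt (size I)%:R `^ (- p') * (C * Num.sqrt (env_moment M Psi h j g)).
Proof.
have Bh0 : 0 <= Bh by exact: le_trans (h_ge0 0) (h_le 0).
have B1 : 1 <= 2 * (B + 1) by move: B_ge0; lra.
pose v0 := Num.sqrt Bh + 1.
have v01 : 1 <= v0 by rewrite lerDr sqrtr_ge0.
pose mass := B * L%:R ^+ d.+1.
pose Cd := (2 * (B + 1)) ^+ 2 * (h0 * mass ^+ 2).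
have Cd0 : 0 <= Cd by rewrite mulr_ge0 ?sqr_ge0// mulr_ge0// sqr_ge0.
pose Cb := (2 * (B + 1)) ^+ 2.
have Cb1 : 1 <= Cb by exact: exprn_ege1.
(* A fraction [1 / l <= 2 s'] of the power of the sup norm is available, as [b ^ j <= n ^
   (1 / (2 s' + 1))]. *)
pose l := maxn 2 (Num.truncn ((2 * s')^-1)).+1.
have l2 : (2 <= l)%N by rewrite leq_maxl.
have l0 : 0 < l%:R :> R by rewrite ltr0n (ltn_trans _ l2).
have ls : l%:R^-1 <= 2 * s'.
  rewrite -[leRHS]invrK lef_pV2 ?posrE ?invr_gt0 ?mulr_gt0//.
  rewrite (le_trans (ltW (truncnS_gt _)))// ler_nat leq_maxr//.
(* [Q] is even, so that [S ^ Q] is nonnegative, and at least [p']. *)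
pose m := (Num.truncn p').+1; pose Q := (m + m)%N.
have pQ : p' <= Q%:R.
  by rewrite (le_trans (ltW (truncnS_gt p')))// ler_nat leq_addr.
have Q1 : (1 < Q)%N by rewrite /Q /m addSn addnS.
have [C2 C20 hC2] := field_moment_le c0 N_gt0 c1_gt0 v01 Cd0 Cb1 l2 Q1.
pose C1 := 5 * (1 + 2 * @dyadic_const R N c0 c1).
have C10 : 0 <= C1.
  by rewrite mulr_ge0// addr_ge0// mulr_ge0// dyadic_const_ge0.
exists (C1 + C2); first exact: addr_ge0.
move=> dT T P Z f I j g SA fh Jh uI I0 bj.
pose phi := dilate M Phi j%:Z g.
have mphi : measurable_fun [set: Rd] phi := measurable_dilate M j g (fr_meas fr (ndet_gt0 dM)).
have phib x : `|phi x| <= b `^ (j%:R / 2) * B.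
  by apply: dilate_bounded; exact: (fr_bound fr (ndet_gt0 dM)).
have Zf s : has_density P (Z s) (leb d.+1) f := field_density SA s.
have mZ s : measurable_fun [set: T] (Z s) := measurable_funPT (Z s).
pose th := \int[leb d.+1]_y (f y * phi y).
have Eth s : expect P (fun w => phi (Z s w)) = th := density_expect (mZ s) (Zf s) mphi phib.
have bphi s : bmf (fun w => phi (Z s w)) := bmf_comp (mZ s) mphi phib.
pose X s w := phi (Z s w) - th.
have bX s : bmf (X s) by exact: (bmfB (bphi s) (bmf_cst th)).
have mX s : field_meas Z [set s] (X s).
  apply: field_measD; last exact: field_meas_cst.
  exact: (field_meas_coord (s := s)).
have X0 s : expect P (X s) = 0 by rewrite /X -(Eth s); exact: E_centered.
pose r := Num.sqrt (size I)%:R : R.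
have n0 : 0 < (size I)%:R :> R by rewrite ltr0n.
have r0 : 0 < r by rewrite sqrtr_gt0.
have rsq : r ^+ 2 = (size I)%:R by rewrite sqr_sqrtr// ltW.
pose v := Num.sqrt (env_moment M Psi h j g).
have v_ge0 : 0 <= v by exact: sqrtr_ge0.
have vsq : v ^+ 2 = env_moment M Psi h j g.
  by rewrite sqr_sqrtr// env_moment_ge0.
have v_le : v <= v0.
  by rewrite /v /v0 -[leLHS]addr0 lerD// ler_wsqrtr// (env_moment_le dM fr h_ge0 h_le h_radial).
have XV s : expect P (fun w => X s w ^+ 2) <= v ^+ 2.
  rewrite vsq; apply: (@le_trans _ _ (expect P (fun w => phi (Z s w) ^+ 2))).
    rewrite (@eq_expect _ _ _ P _ (fun w => (phi (Z s w) - expect P (fun w => phi (Z s w))) ^+ 2)).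
      exact: E_centered_sqr.
    by move=> w; rewrite Eth.
  have mphi2 : measurable_fun [set: Rd] (fun x => phi x ^+ 2) by exact: measurable_funX.
  have phi2c x : 0 <= phi x ^+ 2 <= (b `^ (j%:R / 2) * B) ^+ 2.
    rewrite sqr_ge0/= -[leLHS]real_normK ?num_real//.
    by apply: lerXn2r; rewrite ?nnegrE// (le_trans (normr_ge0 _) (phib x)).
  rewrite -lee_fin (density_expect_ge0 (mZ s) (Zf s) mphi2 phi2c) /env_moment.
  have mh := measurable_radial h_radial.
  have bcs2 : bcs (fun x => h x * phi x ^+ 2).
    have bphi0 := bcs_wavelet dM fr j g (ndet_gt0 dM).
    rewrite (_ : (fun x => _) = (fun x => (h x * phi x) * phi x)).
      apply: bcs_mul => //; first exact: measurable_funM.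
      exists (Bh * (b `^ (j%:R / 2) * B)) => x; rewrite normrM ler_pM// ger0_norm//.
    by apply/funext => x; rewrite expr2 mulrA.
  rewrite /Rintegral fineK; last by apply: integrable_fin_num => //; exact: bcs_integrable bcs2.
  have [mf f0 _] := Zf s.
  apply: ae_le_integral_ge0.
  - by move=> x; rewrite lee_fin mulr_ge0// sqr_ge0.
  - by move=> x; rewrite lee_fin mulr_ge0// sqr_ge0.
  - by apply/measurable_EFinP; exact: bcs_measurable bcs2.
  by apply: filterS fh => x fhx; rewrite lee_fin mulrC ler_wpM2r// sqr_ge0.
pose D0 := h0 * level_mass M L B 1 j ^+ 2.
have D00 : 0 <= D0 by rewrite mulr_ge0// sqr_ge0.
have Iphi : (\int[leb d.+1]_x (`|phi x|)%:E <= (level_mass M L B 1 j)%:E)%E.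
  have := integral_dilate_powR dM fr j g (ndet_gt0 dM) (ltr01 : 0 < 1 :> R).
  by under eq_integral do rewrite powRr1//.
have XX s t : s != t -> `|expect P (fun w => X s w * X t w)| <= D0.
  move=> st; rewrite (@eq_expect _ _ _ P _ (fun w => (phi (Z s w) - expect P (fun w => phi (Z s w))) *
     (phi (Z t w) - expect P (fun w => phi (Z t w))))); last by move=> w; rewrite !Eth.
  rewrite E_centered_mul//.
  exact: (pair_covariance_le Zf h0_ge0 Jh st mphi phib Iphi).
pose bb := be j `^ l%:R^-1.
have be0 : 0 <= be j by exact: le_trans (be_ge1 j).
have bb1 : 1 <= bb.
  by rewrite /bb -[leLHS](one_powR l%:R^-1) ge0_ler_powR ?nnegrE// invr_ge0 ltW.
have bbl : bb ^+ l = be j.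
  by rewrite /bb -powR_mulrn ?powR_ge0// -powRrM mulVf ?gt_eqF// powRr1.
have thb : `|th| <= b `^ (j%:R / 2) * B.
  by rewrite -(Eth 0); apply: E_norm_le.
have Xb s w : `|X s w| <= bb ^+ l.
  rewrite bbl; apply: (le_trans (ler_normB _ _)); apply: (le_trans (lerD (phib _) thb)).
  rewrite /be; have := powR_ge0 b (j%:R / 2); move: (b `^ _) => u u0.
  rewrite (_ : u * B + u * B = 2 * B * u); last by ring.
  by rewrite ler_wpM2r// ler_wpM2l// lerDl.
have bD0 : (bb ^+ l) ^+ 2 * D0 <= Cd.
  rewrite bbl /D0 /level_mass powRr1// /be /Cd -/mass.
  have e1 : b `^ (j%:R / 2) * b `^ (j%:R * (1 / 2 - 1)) = 1.
    by rewrite -powR_add// (_ : _ + _ = 0) ?powRr0//; field.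
  rewrite le_eqVlt; apply/orP; left; apply/eqP.
  transitivity ((2 * (B + 1)) ^+ 2 * (h0 * mass ^+ 2) *
    (b `^ (j%:R / 2) * b `^ (j%:R * (1 / 2 - 1))) ^+ 2); first by ring.
  by rewrite e1 expr1n mulr1.
have br : bb ^+ l.+1 <= Cb * r by exact: (root_le l2 ls bj I0).
pose S w := \sum_(s <- I) X s w.
have bS : bmf S by exact: bmf_sum.
have ES1 : expect P (fun w => `|S w|) <= C1 * v * r.
  have := sum_norm_le N_gt0 c1_gt0 SA mX Xb X0 XV uI.
  rewrite -/C1 sqrtrM ?ler0n// sqrtr_sqr (ger0_norm v_ge0) -/r.
  by rewrite (mulrC r v) mulrA.
have ESQ : expect P (fun w => S w ^+ Q) <= C2 * v * r ^+ Q.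
  pose x (t : 'I_(size I)) := nth 0 I t.
  have xi : injective x.
    move=> t u /eqP; rewrite nth_uniq// => /eqP tu; exact: ord_inj.
  have := hC2 d dT T P Z f X bb v D0 r (size I) x SA mX Xb X0 XV XX v_ge0 v_le bb1 bD0 D00
    br (ltW r0) rsq I0 xi.
  rewrite (@eq_expect _ _ _ P _ (fun w => S w ^+ Q))// => w.
  by rewrite /S (big_nth 0) big_mkord.
have cE w : th - (size I)%:R^-1 * \sum_(s <- I) phi (Z s w) = - ((size I)%:R^-1 * S w).
  rewrite /S /X sumrB big_const_seq count_predT iter_addr_0 mulrBr -[th *+ _]mulr_natl mulrA.
  by rewrite mulVf ?gt_eqF// mul1r opprB.
have key w : `|th - (size I)%:R^-1 * \sum_(s <- I) phi (Z s w)| `^ p' <=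
    r `^ (- p') * (r^-1 * `|S w| + r ^- Q * S w ^+ Q).
  rewrite cE normrN normrM (ger0_norm (_ : 0 <= (size I)%:R^-1)) ?invr_ge0 ?ler0n//.
  rewrite -rsq expr2 invfM -mulrA powRM ?mulr_ge0 ?invr_ge0 ?(ltW r0)//.
  rewrite -(powR_inv1 (ltW r0)) -powRrM mulN1r ler_wpM2l ?powR_ge0// powR_inv1 ?(ltW r0)//.
  have y0 : 0 <= r^-1 * `|S w| by rewrite mulr_ge0// invr_ge0 ltW.
  apply: (le_trans (powR_le_add y0 p'_ge1 pQ)).
  rewrite lerD2l exprMn exprVn ler_wpM2l ?invr_ge0 ?exprn_ge0 ?(ltW r0)//.
  by rewrite -normrX ger0_norm// /Q exprD -expr2 sqr_ge0.
have bc : bmf (fun w => `|th - (size I)%:R^-1 * \sum_(s <- I) phi (Z s w)| `^ p').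
  have bc0 : bmf (fun w => th - (size I)%:R^-1 * \sum_(s <- I) phi (Z s w)).
    by apply: (bmfB (bmf_cst th)); apply: bmfZ; exact: bmf_sum.
  have [mc [e ce]] := bc0; split.
    apply: (measurableT_comp (measurable_powR p')).
    exact: (measurableT_comp _ mc).
  exists (e `^ p') => w; rewrite (ger0_norm (powR_ge0 _ _)).
  apply: ge0_ler_powR; rewrite ?nnegrE ?(le_trans _ (ce w))//.
  exact: le_trans p'_ge1.
split => //.
have b1 := bmf_abs bS; have b2 := bmfX Q bS.
apply: (le_trans (E_le P bc (bmfZ (r `^ (- p')) (bmfD (bmfZ r^-1 b1) (bmfZ (r ^- Q) b2))) key)).
rewrite EZ; last by apply: bmfD; exact: bmfZ.
rewrite (ED P (bmfZ r^-1 b1) (bmfZ (r ^- Q) b2)) (EZ P _ b1) (EZ P _ b2).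
rewrite -/r ler_wpM2l ?powR_ge0// -/v mulrDl lerD//.
  by rewrite mulrC ler_pdivrMr.
by rewrite mulrC ler_pdivrMr// exprn_gt0.
Qed.

End stochastic.

(** * The risk *)

Section stochastic_integral.
Context {R : realType} {d : nat}.
Local Notation Rd := ('cV[R]_d.+1).
Local Notation Zd := ('cV[int]_d.+1).
Variables (M : 'M[R]_d.+1) (dM : dilation_matrix M).
Variables (Psi : nat -> Rd -> R) (L : nat) (B : R) (a : nat -> Zd -> R).
Variables (F : {fset Zd}) (mz : Zd -> Zd).
Hypothesis fr : finite_refinement M Psi L B a F mz.
Local Notation Phi := (Psi 0%N).
Local Notation b := (absdet M).
Variables (h : Rd -> R) (Bh : R).
Hypothesis h_ge0 : forall x, 0 <= h x.
Hypothesis h_le : forall x, h x <= Bh.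
Hypothesis h_radial : forall x y, norm2 y <= norm2 x -> h x <= h y.
Hypothesis h_int : (\int[leb d.+1]_x (Num.sqrt (h x))%:E < +oo)%E.
Variables (N : nat) (c0 c1 h0 p' s' : R).
Hypothesis N_gt0 : (0 < N)%N.
Hypothesis c1_gt0 : 0 < c1.
Hypothesis h0_ge0 : 0 <= h0.
Hypothesis p'_ge1 : 1 <= p'.
Hypothesis s'_gt0 : 0 < s'.

(** By bounded overlap the stochastic error is at most the sum over all translates of
    the coefficient errors, and the sum of the roots of the moments is of order
    [b ^+ j] by [esum_sqrt_env_le]. The majorant [G] is measurable, which spares the
    measurability of the error itself in the sample point. *)
Lemma stochastic_majorant : exists2 C : R, 0 <= C &
  forall (dT : measure_display) (T : measurableType dT) (P : probability T R)
    (Z : 'cV[int]_N -> {RV P >-> Rd}) (f : Rd -> R) (I : seq 'cV[int]_N) (j : nat),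
    standing_assumptions Z c0 c1 f -> {ae leb d.+1, forall x, f x <= h x} ->
    joint_bounded Z h0 f -> uniq I -> (0 < size I)%N ->
    b ^+ j <= (size I)%:R `^ (2 * s' + 1)^-1 ->
    exists G : T -> \bar R, [/\ measurable_fun [set: T] G, forall w, (0 <= G w)%E,
      forall w, (\int[leb d.+1]_x (`|level_proj M Psi f j x -
          \sum_(g \in [set: Zd]) ((size I)%:R^-1 * \sum_(s <- I) dilate M Phi j%:Z g (Z s w)) *
            dilate M Phi j%:Z g x| `^ p')%:E <= G w)%E &
      (\int[P]_w G w <= (C * (b ^+ j / (size I)%:R) `^ (p' / 2))%:E)%E].
Proof.
have b0 : 0 < b by exact: lt_trans (absdet_gt1 dM).
have p'0 : 0 < p' by exact: lt_le_trans p'_ge1.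
have [C C0 hC] := coef_moment_le dM fr h_ge0 h_le h_radial c0 N_gt0 c1_gt0 h0_ge0 p'_ge1 s'_gt0.
have [Lam Lam1 hLam] := dilation_expand dM.
have [Ce Ce0 hCe] := integral_env_majorant L Bh h_radial h_int Lam1.
have env := esum_sqrt_env_le dM fr h_ge0 h_le h_radial Lam1 hLam hCe Ce0.
pose E := @overlap R d 1 * Ce.
have E0 : 0 <= E by rewrite mulr_ge0.
pose mass := B `^ p' * L%:R ^+ d.+1.
have mass0 : 0 <= mass by rewrite mulr_ge0 ?powR_ge0// exprn_ge0.
exists (@overlap R d L `^ p' * mass * (C * E)).
  by rewrite !mulr_ge0 ?powR_ge0 ?exprn_ge0.
move=> dT T P Z f I j SA fh Jh uI I0 bj.
pose n := (size I)%:R : R.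
have n0 : 0 < n by rewrite ltr0n.
pose r := Num.sqrt n.
pose c g w := \int[leb d.+1]_y (f y * dilate M Phi j%:Z g y) -
   n^-1 * \sum_(s <- I) dilate M Phi j%:Z g (Z s w).
have hc g := hC dT T P Z f I j g SA fh Jh uI I0 bj.
pose u g w := (`|c g w| `^ p')%:E.
have mu g : measurable_fun [set: T] (u g) by apply/measurable_EFinP; case: (hc g) => -[].
have u0 g w : (0 <= u g w)%E by rewrite lee_fin powR_ge0.
have [mes Ees] := measurable_esum P mu u0.
pose k := @overlap R d L `^ p' * level_mass M L B p' j.
have k0 : 0 <= k by rewrite mulr_ge0 ?powR_ge0// level_mass_ge0.
exists (fun w => (k%:E * \esum_(g in [set: Zd]) u g w)%E); split.
- by apply: emeasurable_funM => //; exact: measurable_cst.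
- by move=> w; rewrite mule_ge0 ?lee_fin// esum_ge0.
- move=> w; have := integral_lat_sum_powR dM fr j (c^~ w) (ndet_gt0 dM) p'0.
  apply: le_trans; rewrite le_eqVlt; apply/orP; left; apply/eqP.
  apply: eq_integral => x _; congr ((`|_| `^ _)%:E).
  rewrite /level_proj !(fsum_dilate _ _ _ _ (fr_supp fr (ndet_gt0 dM))) -sumrB.
  by apply: eq_bigr => e _; rewrite -mulrBl.
rewrite ge0_integralZl ?lee_fin//; last by move=> w _; exact: esum_ge0.
rewrite Ees.
have Iu g : (\int[P]_w u g w = (expect P (fun w => `|c g w| `^ p'))%:E)%E.
  rewrite /expect /Rintegral fineK//; apply: integrable_fin_num => //.
  by apply: bmf_integrable; case: (hc g).
have rC : 0 <= r `^ (- p') * C by rewrite mulr_ge0 ?powR_ge0.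
have step : (\esum_(g in [set: Zd]) (\int[P]_w u g w) <=
    (r `^ (- p') * C)%:E * (b ^+ j * E)%:E)%E.
  apply: (@le_trans _ _ ((r `^ (- p') * C)%:E * \esum_(g in [set: Zd]) (Num.sqrt (env_moment M Psi h j g))%:E)%E).
    apply: le_trans (esum_scale_le rC _); last by move=> g; rewrite lee_fin sqrtr_ge0.
    by apply: le_esum => g _; rewrite Iu -EFinM lee_fin -mulrA; case: (hc g) => _; exact.
  by rewrite lee_wpmul2l ?lee_fin.
apply: (le_trans (lee_wpmul2l _ step)); first by rewrite lee_fin.
rewrite -!EFinM lee_fin /k /level_mass -/mass.
have -> : (b ^+ j / n) `^ (p' / 2) = b `^ (j%:R * (p' / 2)) * r `^ (- p').
  rewrite powRM ?exprn_ge0 ?invr_ge0 ?(ltW b0) ?(ltW n0)//.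
  rewrite -[b ^+ j]powR_mulrn ?(ltW b0)// -powRrM; congr (_ * _).
  rewrite /r -(powR12_sqrt (ltW n0)) -powRrM -(powR_inv1 (ltW n0)) -powRrM.
  by congr (_ `^ _); field.
have -> : b `^ (j%:R * (p' / 2)) = b `^ (j%:R * (p' / 2 - 1)) * b ^+ j.
  rewrite -[b ^+ j]powR_mulrn ?(ltW b0)// -powR_add//.
  by congr (_ `^ _); ring.
rewrite le_eqVlt; apply/orP; left; apply/eqP; ring.
Qed.

End stochastic_integral.

Section index_box.
Variables (R : realType) (N : nat).

Lemma finite_index_box (n : 'I_N -> nat) : finite_set (index_box n).
Proof.
pose m := (\max_i n i)%N.
apply: (@sub_finite_set _ _ [set` @zbox R N m]); last exact: finite_fset.
move=> g gn /=; apply: zboxP => i; have /andP[g1 g2] := gn i.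
rewrite ger0_norm; last by rewrite ler0z (le_trans _ g1).
rewrite -[m%:R]/(m%:Z%:~R) ler_int (le_trans g2)// lez_nat.
exact: (leq_bigmax i).
Qed.

Lemma card_index_box_gt0 (n : 'I_N -> nat) : (forall i, (0 < n i)%N) ->
  (0 < card_box n)%N.
Proof.
move=> n0; rewrite /card_box cardfs_gt0; apply/fset0Pn; exists (const_mx 1).
rewrite in_fset_set ?inE; last exact: finite_index_box.
by move=> i; rewrite mxE lexx /=; exact: n0.
Qed.

End index_box.

Lemma s_prime_gt0 (R : realType) (s p' : R) (p : \bar R) : (1 <= p)%E ->
  1 <= p' -> recip p < s -> 0 < s_prime s p' p.
Proof.
move=> p1 p'1 ps; rewrite /s_prime minEle; case: ifPn => _.
  have : 0 < p'^-1 by rewrite invr_gt0 (lt_le_trans ltr01).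
  by move: (recip p) ps (p'^-1) => u us v v0; lra.
by rewrite addr0 (le_lt_trans _ ps)// recip_ge0.
Qed.

Section risk.
Context {R : realType} {d : nat}.
Local Notation Rd := ('cV[R]_d.+1).
Local Notation Zd := ('cV[int]_d.+1).
Variables (M : 'M[R]_d.+1) (dM : dilation_matrix M).
Variables (Psi : nat -> Rd -> R) (L : nat) (B : R) (a : nat -> Zd -> R).
Variables (F : {fset Zd}) (mz : Zd -> Zd).
Hypothesis fr : finite_refinement M Psi L B a F mz.
Local Notation Phi := (Psi 0%N).
Local Notation b := (absdet M).
Variables (N : nat) (N_gt0 : (0 < N)%N) (c0 c1 : R) (c1_gt0 : 0 < c1).
Variables (p' : R) (p'_ge1 : 1 <= p') (p q : \bar R) (p_ge1 : (1 <= p)%E)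
  (q_ge1 : (1 <= q)%E) (s : R) (s_gt : recip p < s) (A : set Rd)
  (A_bounded : (p'%:E < p)%E -> bounded_set A) (K : R).
Variables (h : Rd -> R) (Bh : R).
Hypothesis h_ge0 : forall x, 0 <= h x.
Hypothesis h_le : forall x, h x <= Bh.
Hypothesis h_radial : forall x y, norm2 y <= norm2 x -> h x <= h y.
Hypothesis h_int : (\int[leb d.+1]_x (Num.sqrt (h x))%:E < +oo)%E.
Variables (h0 : R) (h0_ge0 : 0 <= h0).
Local Notation s' := (s_prime s p' p).

(** The level balances the bias [b ^ (-j s')] and the stochastic error
    [(b ^ j / n) ^ (1/2)], which are then both of order [n ^ (-s' / (2 s' + 1))]. *)
Lemma risk_le : exists2 C : R, 0 < C &
  forall (dT : measure_display) (T : measurableType dT) (P : probability T R)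
    (Z : 'cV[int]_N -> {RV P >-> Rd}) (f : Rd -> R) (n : 'I_N -> nat) (j : int),
    besov_density M Psi s p q K A f -> standing_assumptions Z c0 c1 f ->
    {ae leb d.+1, forall x, f x <= h x} -> joint_bounded Z h0 f ->
    (forall i, (0 < n i)%N) -> level M s' n j ->
    (estimator_risk M Phi Z f p' n j <=
       (C * (card_box n)%:R `^ (- (s' / (2 * s' + 1))))%:E)%E.
Proof.
have b1 : 1 < b := absdet_gt1 dM.
have b0 : 0 < b by exact: lt_trans b1.
have p'0 : 0 < p' by exact: lt_le_trans p'_ge1.
have s'0 : 0 < s' by exact: s_prime_gt0.
have S0 : 0 < 2 * s' + 1 by move: s'0; lra.
have [Cb Cb0 hCb] := integral_bias dM fr K p_ge1 q_ge1 s_gt p'_ge1 A_bounded.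
have [Cs Cs0 hCs] := stochastic_majorant dM fr h_ge0 h_le h_radial h_int c0 N_gt0 c1_gt0
  h0_ge0 p'_ge1 s'0.
pose D := 2 `^ p' * (Cb * b `^ (p' * s') + Cs) + 1.
have D0 : 0 < D by rewrite ltr_wpDl// mulr_ge0 ?powR_ge0// addr_ge0// mulr_ge0// powR_ge0.
exists (D `^ p'^-1); first exact: powR_gt0.
move=> dT T P Z f n j [f0 [mf _] _ [th [v [fexp fnorm]]] fA] SA fh Jh n0 /andP[j1 j2].
have fB : finite_set (index_box n) := finite_index_box R n.
pose I := enum_fset (fset_set (index_box n)).
have uI : uniq I by exact: fset_uniq.
have sI : size I = card_box n by [].
have I0 : (0 < size I)%N by rewrite sI; exact: (card_index_box_gt0 R n0).
pose m := (card_box n)%:R : R.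
have m0 : 0 < m by rewrite ltr0n -sI.
have m1 : 1 <= m by rewrite ler1n -sI.
have mt1 : 1 <= m `^ (2 * s' + 1)^-1.
  by rewrite -[leLHS](powRr0 m) ler_powR// invr_ge0 ltW.
(* A negative level would contradict [1 <= m ^ (1 / (2 s' + 1)) < b ^ (j + 1)]. *)
have [k jk] : exists k : nat, j = k%:Z.
  case: j j1 j2 => [k|k] j1 j2; first by exists k.
  exfalso; have : b ^ (Negz k + 1) <= 1.
    rewrite NegzE -(addn1 k) PoszD opprD subrK -exprnN invf_le1 ?exprn_gt0//.
    exact: exprn_ege1 (ltW b1).
  by rewrite leNgt (le_lt_trans mt1 j2).
subst j; have {}j1 : b ^+ k <= m `^ (2 * s' + 1)^-1 by [].
have {}j2 : m `^ (2 * s' + 1)^-1 < b ^+ k.+1 by move: j2; rewrite -PoszD addn1.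
have [G [mG G0 GS GP]] := hCs dT T P Z f I k SA fh Jh uI I0 j1.
have estE w x : linear_estimator M Phi n k%:Z (fun s => Z s w) x =
    \sum_(g \in [set: Zd]) ((size I)%:R^-1 * \sum_(s <- I) dilate M Phi k%:Z g (Z s w)) *
       dilate M Phi k%:Z g x.
  by apply: eq_fsbigr => g _; rewrite /theta_hat fsbig_finite.
have mproj : measurable_fun [set: Rd] (level_proj M Psi f k).
  exact: measurable_dilate_sum (fr_supp fr (ndet_gt0 dM)) (fr_meas fr (ndet_gt0 dM)).
have mest w : measurable_fun [set: Rd] (linear_estimator M Phi n k%:Z (fun s => Z s w)).
  exact: measurable_dilate_sum (fr_supp fr (ndet_gt0 dM)) (fr_meas fr (ndet_gt0 dM)).
pose bias := Cb * b `^ (- (k%:R * (p' * s'))).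
have bias0 : 0 <= bias by rewrite mulr_ge0// powR_ge0.
have split_le w : (\int[leb d.+1]_x
    (`|f x - linear_estimator M Phi n k%:Z (fun s => Z s w) x| `^ p')%:E <=
    (2 `^ p')%:E * (bias%:E + G w))%E.
  pose u1 x := (`|f x - level_proj M Psi f k x| `^ p')%:E.
  pose u2 x := (`|level_proj M Psi f k x - linear_estimator M Phi n k%:Z (fun s => Z s w) x| `^ p')%:E.
  have mu1 : measurable_fun [set: Rd] u1.
    by apply: measurable_norm_powR; exact: measurable_funB.
  have mu2 : measurable_fun [set: Rd] u2.
    by apply: measurable_norm_powR; apply: measurable_funB; [exact: mproj|exact: mest].
  have u10 x : (0 <= u1 x)%E by rewrite lee_fin powR_ge0.
  have u20 x : (0 <= u2 x)%E by rewrite lee_fin powR_ge0.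
  apply: (@le_trans _ _ (\int[leb d.+1]_x ((2 `^ p')%:E * (u1 x + u2 x)))%E).
    apply: le_integral_ge0 => x; first by rewrite lee_fin powR_ge0.
    rewrite /u1 /u2 -EFinD -EFinM lee_fin.
    pose t (c : bool) := if c then f x - level_proj M Psi f k x
      else level_proj M Psi f k x - linear_estimator M Phi n k%:Z (fun s => Z s w) x.
    have := powR_sum_le t p'0; rewrite card_bool !big_bool /t /=.
    by rewrite addrA subrK.
  rewrite ge0_integralZl ?lee_fin ?powR_ge0//; last 2 first.
  - exact: emeasurable_funD.
  - by move=> x _; rewrite adde_ge0.
  rewrite lee_wpmul2l ?lee_fin ?powR_ge0// ge0_integralD//; apply: leeD.
    exact: (hCb f th v mf fA fexp fnorm k).
  by apply: le_trans (GS w); under eq_integral do rewrite /u2 estE.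
have total : (\int[P]_w \int[leb d.+1]_x
    (`|f x - linear_estimator M Phi n k%:Z (fun s => Z s w) x| `^ p')%:E <=
    (D * m `^ (- (p' * (s' / (2 * s' + 1)))))%:E)%E.
  apply: (@le_trans _ _ (\int[P]_w ((2 `^ p')%:E * (bias%:E + G w)))%E).
    apply: le_integral_ge0 => w; last exact: split_le.
    by apply: integral_ge0 => x _; rewrite lee_fin powR_ge0.
  rewrite ge0_integralZl ?lee_fin ?powR_ge0//; last 2 first.
  - by apply: emeasurable_funD => //; exact: measurable_cst.
  - by move=> w _; rewrite adde_ge0// lee_fin.
  rewrite ge0_integralD// integral_cst//= [X in (_ * (_ * X + _))%E](@probability_setT _ _ _ P) mule1.
  apply: (@le_trans _ _ ((2 `^ p')%:E * (bias%:E + (Cs * (b ^+ k / m) `^ (p' / 2))%:E))%E).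
    by rewrite lee_wpmul2l ?lee_fin ?powR_ge0// leeD2l.
  rewrite -EFinD -EFinM lee_fin.
  pose e := m `^ (- (p' * (s' / (2 * s' + 1)))).
  have e0 : 0 <= e by exact: powR_ge0.
  have h1 : bias <= Cb * b `^ (p' * s') * e.
    rewrite /bias -mulrA ler_wpM2l//.
    have ps0 : 0 <= p' * s' by rewrite mulr_ge0 ?ltW.
    have -> : b `^ (- (k%:R * (p' * s'))) = b `^ (p' * s') * (b ^+ k.+1) `^ (- (p' * s')).
      rewrite -[b ^+ k.+1]powR_mulrn ?(ltW b0)// -powRrM -powR_add//.
      by congr (_ `^ _); rewrite -natr1; ring.
    rewrite ler_wpM2l ?powR_ge0// /e.
    have -> : m `^ (- (p' * (s' / (2 * s' + 1)))) = (m `^ (2 * s' + 1)^-1) `^ (- (p' * s')).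
      by rewrite -powRrM; congr (_ `^ _); ring.
    rewrite !powRN lef_pV2 ?posrE ?powR_gt0 ?exprn_gt0// ?(lt_le_trans ltr01 mt1)//.
    by rewrite ge0_ler_powR ?nnegrE ?powR_ge0 ?exprn_ge0 ?(ltW b0)// ltW.
  have h2 : (b ^+ k / m) `^ (p' / 2) <= e.
    apply: (@le_trans _ _ ((m `^ (2 * s' + 1)^-1 / m) `^ (p' / 2))).
      rewrite ge0_ler_powR ?nnegrE ?divr_ge0 ?powR_ge0 ?exprn_ge0 ?(ltW b0) ?(ltW m0) ?(ltW p'0)//.
      by rewrite ler_wpM2r// invr_ge0 ltW.
    rewrite -[m^-1](powR_inv1 (ltW m0)) -powR_add// -powRrM /e.
    rewrite le_eqVlt; apply/orP; left; apply/eqP; congr (_ `^ _).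
    by field; rewrite gt_eqF.
  rewrite -/e /D mulrDl mul1r -[leLHS]addr0 lerD//.
  rewrite -mulrA ler_wpM2l ?powR_ge0// mulrDl lerD//.
  by rewrite ler_wpM2l.
rewrite /estimator_risk.
apply: (@le_trans _ _ ((D * m `^ (- (p' * (s' / (2 * s' + 1)))))%:E `^ p'^-1)%E).
  apply: gt0_ler_poweR; rewrite ?in_itv/= ?leey ?andbT ?invr_ge0 ?(ltW p'0)//.
    by apply: integral_ge0 => w _; apply: integral_ge0 => x _; rewrite lee_fin powR_ge0.
  by rewrite lee_fin mulr_ge0 ?powR_ge0// ltW.
rewrite poweR_EFin lee_fin powRM ?powR_ge0 ?(ltW D0)// -powRrM.
rewrite le_eqVlt; apply/orP; left; apply/eqP; congr (_ * _ `^ _).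
by field; rewrite (gt_eqF p'0) (gt_eqF S0).
Qed.

End risk.

(** * Envelopes for the two parts *)

Section envelopes.
Context {R : realType} {d : nat}.
Local Notation Rd := ('cV[R]_d.+1).

(** The exponent [1 / (2k)] is at most [1/2] and [h] is bounded, so [sqrt h] is at
    most a constant times the given integrable power. *)
Lemma sqrt_integrable_powR (h : Rd -> R) (Bh : R) (k : nat) : (0 < k)%N ->
  (forall x, 0 <= h x) -> (forall x, h x <= Bh) ->
  (forall x y, norm2 y <= norm2 x -> h x <= h y) ->
  ('N[leb d.+1]_1%:E[(fun x => (h x `^ (2 * k%:R)^-1)%:E)] < +oo)%E ->
  (\int[leb d.+1]_x (Num.sqrt (h x))%:E < +oo)%E.
Proof.
move=> k0 h_ge0 hB hr; rewrite Lnorm1; set e := (2 * k%:R)^-1.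
have Bh0 : 0 <= Bh by exact: le_trans (h_ge0 0) (hB 0).
have k0' : 0 < k%:R :> R by rewrite ltr0n.
have e0 : 0 < e by rewrite invr_gt0 mulr_gt0.
have e2 : 0 <= 2^-1 - e.
  by rewrite subr_ge0 lef_pV2 ?posrE ?mulr_gt0// ler_peMr// ler1n.
under eq_integral do rewrite /= (ger0_norm (powR_ge0 _ _)).
move=> hoo; pose c := Bh `^ (2^-1 - e).
apply: (@le_lt_trans _ _ (\int[leb d.+1]_x (c%:E * (h x `^ e)%:E))%E).
  apply: le_integral_ge0 => x; first by rewrite lee_fin sqrtr_ge0.
  rewrite -EFinM lee_fin -(powR12_sqrt (h_ge0 x)).
  have [hx0|hx0] := eqVneq (h x) 0.
    by rewrite hx0 powR0 ?invr_neq0// mulr_ge0// powR_ge0.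
  have hx : 0 < h x by rewrite lt_def hx0 h_ge0.
  have -> : h x `^ 2^-1 = h x `^ (2^-1 - e) * h x `^ e.
    by rewrite -powR_add// subrK.
  by rewrite ler_wpM2r ?powR_ge0// ge0_ler_powR ?nnegrE.
rewrite ge0_integralZl ?lee_fin ?powR_ge0//; last first.
- by move=> x _; rewrite lee_fin powR_ge0.
- apply/measurable_EFinP; apply: (measurableT_comp (measurable_powR e)).
  exact: measurable_radial.
by apply: lte_mul_pinfty; rewrite ?lee_fin ?powR_ge0.
Qed.

(** Envelope for the second part: all densities of the Besov ball are bounded by the
    same constant and vanish outside of a ball containing [A]. *)
Definition ball_envelope (rho c : R) (x : Rd) : R := if norm2 x <= rho then c else 0.

Lemma ball_envelope_radial (rho c : R) : 0 <= c ->
  forall x y, norm2 y <= norm2 x -> ball_envelope rho c x <= ball_envelope rho c y.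
Proof.
move=> c0 x y yx; rewrite /ball_envelope; case: ifPn => [xr|_]; last by case: ifP.
by rewrite (le_trans yx xr).
Qed.

Lemma ball_envelope_sqrt_integrable (rho c : R) : 0 <= c -> 0 <= rho ->
  (\int[leb d.+1]_x (Num.sqrt (ball_envelope rho c x))%:E < +oo)%E.
Proof.
move=> c0 rho0; pose Q := [set x : Rd | forall i, - rho <= x i 0 <= rho].
have mQ : measurable Q by exact: measurable_cube.
apply: (@le_lt_trans _ _ (\int[leb d.+1]_x ((Num.sqrt c)%:E * (\1_Q x)%:E))%E).
  apply: le_integral_ge0 => x; first by rewrite lee_fin sqrtr_ge0.
  rewrite -EFinM lee_fin /ball_envelope; case: ifPn => [xr|_]; last first.
    by rewrite sqrtr0 mulr_ge0 ?sqrtr_ge0// indicE.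
  rewrite indicE mem_set ?mulr1// => i; rewrite -ler_norml; apply: le_trans xr.
  rewrite -sqrtr_sqr /norm2 ler_wsqrtr// (bigD1 i)//= lerDl.
  by apply: sumr_ge0 => k _; exact: sqr_ge0.
rewrite ge0_integralZl ?lee_fin ?sqrtr_ge0//; last first.
  by apply/measurable_EFinP; exact: measurable_indic.
rewrite integral_indic// setIT [X in (_ * X < _)%E](@leb_cube R d.+1); last by rewrite ge0_cp.
by rewrite -EFinM ltry.
Qed.

Lemma norm2_le_cube (x : Rd) (c : R) : (forall i, `|x i 0| <= c) ->
  norm2 x <= Num.sqrt (d.+1%:R * c ^+ 2).
Proof.
move=> xc; rewrite /norm2 ler_wsqrtr//.
have -> : d.+1%:R * c ^+ 2 = \sum_(i < d.+1) c ^+ 2 by rewrite sumr_const card_ord mulr_natl.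
apply: ler_sum => i _; rewrite -[leLHS]real_normK ?num_real//.
by apply: lerXn2r; rewrite ?nnegrE// (le_trans (normr_ge0 _) (xc i)).
Qed.

End envelopes.

(** * The rate of convergence *)

Theorem theorem2p1 (R : realType) (d N : nat) (N_gt0 : (0 < N)%N)
  (M : 'M[R]_d.+1) (M_dilation : dilation_matrix M)
  (Psi : nat -> 'cV[R]_d.+1 -> R) (Psi_wavelet : wavelet_system M Psi)
  (c0 c1 C' : R) (c0_gt0 : 0 < c0) (c1_gt0 : 0 < c1) (C'_gt0 : 0 < C')
  (p' : R) (p'_ge1 : 1 <= p')
  (p q : \bar R) (p_ge1 : (1 <= p)%E) (q_ge1 : (1 <= q)%E)
  (s : R) (s_gt : recip p < s)
  (A : set 'cV[R]_d.+1) (A_borel : measurable A)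
  (A_bounded : (p'%:E < p)%E -> bounded_set A)
  (K : R) (K_gt0 : 0 < K) :
  (forall h ht : 'cV[R]_d.+1 -> R,
    exists2 C1 : R, 0 < C1 &
    forall (dT : measure_display) (T : measurableType dT)
      (P : probability T R) (Z : 'cV[int]_N -> {RV P >-> 'cV[R]_d.+1})
      (f : 'cV[R]_d.+1 -> R),
      besov_density M Psi s p q K A f ->
      standing_assumptions Z c0 c1 f ->
      condition_D Z (if p' <= 2 then 1%N else 2%N) f h ht ->
      forall (n : 'I_N -> nat) (j : int), admissible C' n ->
        level M (s_prime s p' p) n j ->
        (estimator_risk M (Psi 0%N) Z f p' n j <=
         (C1 * (card_box n)%:R `^
            (- (s_prime s p' p / (2 * s_prime s p' p + 1))))%:E)%E) /\
  (bounded_set A -> forall h0 : R, 0 < h0 ->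
    exists2 C2 : R, 0 < C2 &
    forall (n : 'I_N -> nat) (j : int), admissible C' n ->
      level M (s_prime s p' p) n j ->
    forall (dT : measure_display) (T : measurableType dT)
      (P : probability T R) (Z : 'cV[int]_N -> {RV P >-> 'cV[R]_d.+1})
      (f : 'cV[R]_d.+1 -> R),
      besov_density M Psi s p q K A f ->
      standing_assumptions Z c0 c1 f ->
      joint_bounded Z h0 f ->
      (estimator_risk M (Psi 0%N) Z f p' n j <=
       (C2 * (card_box n)%:R `^
          (- (s_prime s p' p / (2 * s_prime s p' p + 1))))%:E)%E).
Proof.
have [L [B [a [F [mz fr]]]]] := finite_refinement_exists M_dilation Psi_wavelet.
split=> [h ht|A_bd h0 h0_gt0].
  pose k := if p' <= 2 then 1%N else 2%N.
  have k0 : (0 < k)%N by rewrite /k; case: ifP.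
  (* If [h], [ht] are not admissible envelopes no field satisfies the condition. *)
  case: (pselect [/\ radial_envelope h, radial_envelope ht &
      ('N[leb d.+1]_1%:E[(fun x => (h x `^ (2 * k%:R)^-1)%:E)] < +oo)%E]); last first.
    move=> nok; exists 1 => // dT T P Z f _ _ [D1 D2 _ _ D5 _].
    by exfalso; apply: nok.
  move=> [[h_ge0 [Bh hB] hr] [ht_ge0 [Bt htB] _] hint].
  have h_int := sqrt_integrable_powR k0 h_ge0 hB hr hint.
  have Bt0 : 0 <= Bt by exact: le_trans (ht_ge0 0) (htB 0).
  have [C C_gt0 hC] := risk_le M_dilation fr N_gt0 c0 c1_gt0 p'_ge1 p_ge1 q_ge1 s_gt
    A_bounded K h_ge0 hB hr h_int (sqr_ge0 Bt).
  exists C => // dT T P Z f fF fSA fD n j [n_gt0 _] jn.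
  apply: (hC _ _ _ _ _ _ _ fF fSA) => //; first exact: D_density fD.
  move=> u v uv; have [f2 Jf2 f2b] := D_joint fD uv; exists f2 => // z1 z2.
  by apply: (le_trans (f2b z1 z2)); rewrite expr2 ler_pM.
have [c c_ge0 cA] := bounded_set_cube A_bd.
pose Bs := Num.max 0 (partial_sum_bound M L B s p K).
have Bs0 : 0 <= Bs by rewrite le_max lexx.
pose rho : R := Num.sqrt (d.+1%:R * c ^+ 2).
pose h : 'cV[R]_d.+1 -> R := ball_envelope rho Bs.
have h_ge0 x : 0 <= h x by rewrite /h /ball_envelope; case: ifP.
have hB x : h x <= Bs by rewrite /h /ball_envelope; case: ifP.
have [C C_gt0 hC] := risk_le M_dilation fr N_gt0 c0 c1_gt0 p'_ge1 p_ge1 q_ge1 s_gt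
  A_bounded K h_ge0 hB (ball_envelope_radial rho Bs0)
  (ball_envelope_sqrt_integrable Bs0 (sqrtr_ge0 _)) (ltW h0_gt0).
exists C => // n j [n_gt0 _] jn dT T P Z f fF fSA fJ.
apply: (hC _ _ _ _ _ _ _ fF fSA) => //.
have [f_ge0 _ _ [th [v [fexp fnorm]]] fA] := fF.
apply: filterS fexp => x fx; rewrite /h /ball_envelope.
have [f0|fn0] := eqVneq (f x) 0; first by rewrite f0; case: ifP.
rewrite (norm2_le_cube (cA x (fA x fn0))) le_max; apply/orP; right.
rewrite -(cvg_lim _ fx)//; apply: limr_le; first by apply/cvg_ex; exists (f x).
apply: nearW => J; apply: (le_trans (ler_norm _)).
exact: (partial_sum_le M_dilation fr p_ge1 q_ge1 s_gt fnorm).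
Qed.
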